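(* Let $q\in\mathbb C$ with $0<|q|<1$ and let $\mathbb Y=\mathbb W_{13}\mathbb W_{23}\in\mathcal U(\mathcal H\otimes\mathcal H\otimes\mathcal H\otimes\mathcal H)=\mathcal U(\mathcal L\otimes\mathcal L)$. Then the operator $\mathbb F:=F_{|q|}(X)\,\mathbb Y$ is a manageable braided multiplicative unitary on $\mathcal L\otimes\mathcal L$ over $\mathbb T$ relative to $(\mathbb U,R)$.
   Context: $\zeta=q/\overline q$, $\overline{\mathbb C}^{|q|}=\{\lambda\in\mathbb C:|\lambda|\in|q|^{\mathbb Z}\}\cup\{0\}$. $\mathcal H=\ell^2(\mathbb Z)$ with orthonormal basis $(e_p)$; $\mathcal L=\mathcal H\otimes\mathcal H$ with basis $e_{i,j}=e_i\otimes e_j$. $\mathbb W\in\mathcal U(\mathcal H\otimes\mathcal H)$, $\mathbb W(e_k\otimes e_l)=e_k\otimes e_{l+k}$, is a manageable multiplicative unitary generating $\mathbb T$ (viewed as a quantum group), with associated positive operator $Q=\mathrm{id}_{\mathcal H}$. Hence $\mathbb Y(e_{i,j}\otimes e_{k,l})=e_{i,j}\otimes e_{k+i+j,l}$. $\mathbb T$ is quasitriangular with respect to the $R$-matrix $R(m,n)=\zeta^{mn}$, $m,n\in\mathbb Z$. The representation $\mathbb U$ of $\mathbb T$ on $\mathcal L$ is $\mathbb U(e_{i,j}\otimes e_p)=e_{i,j}\otimes e_{p+j}$ on $\mathcal L\otimes\mathcal H$. $X$ is the closed normal operator on $\mathcal L\otimes\mathcal L$ with $X(e_{i,j}\otimes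 e_{k,l})=\zeta^{-j}q^{k-i+1}e_{i-1,j-1}\otimes e_{k-1,l+1}$ (modulus $|X|(e_{i,j}\otimes e_{k,l})=|q|^{k-i+1}e_{i,j}\otimes e_{k,l}$); its spectrum is $\overline{\mathbb C}^{|q|}$. $F_{|q|}:\overline{\mathbb C}^{|q|}\to\mathbb T$ is $F_{|q|}(w)=\prod_{k=0}^\infty\frac{1+|q|^{2k}\overline w}{1+|q|^{2k}w}$ for $w\notin\{-|q|^{-2k}:k=0,1,\dots\}$ and $F_{|q|}(w)=-1$ otherwise. For these data the unitaries entering the definitions are $Z\in\mathcal U(\mathcal L\otimes\mathcal L)$, $Z(e_{i,j}\otimes e_{k,l})=\zeta^{-jl}e_{i,j}\otimes e_{k,l}$, the braiding $\Psi=Z\Sigma$ ($\Sigma$ the flip), i.e. $\Psi(e_{i,j}\otimes e_{k,l})=\zeta^{-jl}e_{k,l}\otimes e_{i,j}$, and $\widetilde Z\in\mathcal U(\overline{\mathcal L}\otimes\mathcal L)$, $\widetilde Z(\overline{e_{i,j}}\otimes e_{k,l})=\zeta^{jl}\,\overline{e_{i,j}}\otimes e_{k,l}$ ($\overline{\mathcal L}$ the conjugate Hilbert space). A unitary $\mathbb F$ on $\mathcal L\otimes\mathcal L$ is a braided multiplicative unitary over $\mathbb T$ relative to $(\mathbb U,R)$ if (1) $\mathbb F_{12}\mathbb U_{13}\mathbb U_{23}=\mathbb U_{13}\mathbb U_{23}\mathbb F_{12}$ on $\mathcal L\otimes\mathcal L\otimes\mathcal H$, and (2) $\mathbb F_{23}\mathbb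 F_{12}=\mathbb F_{12}\Psi_{23}\mathbb F_{12}\Psi_{23}^*\mathbb F_{23}$ on $\mathcal L\otimes\mathcal L\otimes\mathcal L$. It is manageable if there are a strictly positive operator $Q_{\mathcal L}$ on $\mathcal L$ (positive self-adjoint with trivial kernel) and a unitary $\widetilde{\mathbb F}\in\mathcal U(\overline{\mathcal L}\otimes\mathcal L)$ with $\mathbb F(Q_{\mathcal L}\otimes Q_{\mathcal L})\mathbb F^*=Q_{\mathcal L}\otimes Q_{\mathcal L}$, $\mathbb U(Q_{\mathcal L}\otimes Q)\mathbb U^*=Q_{\mathcal L}\otimes Q$, and $$\langle x\otimes u\mid Z^*\mathbb F\mid y\otimes w\rangle=\langle\overline y\otimes Q_{\mathcal L}u\mid\widetilde{\mathbb F}\widetilde Z^*\mid\overline x\otimes Q_{\mathcal L}^{-1}w\rangle$$ for all $x,y\in\mathcal L$, $u\in\mathcal D(Q_{\mathcal L})$, $w\in\mathcal D(Q_{\mathcal L}^{-1})$. *)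

(* Defs.v *)
From mathcomp Require Import all_boot all_order all_algebra.
From mathcomp Require Import complex.
From mathcomp Require Import all_classical all_reals all_analysis.

Set Implicit Arguments.
Unset Strict Implicit.
Unset Printing Implicit Defensive.
Import Order.TTheory GRing.Theory Num.Theory.
Import numFieldNormedType.Exports.

Local Open Scope classical_set_scope.
Local Open Scope ring_scope.
Local Open Scope complex_scope.

(* The Hilbert space with orthonormal basis indexed by
   I is modelled by its coordinates: l2(I), a subset of I -> R[i]. The tensor
   product of l2(I) and l2(J) is l2(I * J), with e_i (x) e_j = e_(i, j). The
   conjugate of l2(I) is again l2(I), through its orthonormal basis of the
   conjugates of the e_i; the vector conjugate to x is then conjv x. *)

Section Hilbert.
Variable R : realType.
Local Notation C := R[i].

Definition cabs (z : C) : R := complex.Re `|z|.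

(* Meaningful for absolutely summable f: esum is for nonnegative families. *)
Definition rsum (I : choiceType) (f : I -> R) : R :=
  fine (\esum_(i in [set: I]) (Num.max (f i) 0)%:E)
  - fine (\esum_(i in [set: I]) (Num.max (- f i) 0)%:E).

Definition csum (I : choiceType) (f : I -> C) : C :=
  rsum (fun i => complex.Re (f i)) +i* rsum (fun i => complex.Im (f i)).

Definition sqnorm (I : choiceType) (x : I -> C) : \bar R :=
  \esum_(i in [set: I]) (cabs (x i) ^+ 2)%:E.

Definition l2 (I : choiceType) (x : I -> C) : Prop := (sqnorm x < +oo)%E.

(* Antilinear in the first argument. *)
Definition inner (I : choiceType) (x y : I -> C) : C :=
  csum (fun i => (x i)^* * y i).

Definition delta (I : choiceType) (i : I) : I -> C := fun j => (j == i)%:R.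

Definition tens (I J : choiceType) (x : I -> C) (y : J -> C) : I * J -> C :=
  fun p => x p.1 * y p.2.

Definition conjv (I : choiceType) (x : I -> C) : I -> C := fun i => (x i)^*.

(* Everywhere defined operators from l2(I) to l2(J). Only the values on l2(I)
   are meaningful, and operators are compared on l2(I) only. *)
Definition op (I J : choiceType) : Type := (I -> C) -> (J -> C).

Definition linear_op (I J : choiceType) (T : op I J) : Prop :=
  (forall x, l2 x -> l2 (T x)) /\
  (forall (a : C) x y, l2 x -> l2 y ->
     T (fun i => a * x i + y i) = fun j => a * T x j + T y j).

Definition bounded_op (I J : choiceType) (T : op I J) : Prop :=
  linear_op T /\
  exists M : R, forall x, l2 x -> (sqnorm (T x) <= M%:E * sqnorm x)%E.

Definition unitary_op (I J : choiceType) (T : op I J) : Prop :=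
  [/\ linear_op T,
      forall x, l2 x -> sqnorm (T x) = sqnorm x &
      forall y, l2 y -> exists2 x, l2 x & T x = y].

(* The adjoint of a bounded operator: <e_i | T^* y> = <T e_i | y>. *)
Definition adj (I J : choiceType) (T : op I J) : op J I :=
  fun y i => inner (T (delta i)) y.

(* The operator with T e_i = f i, through its matrix in the bases. *)
Definition basis_op (I J : choiceType) (f : I -> J -> C) : op I J :=
  fun x j => csum (fun i => x i * f i j).

Definition leg12 (I J K : choiceType) (T : op (I * J)%type (I * J)%type) :
    op (I * J * K)%type (I * J * K)%type :=
  fun x '(i, j, k) => T (fun p => x (p.1, p.2, k)) (i, j).

Definition leg13 (I J K : choiceType) (T : op (I * K)%type (I * K)%type) :
    op (I * J * K)%type (I * J * K)%type :=
  fun x '(i, j, k) => T (fun p => x (p.1, j, p.2)) (i, k).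

Definition leg23 (I J K : choiceType) (T : op (J * K)%type (J * K)%type) :
    op (I * J * K)%type (I * J * K)%type :=
  fun x '(i, j, k) => T (fun p => x (i, p.1, p.2)) (j, k).

(* Possibly unbounded operators on l2(I), as graphs: A x y means that x is in
   the domain of A and A x = y. In particular A^-1 is the converse relation. *)
Definition uop (I : choiceType) : Type := (I -> C) -> (I -> C) -> Prop.

Definition is_uop (I : choiceType) (A : uop I) : Prop :=
  [/\ forall x y, A x y -> l2 x /\ l2 y,
      forall x y y', A x y -> A x y' -> y = y' &
      forall (a : C) x y x' y', A x y -> A x' y' ->
        A (fun i => a * x i + x' i) (fun i => a * y i + y' i)].

Definition densely_defined (I : choiceType) (A : uop I) : Prop :=
  forall x (e : R), l2 x -> 0 < e ->
    exists x' y', A x' y' /\ (sqnorm (fun i => x i - x' i)%R < e%:E)%E.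

Definition self_adjoint (I : choiceType) (A : uop I) : Prop :=
  [/\ is_uop A, densely_defined A &
      forall y z, A y z <->
        [/\ l2 y, l2 z & forall x x', A x x' -> inner x' y = inner x z]].

Definition strictly_positive (I : choiceType) (A : uop I) : Prop :=
  [/\ self_adjoint A,
      forall x y, A x y -> 0 <= inner x y &
      forall x y, A x y -> (forall i, y i = 0) -> forall i, x i = 0].

Definition id_uop (I : choiceType) : uop I := fun x y => l2 x /\ y = x.

(* A (x) B: the closure of its restriction to the algebraic tensor product of
   the domains, consisting of the finite sums of x_k (x) y_k. *)
Definition tens_uop (I J : choiceType) (A : uop I) (B : uop J) :
    uop (I * J)%type :=
  fun z w => [/\ l2 z, l2 w & forall e : R, 0 < e ->
    exists n (x x' : 'I_n -> I -> C) (y y' : 'I_n -> J -> C),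
      [/\ forall k, A (x k) (x' k),
          forall k, B (y k) (y' k),
          (sqnorm (fun p => z p - \sum_(k < n) tens (x k) (y k) p)%R < e%:E)%E &
          (sqnorm (fun p => w p - \sum_(k < n) tens (x' k) (y' k) p)%R < e%:E)%E]].

(* U A U^* for a unitary U. *)
Definition conj_uop (I : choiceType) (U : op I I) (A : uop I) : uop I :=
  fun z w => exists z' w', [/\ A z' w', z = U z' & w = U w'].

(* Borel functional calculus of normal operators, through the spectral theorem.
   The Borel space C is R * R, with (a, b) standing for a + i b. *)
Definition toC (z : R * R) : C := z.1 +i* z.2.

Notation cborel := (measurableTypeR R * measurableTypeR R)%type.

Definition cintegral (mu : {measure set cborel -> \bar R}) (D : set cborel)
    (f : C -> C) : C :=
  (\int[mu]_(z in D) complex.Re (f (toC z))) +i*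
  (\int[mu]_(z in D) complex.Im (f (toC z))).

(* E is a projection-valued measure on C, with mu x B = <x | E(B) x>;
   countable additivity of E is that of all the mu x. *)
Definition spectral_measure (I : choiceType) (E : set cborel -> op I I)
    (mu : (I -> C) -> {measure set cborel -> \bar R}) : Prop :=
  [/\ forall B, measurable B ->
        [/\ linear_op (E B), forall x, l2 x -> E B (E B x) = E B x &
            forall x y, l2 x -> l2 y -> inner (E B x) y = inner x (E B y)],
      forall x, l2 x -> E setT x = x,
      forall A B x, measurable A -> measurable B -> l2 x ->
        E (A `&` B) x = E A (E B x) &
      forall B x, measurable B -> l2 x ->
        mu x B = (complex.Re (inner x (E B x)))%:E].

(* X is the integral of the identity function of C with respect to E. *)
Definition spectral_resolution (I : choiceType) (X : uop I)
    (mu : (I -> C) -> {measure set cborel -> \bar R}) : Prop :=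
  [/\ is_uop X,
      forall x, (exists y, X x y) <->
        l2 x /\ (\int[mu x]_z (cabs (toC z) ^+ 2)%:E < +oo)%E &
      forall x y, X x y -> inner x y = cintegral (mu x) setT id].

(* T = f(X), where X is normal with spectral measure concentrated on the
   Borel set D and f is a bounded Borel function on D. *)
Definition is_fun_calc (I : choiceType) (X : uop I) (D : set cborel)
    (f : C -> C) (T : op I I) : Prop :=
  [/\ measurable D,
      measurable_fun D (fun z : cborel => complex.Re (f (toC z))),
      measurable_fun D (fun z : cborel => complex.Im (f (toC z))),
      exists M : R, forall z, D z -> cabs (f (toC z)) <= M &
      bounded_op T /\
      exists (E : set cborel -> op I I)
        (mu : (I -> C) -> {measure set cborel -> \bar R}),
        [/\ spectral_measure E mu,
            spectral_resolution X mu,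
            forall x, l2 x -> E D x = x &
            forall x, l2 x -> inner x (T x) = cintegral (mu x) D f]].

(* Braided multiplicative unitaries on l2(I) over a quantum group acting by the
   representation U on l2(I) (x) l2(H), for the braiding Psi of l2(I). *)
Definition braided_multiplicative_unitary (I H : choiceType)
    (U : op (I * H)%type (I * H)%type)
    (Psi F : op (I * I)%type (I * I)%type) : Prop :=
  [/\ unitary_op F,
      forall x, l2 x ->
        leg12 (K := H) F (leg13 (J := I) U (leg23 (I := I) U x)) =
        leg13 (J := I) U (leg23 (I := I) U (leg12 (K := H) F x)) &
      forall x, l2 x ->
        leg23 (I := I) F (leg12 (K := I) F x) =
        leg12 (K := I) F (leg23 (I := I) Psi (leg12 (K := I) F
          (leg23 (I := I) (adj Psi) (leg23 (I := I) F x))))].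

(* Zt and Ft act on the tensor product of the conjugate of l2(I) and l2(I);
   Q is the positive operator attached to the ambient quantum group. *)
Definition manageable (I H : choiceType) (U : op (I * H)%type (I * H)%type)
    (Q : uop H) (Z Zt F : op (I * I)%type (I * I)%type) : Prop :=
  exists (QL : uop I) (Ft : op (I * I)%type (I * I)%type),
    [/\ strictly_positive QL,
        unitary_op Ft,
        forall z w, conj_uop F (tens_uop QL QL) z w <-> tens_uop QL QL z w,
        forall z w, conj_uop U (tens_uop QL Q) z w <-> tens_uop QL Q z w &
        (* u' = QL u and w' = QL^-1 w *)
        forall x y u u' w w', l2 x -> l2 y -> QL u u' -> QL w' w ->
          inner (tens x u) (adj Z (F (tens y w))) =
          inner (tens (conjv y) u') (Ft (adj Zt (tens (conjv x) w')))].

End Hilbert.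

Section Data.
Variables (R : realType) (q : R[i]).
Local Notation C := R[i].

Local Notation Hix := int (only parsing).
Local Notation Lix := (int * int)%type (only parsing).
Local Notation LL := (Lix * Lix)%type (only parsing).
Local Notation e := (@delta R LL) (only parsing).

Definition zeta : C := q / q^*.

Definition W : op R (Hix * Hix)%type (Hix * Hix)%type :=
  @basis_op R (Hix * Hix)%type (Hix * Hix)%type (fun '(k, l) =>
    @delta R (Hix * Hix)%type (k, l + k)).

(* W_13 and W_23 on H (x) H (x) H (x) H = L (x) L. *)
Definition W13 : op R LL LL :=
  fun x '((i, j), (k, l)) => W (fun p => x ((p.1, j), (p.2, l))) (i, k).
Definition W23 : op R LL LL :=
  fun x '((i, j), (k, l)) => W (fun p => x ((i, p.1), (p.2, l))) (j, k).

Definition Y : op R LL LL := W13 \o W23.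

Definition U : op R (Lix * Hix)%type (Lix * Hix)%type :=
  @basis_op R (Lix * Hix)%type (Lix * Hix)%type (fun '((i, j), p) =>
    @delta R (Lix * Hix)%type ((i, j), p + j)).

Definition Rmatrix (m n : int) : C := zeta ^ (m * n).

Definition Zop : op R LL LL :=
  @basis_op R LL LL (fun '((i, j), (k, l)) =>
    fun p => (Rmatrix j l)^-1 * e ((i, j), (k, l)) p).

Definition flip : op R LL LL :=
  fun x p => x (p.2, p.1).

Definition Psi : op R LL LL := Zop \o flip.

(* On the tensor product of the conjugate of L and L. *)
Definition Ztilde : op R LL LL :=
  @basis_op R LL LL (fun '((i, j), (k, l)) =>
    fun p => Rmatrix j l * e ((i, j), (k, l)) p).

(* X is a weighted shift of the basis: its closure from the span of the basis
   has the maximal domain, all x in l2 for which the coordinatewise X x is. *)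
Definition X : uop R LL :=
  fun x y => [/\ l2 x, l2 y & y = @basis_op R LL LL (fun '((i, j), (k, l)) =>
    fun p => zeta ^ (- j) * q ^ (k - i + 1)
             * e ((i - 1, j - 1), (k - 1, l + 1)) p) x].

Definition Cbar : set (R * R) :=
  [set z | toC z = 0 \/ exists n : int, `|toC z| = `|q| ^ n].

Definition Fq (w : C) : C :=
  if `[< exists k : nat, w = - `|q| ^- (2 * k) >] then -1
  else lim ((fun n : nat => \prod_(k < n)
    ((1 + `|q| ^+ (2 * k) * w^*) / (1 + `|q| ^+ (2 * k) * w))
      : (R[i] : numFieldType)) @ \oo).

End Data.

(* Main.v *)
From HB Require Import structures.
Require Import Defs.
From mathcomp Require Import all_boot all_order all_algebra.
From mathcomp Require Import complex.
From mathcomp Require Import all_classical all_reals all_analysis.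
From mathcomp Require Import measurable_realfun.
From mathcomp Require Import ring lra zify.

(** Throughout, q = r ph with r = |q| and ph a phase, so that zeta = ph^2, and
    e_((i,j),(k,l)) is the basis of L (x) L.

    The functional calculus. The operator X moves the basis vectors along the
    orbits of (i, j, k, l) |-> (i-1, j-1, k-1, l+1), on which m = k-i+1 is
    constant. A diagonal unitary, the gauge, absorbs the phases of X, after which
    X is, on each orbit, r^m times the bilateral shift, that is, multiplication
    by the coordinate on the circle of radius r^m, read through Fourier series.
    So f(X) has to be the convolution on the orbits by the Fourier coefficients
    of t |-> f(r^m exp(2 pi i t)); this is the operator [Phi f]. It is
    multiplicative in f ([PhiM]) because the Fourier coefficients of a product
    are given by convolution ([fourierM]), which needs the completeness of the
    characters for all bounded Borel functions of exp(2 pi i t)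
    ([approximable_circle]). The spectral measure of X is B |-> Phi(1_B), its
    countable additivity and the moments of the measures <x | Phi(1_B) x> follow
    by bounded and monotone convergence, and f(X) = Phi f
    ([wshift_fun_calc]).

    The coefficients. With S(w) the product of the 1 + r^(2k) w, one has
    F(w) = S(conj w)/S(w) away from the zeros of S ([FqE]). Both S and 1/S are
    Euler series with explicit coefficients. For m >= 1 their Cauchy product
    gives the Fourier coefficients c_m(s) of F on the circle of radius r^m, as a
    series in powers of r^m that makes sense for all integers m. For m <= 0
    the product formula relates the circles of radii r^m and r^(2-m), and c_m(s)
    has the matching symmetry, so that the formula holds for all m
    ([fourier_Fq]). The recurrences of the two Euler series give two first-order
    relations between c_m and c_(m+1) ([cser_alpha], [cser_beta]), and the
    quotient of their coefficients gives a formula for c_m(-s) ([cser_flip]).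

    The braided multiplicative unitary. The matrix of F(X)Y is now explicit
    ([theFE]): its row at ((i,j),(k,l)) has entries a phase times c_(k-i+1)(s) at
    ((i+s,j+s),(k-i-j-s,l-s)). It is unitary since F has modulus 1, and
    covariant since j+l is preserved. In the pentagon equation the phases of
    corresponding matrix entries agree, and what remains is an identity between
    the coefficients,
      sum_t c_y(b-t) c_(x+y-1-b+t)(t) c_(x-b)(a-t) = c_x(a) c_(y+a)(b)
    ([cser_pentagon]). As functions of m = y+a and b, both sides satisfy the two
    first-order relations; for the sum this is a telescoping. Bounded solutions
    of these relations with a prescribed limit of their value at b = 0 as m
    tends to +oo are unique, because the Wronskian of two bounded solutions
    vanishes ([ladder_unique]); and in that limit only the term t = 0 of the sum
    survives, since c_y is a vector of norm at most 1 with c_y(0) -> 1.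

    Manageability. One takes Q_L e_(i,j) = r^j e_(i,j). The second unitary is
    again Phi F, in another gauge and between two monomial unitaries ([FtE]).
    Both sides of the matrix identity are continuous in x and y, so that x and y
    may be basis vectors; then the two sums agree term by term by
    [cser_flip]. *)

Set Implicit Arguments.
Unset Strict Implicit.
Unset Printing Implicit Defensive.
Import Order.TTheory GRing.Theory Num.Theory.
Import numFieldNormedType.Exports.

Local Open Scope classical_set_scope.
Local Open Scope ring_scope.
Local Open Scope complex_scope.

(** * Absolute value of complex numbers *)

Section Cabs.
Variable R : realType.
Local Notation C := R[i].
Implicit Types z w : C.

Lemma normE z : `|z| = (cabs z)%:C.
Proof. by rewrite /cabs normc_def. Qed.

Lemma cabsE z : cabs z = Num.sqrt (complex.Re z ^+ 2 + complex.Im z ^+ 2).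
Proof. by rewrite /cabs normc_def. Qed.

Lemma cabs_ge0 z : 0 <= cabs z.
Proof. by rewrite cabsE sqrtr_ge0. Qed.

Lemma cabs_sqr z : cabs z ^+ 2 = complex.Re z ^+ 2 + complex.Im z ^+ 2.
Proof. by rewrite cabsE sqr_sqrtr// addr_ge0 ?sqr_ge0. Qed.

Lemma cabsM z w : cabs (z * w) = cabs z * cabs w.
Proof. by apply: complexI; rewrite rmorphM /= -!normE normrM. Qed.

Lemma cabsD z w : cabs (z + w) <= cabs z + cabs w.
Proof. by rewrite -lecR rmorphD /= -!normE ler_normD. Qed.

Lemma cabsN z : cabs (- z) = cabs z.
Proof. by rewrite /cabs normrN. Qed.

Lemma cabsB z w : cabs (z - w) <= cabs z + cabs w.
Proof. by rewrite -(cabsN w) cabsD. Qed.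

Lemma cabs_distC z w : cabs (z - w) = cabs (w - z).
Proof. by rewrite /cabs distrC. Qed.

Lemma cabs0 : cabs (0 : C) = 0.
Proof. by rewrite /cabs normr0. Qed.

Lemma cabs1 : cabs (1 : C) = 1.
Proof. by rewrite /cabs normr1. Qed.

Lemma cabsJ z : cabs z^* = cabs z.
Proof. by rewrite /cabs normcJ. Qed.

Lemma cabsR (x : R) : cabs x%:C = `|x|.
Proof. by rewrite cabsE /= expr0n addr0 sqrtr_sqr. Qed.

Lemma cabs0_eq0 z : cabs z = 0 -> z = 0.
Proof. by move=> h; apply/eqP; rewrite -normr_eq0 normE h. Qed.

Lemma cabs_eq0 z : (cabs z == 0) = (z == 0).
Proof. by apply/eqP/eqP => [/cabs0_eq0//|->]; rewrite cabs0. Qed.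

Lemma cabsX z n : cabs (z ^+ n) = cabs z ^+ n.
Proof. by elim: n => [|n ih]; rewrite ?expr0 ?cabs1// !exprS cabsM ih. Qed.

Lemma cabsV z : cabs z^-1 = (cabs z)^-1.
Proof. by apply: complexI; rewrite fmorphV /= -!normE normfV. Qed.

Lemma cabs_exprz z (n : int) : cabs (z ^ n) = cabs z ^ n.
Proof. by case: n => n; rewrite ?NegzE -?exprnP -?exprnN ?cabsV cabsX. Qed.

Lemma cabs_Re z : `|complex.Re z| <= cabs z.
Proof. by rewrite -lecR -normE normc_ge_Re. Qed.

Lemma cabs_Im z : `|complex.Im z| <= cabs z.
Proof.
rewrite -[leLHS]sqrtr_sqr cabsE ler_sqrt ?addr_ge0 ?sqr_ge0//.
by rewrite lerDr sqr_ge0.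
Qed.

Lemma conjCM z : z^* * z = (cabs z ^+ 2)%:C.
Proof. by rewrite mulrC rmorphXn /= -normE sqr_normc. Qed.

Lemma cabs_sum (I : Type) (s : seq I) (P : pred I) (F : I -> C) :
  cabs (\sum_(i <- s | P i) F i) <= \sum_(i <- s | P i) cabs (F i).
Proof.
elim/big_ind2 : _ => [|x1 x2 y1 y2 h1 h2|//]; first by rewrite cabs0.
by rewrite (le_trans (cabsD _ _))// lerD.
Qed.

Lemma cabs_dist z w : `|cabs z - cabs w| <= cabs (z - w).
Proof.
have := cabsD (z - w) w; have := cabsD (w - z) z.
rewrite !subrK (cabs_distC w z) => h1 h2.
by rewrite ler_norml; apply/andP; split; lra.
Qed.

Lemma cabsD_sqr z w : cabs (z + w) ^+ 2 <= 2 * cabs z ^+ 2 + 2 * cabs w ^+ 2.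
Proof.
rewrite !cabs_sqr; case: z => a b; case: w => c d /=.
have := sqr_ge0 (a - c); have := sqr_ge0 (b - d); nra.
Qed.

Lemma conjE z : Num.conj z = conjc z.
Proof. by []. Qed.

Lemma Re_conjc z : complex.Re z^* = complex.Re z.
Proof. by case: z. Qed.

Lemma Im_conjc z : complex.Im z^* = - complex.Im z.
Proof. by case: z. Qed.

Lemma conjcM z w : conjc (z * w) = conjc z * conjc w.
Proof. exact: rmorphM. Qed.

Lemma conjc_sum (I : Type) (s : seq I) (P : pred I) (F : I -> C) :
  conjc (\sum_(i <- s | P i) F i) = \sum_(i <- s | P i) conjc (F i).
Proof. exact: rmorph_sum. Qed.

Lemma conjcB z w : conjc (z - w) = conjc z - conjc w.
Proof. exact: rmorphB. Qed.

Lemma conjcD z w : conjc (z + w) = conjc z + conjc w.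
Proof. exact: rmorphD. Qed.

Lemma complex_eqP z w :
  complex.Re z = complex.Re w -> complex.Im z = complex.Im w -> z = w.
Proof. by case: z w => [a b] [c d] /= -> ->. Qed.

Lemma Re_add z w : complex.Re (z + w) = complex.Re z + complex.Re w.
Proof. by case: z w => [? ?] []. Qed.

Lemma Re_sub z w : complex.Re (z - w) = complex.Re z - complex.Re w.
Proof. by case: z w => [? ?] []. Qed.

Lemma Im_sub z w : complex.Im (z - w) = complex.Im z - complex.Im w.
Proof. by case: z w => [? ?] []. Qed.

Lemma Re_mul z w : complex.Re (z * w) =
  complex.Re z * complex.Re w - complex.Im z * complex.Im w.
Proof. by case: z w => [a b] [c d]. Qed.

Lemma Im_mul z w : complex.Im (z * w) =
  complex.Re z * complex.Im w + complex.Im z * complex.Re w.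
Proof. by case: z w => [a b] [c d] /=. Qed.

Lemma cabs_unit_conj z : cabs z = 1 -> z^* = z^-1.
Proof.
move=> h; have z0 : z != 0 by rewrite -cabs_eq0 h oner_eq0.
by apply: (mulIf z0); rewrite conjCM h expr1n mulVf.
Qed.

End Cabs.

(** * Absolutely summable families *)

Section RealSums.
Variable R : realType.

Definition psum (I : choiceType) (f : I -> R) : \bar R :=
  \esum_(i in [set: I]) (f i)%:E.

Section OneIndex.
Variable I : choiceType.
Implicit Types f g : I -> R.

Lemma psum_ge0 f : (forall i, 0 <= f i) -> (0 <= psum f)%E.
Proof. by move=> h; apply: esum_ge0 => i _; rewrite lee_fin. Qed.

Lemma le_psum f g : (forall i, f i <= g i) -> (psum f <= psum g)%E.
Proof. by move=> h; apply: le_esum => i _; rewrite lee_fin. Qed.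

Lemma psumD f g : (forall i, 0 <= f i) -> (forall i, 0 <= g i) ->
  psum (fun i => f i + g i)%R = (psum f + psum g)%E.
Proof. by move=> hf hg; rewrite /psum -esumD// => i _; rewrite lee_fin. Qed.

Lemma psumZ (a : R) f : 0 <= a -> (forall i, 0 <= f i) ->
  psum (fun i => a * f i)%R = (a%:E * psum f)%E.
Proof.
move=> a0 f0; have [->|an0] := eqVneq a 0.
  by rewrite mul0e /psum esum1// => i _; rewrite mul0r.
have {an0}ap : 0 < a by rewrite lt_neqAle eq_sym an0.
apply/eqP; rewrite eq_le; apply/andP; split.
  apply: ge_ereal_sup => _ [X [finX _]] <-.
  under eq_fsbigr do rewrite EFinM.
  rewrite -ge0_mule_fsumr; last by move=> i; rewrite lee_fin.
  by rewrite lee_pmul2l//; apply: ereal_sup_ubound; exists X.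
rewrite -lee_pdivlMl//.
apply: ge_ereal_sup => _ [X [finX _]] <-.
rewrite lee_pdivlMl// ge0_mule_fsumr; last by move=> i; rewrite lee_fin.
by apply: ereal_sup_ubound; exists X.
Qed.

Lemma psum0 : psum (fun _ : I => 0 : R)%R = 0%E.
Proof. by rewrite /psum esum1. Qed.

Lemma psum_fin f : (forall i, 0 <= f i) -> (psum f < +oo)%E ->
  psum f = (fine (psum f))%:E.
Proof. by move=> f0 h; rewrite fineK// ge0_fin_numE// psum_ge0. Qed.

Lemma fine_psum_ge0 f : (forall i, 0 <= f i) -> 0 <= fine (psum f).
Proof. by move=> h; rewrite fine_ge0// psum_ge0. Qed.

Lemma psum_ge_term f i : (forall i, 0 <= f i) -> ((f i)%:E <= psum f)%E.
Proof.
move=> f0; apply: esum_ge; exists [set i]; last by rewrite fsbig_set1.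
by split => //; exact: finite_set1.
Qed.

Lemma psum_ge_seq f (s : seq I) : uniq s -> (forall i, 0 <= f i) ->
  ((\sum_(i <- s) f i)%:E <= psum f)%E.
Proof.
move=> us f0; apply: esum_ge; exists [set` s].
  by split => //; exact: finite_seq.
by rewrite -fsbig_seq// sumEFin.
Qed.

Lemma psum_le_seq f (M : \bar R) : (forall i, 0 <= f i) ->
  (forall s : seq I, uniq s -> ((\sum_(i <- s) f i)%:E <= M)%E) ->
  (psum f <= M)%E.
Proof.
move=> f0 h; apply: ge_ereal_sup => _ [X [finX _]] <-.
by rewrite fsbig_finite//= sumEFin h.
Qed.

Lemma psum_approx f (e : R) : (forall i, 0 <= f i) -> (psum f < +oo)%E ->
  0 < e -> exists2 s : seq I, uniq s &
    fine (psum f) - e < \sum_(i <- s) f i.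
Proof.
move=> f0 fin e0.
have /ereal_sup_gt [_ [X [finX _] <-]] : (((fine (psum f)) - e)%:E < psum f)%E.
  by rewrite [ltRHS]psum_fin// lte_fin ltrBlDr ltrDl.
rewrite fsbig_finite//= sumEFin lte_fin => h.
by exists (finmap.enum_fset (fset_set X)) => //; exact: finmap.fset_uniq.
Qed.

Lemma psum_tail f (e : R) : (forall i, 0 <= f i) -> (psum f < +oo)%E ->
  0 < e -> exists2 s : seq I, uniq s &
    (psum (fun i => if i \in s then 0 else f i)%R < e%:E)%E.
Proof.
move=> f0 fin e0; have [s us hs] := psum_approx f0 fin e0.
exists s => //.
have e1 : psum f = ((\sum_(i <- s) f i)%:E +
    psum (fun i => if i \in s then 0 else f i)%R)%E.
  rewrite [X in (X + _)%E](_ : _ = psum (fun i => if i \in s then f i else 0)%R).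
    rewrite -psumD.
    - by congr psum; apply/funext => i; case: ifP; rewrite ?addr0 ?add0r.
    - by move=> i; case: ifP.
    - by move=> i; case: ifP.
  apply/eqP; rewrite eq_le; apply/andP; split.
    rewrite [X in X%:E](_ : _ = \sum_(i <- s) if i \in s then f i else 0).
      by apply: psum_ge_seq => // i; case: ifP.
    by apply: eq_big_seq => i ->.
  apply: psum_le_seq => [i|t ut]; first by case: ifP.
  rewrite lee_fin -big_mkcond/= -big_filter.
  have sub : {subset [seq i <- t | i \in s] <= s}.
    by move=> i; rewrite mem_filter => /andP[].
  have ut' := filter_uniq (mem s) ut.
  have pe : perm_eq s ([seq i <- t | i \in s] ++
      [seq i <- s | i \notin [seq i <- t | i \in s]]).
    apply: uniq_perm => //.
      rewrite cat_uniq ut' filter_uniq// andbT.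
      by apply/hasPn => i; rewrite mem_filter => /andP[].
    move=> i; rewrite mem_cat [in X in _ || X]mem_filter.
    case: (boolP (i \in [seq i <- t | i \in s])) => //= /sub -> //.
  by rewrite (perm_big _ pe) big_cat/= lerDl sumr_ge0.
have fin2 : (psum (fun i => if (i \in s) then 0 else f i)%R < +oo)%E.
  apply: le_lt_trans fin; apply: le_psum => i; by case: ifP.
have f02 i : 0 <= (if i \in s then 0 else f i) by case: ifP.
rewrite psum_fin// in e1; rewrite [X in (_ + X)%E]psum_fin// in e1.
rewrite psum_fin// lte_fin.
by move: e1 => -[e1]; move: hs; rewrite e1; lra.
Qed.

Definition rsummable f := (psum (fun i => `|f i|)%R < +oo)%E.

Lemma rsumE f : rsum f =
  fine (psum (fun i => Num.max (f i) 0)%R) - fine (psum (fun i => Num.max (- f i) 0)%R).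
Proof. by []. Qed.

Lemma rsum_sub f g : (forall i, 0 <= f i) -> (forall i, 0 <= g i) ->
  (psum f < +oo)%E -> (psum g < +oo)%E ->
  rsum (fun i => f i - g i) = fine (psum f) - fine (psum g).
Proof.
move=> f0 g0 ff fg; rewrite rsumE.
set p := fun i => Num.max (f i - g i) 0; set n := fun i => Num.max (- (f i - g i)) 0.
have p0 i : 0 <= p i by rewrite le_max lexx orbT.
have n0 i : 0 <= n i by rewrite le_max lexx orbT.
have fp : (psum p < +oo)%E.
  by apply: le_lt_trans ff; apply: le_psum => i; rewrite ge_max f0 andbT gerBl g0.
have fn : (psum n < +oo)%E.
  apply: le_lt_trans fg; apply: le_psum => i.
  by rewrite ge_max g0 andbT opprB gerBl f0.
have : (psum p + psum g = psum n + psum f)%E.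
  rewrite -!psumD//; congr psum; apply/funext => i; rewrite /p /n.
  by case: (lerP (f i - g i) 0) => h; [rewrite max_l; lra|rewrite max_r; lra].
rewrite (psum_fin p0 fp) (psum_fin n0 fn) (psum_fin f0 ff) (psum_fin g0 fg).
by move=> -[]; lra.
Qed.

Lemma rsum_ge0 f : (forall i, 0 <= f i) -> rsum f = fine (psum f).
Proof.
move=> f0; rewrite rsumE [in X in _ - X](_ : (fun i => _) = fun=> 0).
  rewrite psum0 subr0; congr (fine (psum _)).
  by apply/funext => i; rewrite max_l.
by apply/funext => i; rewrite max_r// oppr_le0.
Qed.

Lemma rsummable_parts f : rsummable f ->
  (psum (fun i => Num.max (f i) 0)%R < +oo)%E /\
  (psum (fun i => Num.max (- f i) 0)%R < +oo)%E.
Proof.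
move=> h; split; apply: le_lt_trans h; apply: le_psum => i.
  by rewrite ge_max ler_norm normr_ge0.
by rewrite ge_max -normrN ler_norm normr_ge0.
Qed.

Lemma parts_sub (x : R) : x = Num.max x 0 - Num.max (- x) 0.
Proof. by case: (lerP x 0) => h; [rewrite max_l|rewrite max_r]; lra. Qed.

Lemma max0_ge0 (x : R) : 0 <= Num.max x 0.
Proof. by rewrite le_max lexx orbT. Qed.

Lemma rsumD f g : rsummable f -> rsummable g ->
  rsum (fun i => f i + g i) = rsum f + rsum g.
Proof.
move=> /rsummable_parts[fp fn] /rsummable_parts[gp gn].
rewrite [LHS](_ : _ = rsum (fun i => (Num.max (f i) 0 + Num.max (g i) 0) -
    (Num.max (- f i) 0 + Num.max (- g i) 0))); last first.
  by congr rsum; apply/funext => i; rewrite {1}(parts_sub (f i)) {1}(parts_sub (g i)); lra.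
have m0 := max0_ge0.
rewrite rsum_sub ?psumD ?lte_add_pinfty//; try by move=> i; rewrite addr_ge0.
rewrite !rsumE !fineD ?ge0_fin_numE ?psum_ge0//; lra.
Qed.

Lemma rsumN f : rsum (fun i => - f i) = - rsum f.
Proof.
rewrite !rsumE opprB; congr (_ - fine (psum _)).
by apply/funext => i; rewrite opprK.
Qed.

Lemma rsumZ (a : R) f : rsum (fun i => a * f i) = a * rsum f.
Proof.
wlog a0 : a / 0 <= a.
  move=> h; case: (lerP 0 a) => [/h//|a0].
  apply: oppr_inj; rewrite -rsumN -mulNr -h ?oppr_ge0 ?ltW//.
  by congr rsum; apply/funext => i; rewrite mulNr.
rewrite !rsumE mulrBr.
have e g : fine (psum (fun i => Num.max (a * g i) 0)%R) =
    a * fine (psum (fun i => Num.max (g i) 0)%R).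
  rewrite (_ : psum _ = psum (fun i => a * Num.max (g i) 0)%R).
    rewrite psumZ => [||i]//; last exact: max0_ge0.
    have [->|an0] := eqVneq a 0; first by rewrite mul0e mul0r.
    case: (psum _) => [r||] //=.
      by rewrite mulr0 gt0_muley// lte_fin lt_neqAle eq_sym an0.
    by rewrite mulr0 gt0_muleNy// lte_fin lt_neqAle eq_sym an0.
  by congr psum; apply/funext => i; rewrite maxr_pMr// mulr0.
rewrite e; congr (_ - _).
by rewrite -e; congr (fine (psum _)); apply/funext => i; rewrite mulrN.
Qed.

Lemma ler_rsum_norm f : rsummable f -> `|rsum f| <= fine (psum (fun i => `|f i|)%R).
Proof.
move=> h; have [hp hn] := rsummable_parts h.
have e : psum (fun i => `|f i|)%R = (psum (fun i => Num.max (f i) 0)%R +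
    psum (fun i => Num.max (- f i) 0)%R)%E.
  rewrite -psumD; try by move=> i; exact: max0_ge0.
  congr psum; apply/funext => i.
  case: (lerP (f i) 0) => fi; first by rewrite ler0_norm// max_l; lra.
  by rewrite gtr0_norm// max_r; lra.
rewrite e rsumE fineD ?ge0_fin_numE ?psum_ge0// => [|i|i]; try exact: max0_ge0.
rewrite (le_trans (ler_normB _ _))// !ger0_norm ?fine_psum_ge0// => i; exact: max0_ge0.
Qed.

Lemma rsummableD f g : rsummable f -> rsummable g -> rsummable (fun i => f i + g i).
Proof.
move=> hf hg; apply: (@le_lt_trans _ _ (psum (fun i => `|f i| + `|g i|)%R)).
  by apply: le_psum => i; exact: ler_normD.
by rewrite psumD// lte_add_pinfty.
Qed.

Lemma rsummableZ (a : R) f : rsummable f -> rsummable (fun i => a * f i).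
Proof.
move=> hf; rewrite /rsummable [X in (X < _)%E](_ : _ = psum (fun i => `|a| * `|f i|)%R).
  by rewrite psumZ// lte_mul_pinfty.
by congr psum; apply/funext => i; rewrite normrM.
Qed.

End OneIndex.

(** Both sides are suprema over finite sets. *)
Lemma psum_reindex (I J : choiceType) (h : J -> I) (f : I -> R) :
  injective h -> (forall i, (forall j, h j <> i) -> f i = 0) ->
  psum f = psum (f \o h).
Proof.
move=> hinj h0; rewrite /psum.
rewrite -(esum_image [set: J] h (fun i => (f i)%:E)); last by move=> x y _ _ /hinj.
rewrite [RHS]esum_mkcond; apply: eq_esum => i _.
case: ifPn => //; rewrite notin_setE => hi; rewrite h0// => j hj.
by apply: hi; exists j.
Qed.

Lemma rsum_reindex (I J : choiceType) (h : J -> I) (f : I -> R) :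
  injective h -> (forall i, (forall j, h j <> i) -> f i = 0) ->
  rsum f = rsum (f \o h).
Proof.
move=> hinj h0; rewrite !rsumE; congr (fine _ - fine _).
  by rewrite (psum_reindex hinj) // => i /h0 ->; rewrite maxxx.
by rewrite (psum_reindex hinj) // => i /h0 ->; rewrite oppr0 maxxx.
Qed.

Lemma psum_pair (I J : choiceType) (F : I * J -> R) : (forall p, 0 <= F p) ->
  psum F = \esum_(i in [set: I]) psum (fun j => F (i, j))%R.
Proof.
move=> F0; rewrite /psum (esum_esum (J := fun=> [set: J]) (a := fun i j => (F (i, j))%:E)).
  rewrite (_ : [set: I] `*`` _ = setT); last by apply/seteqP; split.
  by apply: eq_esum => -[].
by move=> i j _ _; rewrite lee_fin.
Qed.

Lemma psum_pair_fin (I J : choiceType) (F : I * J -> R) : (forall p, 0 <= F p) ->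
  (psum F < +oo)%E ->
  (forall i, psum (fun j => F (i, j))%R < +oo)%E /\
  psum F = psum (fun i => fine (psum (fun j => F (i, j))))%R.
Proof.
move=> F0 fin.
have h i : (psum (fun j => F (i, j))%R < +oo)%E.
  apply: le_lt_trans fin; rewrite psum_pair//.
  apply: esum_ge; exists [set i]; last by rewrite fsbig_set1.
  by split => //; exact: finite_set1.
split => //; rewrite psum_pair//; apply: eq_esum => i _.
by rewrite psum_fin.
Qed.

Lemma rsum_pair (I J : choiceType) (F : I * J -> R) : rsummable F ->
  rsum F = rsum (fun i => rsum (fun j => F (i, j))).
Proof.
move=> hF; have [hp hn] := rsummable_parts hF.
have [h1 e1] := psum_pair_fin (fun p => max0_ge0 (F p)) hp.
have [h2 e2] := psum_pair_fin (fun p => max0_ge0 (- F p)) hn.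
rewrite rsumE e1 e2 -rsum_sub -?e1 -?e2//.
- by move=> i; apply: fine_psum_ge0 => j; exact: max0_ge0.
- by move=> i; apply: fine_psum_ge0 => j; exact: max0_ge0.
Qed.

End RealSums.

Section ComplexSums.
Variable R : realType.
Local Notation C := R[i].

Definition asum (I : choiceType) (f : I -> C) := (psum (fun i => cabs (f i)) < +oo)%E.

Definition anorm (I : choiceType) (f : I -> C) : R := fine (psum (fun i => cabs (f i))).

Section OneIndex.
Variable I : choiceType.
Implicit Types f g : I -> C.

Lemma anorm_ge0 f : 0 <= anorm f.
Proof. by apply: fine_psum_ge0 => i; exact: cabs_ge0. Qed.

Lemma asumP f : asum f -> psum (fun i => cabs (f i)) = (anorm f)%:E.
Proof. by move=> h; apply: psum_fin => // i; exact: cabs_ge0. Qed.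

Lemma asum_le f g : asum g -> (forall i, cabs (f i) <= cabs (g i)) -> asum f.
Proof. by move=> hg h; apply: le_lt_trans hg; exact: le_psum. Qed.

Lemma anorm_le f (g : I -> R) : (psum g < +oo)%E ->
  (forall i, cabs (f i) <= g i) -> asum f /\ anorm f <= fine (psum g).
Proof.
move=> hg h; have g0 i : 0 <= g i by rewrite (le_trans _ (h i))// cabs_ge0.
have af : asum f by apply: le_lt_trans hg; exact: le_psum.
split => //; rewrite -lee_fin -asumP// -psum_fin//; exact: le_psum.
Qed.

Lemma asum_Re f : asum f -> rsummable (fun i => complex.Re (f i)).
Proof. by apply: le_lt_trans; apply: le_psum => i; exact: cabs_Re. Qed.

Lemma asum_Im f : asum f -> rsummable (fun i => complex.Im (f i)).
Proof. by apply: le_lt_trans; apply: le_psum => i; exact: cabs_Im. Qed.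

Lemma asumD f g : asum f -> asum g -> asum (fun i => f i + g i).
Proof.
move=> hf hg; apply: (@le_lt_trans _ _ (psum (fun i => cabs (f i) + cabs (g i))%R)).
  by apply: le_psum => i; exact: cabsD.
by rewrite psumD ?lte_add_pinfty// => i; exact: cabs_ge0.
Qed.

Lemma asumZ (a : C) f : asum f -> asum (fun i => a * f i).
Proof.
move=> hf; rewrite /asum [X in (X < _)%E](_ : _ = psum (fun i => cabs a * cabs (f i))%R).
  by rewrite psumZ ?lte_mul_pinfty ?lee_fin ?cabs_ge0// => i; exact: cabs_ge0.
by congr psum; apply/funext => i; rewrite cabsM.
Qed.

Lemma asumN f : asum f -> asum (fun i => - f i).
Proof. by move=> h; apply: (asum_le h) => i; rewrite cabsN. Qed.

Lemma csumD f g : asum f -> asum g -> csum (fun i => f i + g i) = csum f + csum g.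
Proof.
move=> hf hg; rewrite /csum.
under [X in rsum X +i* _]eq_fun do rewrite raddfD.
under [X in _ +i* rsum X]eq_fun do rewrite raddfD.
by rewrite (rsumD (asum_Re hf) (asum_Re hg)) (rsumD (asum_Im hf) (asum_Im hg)).
Qed.

Lemma csumZ (a : C) f : asum f -> csum (fun i => a * f i) = a * csum f.
Proof.
move=> hf; rewrite /csum.
under [X in rsum X +i* _]eq_fun do rewrite Re_mul.
under [X in _ +i* rsum X]eq_fun do rewrite Im_mul.
have h1 b := rsummableZ b (asum_Re hf); have h2 b := rsummableZ b (asum_Im hf).
apply: complex_eqP; rewrite ?Re_mul ?Im_mul /=.
  rewrite rsumD//; last by have := rsummableZ (-1) (h2 (complex.Im a)); under eq_fun do rewrite mulN1r.
  by rewrite rsumN !rsumZ.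
by rewrite rsumD// !rsumZ.
Qed.

Lemma csumZr (a : C) f : asum f -> csum (fun i => f i * a) = csum f * a.
Proof. by move=> hf; rewrite mulrC -csumZ//; congr csum; apply/funext => i; rewrite mulrC. Qed.

Lemma csumN f : csum (fun i => - f i) = - csum f.
Proof.
rewrite /csum; under [X in rsum X +i* _]eq_fun do rewrite raddfN.
under [X in _ +i* rsum X]eq_fun do rewrite raddfN.
by rewrite !rsumN.
Qed.

Lemma csumB f g : asum f -> asum g -> csum (fun i => f i - g i) = csum f - csum g.
Proof. by move=> hf hg; rewrite csumD ?csumN//; exact: asumN. Qed.

Lemma csum_conj f : csum (fun i => (f i)^*) = (csum f)^*.
Proof.
rewrite /csum; apply: complex_eqP => /=.
  by congr rsum; apply/funext => i; case: (f i).
by rewrite -rsumN; congr rsum; apply/funext => i; case: (f i).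
Qed.

Lemma rsum0 : rsum (fun _ : I => 0 : R) = 0.
Proof. by rewrite rsum_ge0// psum0. Qed.

Lemma csum0 : csum (fun _ : I => 0 : C) = 0.
Proof. by rewrite /csum /= rsum0. Qed.

Lemma csum_real (f : I -> R) : csum (fun i => (f i)%:C) = (rsum f)%:C.
Proof. by rewrite /csum /= rsum0. Qed.

Lemma cabs_csum f : asum f -> cabs (csum f) <= anorm f.
Proof.
move=> hf; have [->|c0] := eqVneq (csum f) 0; first by rewrite cabs0 anorm_ge0.
pose u := (csum f)^* / (cabs (csum f))%:C.
have n0 : (cabs (csum f))%:C != 0 by rewrite -cabs_eq0 cabsR normr_eq0 cabs_eq0.
have hu : u * csum f = (cabs (csum f))%:C.
  by rewrite /u mulrAC conjCM -rmorphV/= ?unitfE ?cabs_eq0// -rmorphM/= expr2 mulfK// cabs_eq0.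
have cu : cabs u = 1.
  by rewrite /u cabsM cabsJ cabsV cabsR ger0_norm ?cabs_ge0// mulfV// cabs_eq0.
have -> : cabs (csum f) = rsum (fun i => complex.Re (u * f i)).
  by have := hu; rewrite -csumZ// => /(congr1 (@complex.Re R)).
have hs := asum_Re (asumZ u hf).
rewrite (le_trans (ler_norm _))// (le_trans (ler_rsum_norm hs))//.
rewrite -lee_fin -psum_fin// -asumP//; apply: le_psum => i.
by rewrite (le_trans (cabs_Re _))// cabsM cu mul1r.
Qed.

End OneIndex.

Lemma csum_reindex (I J : choiceType) (h : J -> I) (f : I -> C) :
  injective h -> (forall i, (forall j, h j <> i) -> f i = 0) ->
  csum f = csum (f \o h).
Proof.
by move=> hinj h0; rewrite /csum !(rsum_reindex hinj)// => i /h0 ->.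
Qed.

Lemma csum_bij (I J : choiceType) (h : J -> I) (f : I -> C) :
  bijective h -> csum f = csum (fun j => f (h j)).
Proof.
move=> [g hg gh]; rewrite (@csum_reindex _ _ h)//; first exact: can_inj hg.
by move=> i /(_ (g i)); rewrite gh.
Qed.

Lemma psum_bij (I J : choiceType) (h : J -> I) (f : I -> R) :
  bijective h -> psum f = psum (fun j => f (h j)).
Proof.
move=> [g hg gh]; rewrite (@psum_reindex R _ _ h)//; first exact: can_inj hg.
by move=> i /(_ (g i)); rewrite gh.
Qed.

Lemma psum_inj_le (I J : choiceType) (h : J -> I) (f : I -> R) :
  injective h -> (forall i, 0 <= f i) -> (psum (f \o h) <= psum f)%E.
Proof.
move=> hinj f0; apply: psum_le_seq => [j|s us]; first exact: f0.
rewrite -(big_map h predT f); apply: psum_ge_seq => //.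
by rewrite map_inj_uniq.
Qed.

Lemma asum_inj (I J : choiceType) (h : J -> I) (f : I -> C) :
  injective h -> asum f -> asum (fun j => f (h j)).
Proof.
move=> hinj; apply: le_lt_trans.
by apply: (psum_inj_le hinj (f := fun i => cabs (f i))) => i; exact: cabs_ge0.
Qed.

Lemma psum_unit (f : unit -> R) : 0 <= f tt -> psum f = (f tt)%:E.
Proof.
move=> f0; rewrite /psum (_ : [set: unit] = [set tt]) ?esum_set1//.
by apply/seteqP; split => -[].
Qed.

Lemma psum_single (I : choiceType) (i0 : I) (f : I -> R) : 0 <= f i0 ->
  (forall i, i != i0 -> f i = 0) -> psum f = (f i0)%:E.
Proof.
move=> f0 h; rewrite (@psum_reindex R I unit (fun=> i0)) ?psum_unit//.
  by move=> [] [].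
by move=> i /(_ tt) hi; apply: h; apply/eqP => e; apply: hi.
Qed.

Lemma csum_single (I : choiceType) (i0 : I) (f : I -> C) :
  (forall i, i != i0 -> f i = 0) -> csum f = f i0.
Proof.
move=> h; rewrite (@csum_reindex I unit (fun=> i0)).
- have rs (x : R) : rsum (fun _ : unit => x) = x.
    rewrite rsumE !psum_unit ?max0_ge0//= [RHS]parts_sub//.
  by rewrite /csum /= !rs; case: (f i0).
- by move=> [] [].
- by move=> i /(_ tt) hi; apply: h; apply/eqP => e; apply: hi.
Qed.

Lemma asum_single (I : choiceType) (i0 : I) (f : I -> C) :
  (forall i, i != i0 -> f i = 0) -> asum f.
Proof.
move=> h; rewrite /asum (@psum_single _ i0) ?ltry ?cabs_ge0// => i /h ->.
by rewrite cabs0.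
Qed.

Lemma csum_seq (I : choiceType) (s : seq I) (f : I -> C) : uniq s ->
  (forall i, i \notin s -> f i = 0) ->
  asum f /\ csum f = \sum_(i <- s) f i.
Proof.
elim: s f => [|x s ih] f.
  move=> _ h; have -> : f = fun=> 0 by apply/funext => i; exact: h.
  rewrite big_nil csum0; split => //.
  by rewrite /asum; under eq_fun do rewrite cabs0; rewrite psum0.
move=> /= /andP[xs us] h.
pose f1 i := if i == x then f i else 0; pose f2 i := if i == x then 0 else f i.
have ef : f = fun i => f1 i + f2 i.
  by apply/funext => i; rewrite /f1 /f2; case: ifP; rewrite ?addr0 ?add0r.
have z1 i : i != x -> f1 i = 0 by rewrite /f1 => /negbTE ->.
have [|a2 c2] := ih f2 us.
  by move=> i hi; rewrite /f2; case: eqP => // /eqP ix; rewrite h// in_cons negb_or ix.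
have a1 := asum_single z1.
rewrite big_cons {1 2}ef csumD// c2; split; first exact: asumD.
rewrite (csum_single z1) /f1 eqxx; congr (_ + _).
by apply: eq_big_seq => i hi; rewrite /f2; case: eqP => // ix; rewrite -ix hi in xs.
Qed.

Lemma csum_pair (I J : choiceType) (F : I * J -> C) : asum F ->
  csum F = csum (fun i => csum (fun j => F (i, j))).
Proof.
by move=> hF; rewrite /csum /= (rsum_pair (asum_Re hF)) (rsum_pair (asum_Im hF)).
Qed.

Lemma asum_pair (I J : choiceType) (F : I * J -> C) :
  (forall i, asum (fun j => F (i, j))) ->
  (psum (fun i => anorm (fun j => F (i, j))) < +oo)%E -> asum F.
Proof.
move=> h1 h2; rewrite /asum psum_pair; last by move=> p; exact: cabs_ge0.
rewrite [X in (X < _)%E](_ : _ = psum (fun i => anorm (fun j => F (i, j)))) //.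
by apply: eq_esum => i _; rewrite asumP.
Qed.

Lemma asum_slice (I J : choiceType) (F : I * J -> C) i :
  asum F -> asum (fun j => F (i, j)).
Proof. by apply: asum_inj => x y [->]. Qed.

(** A finite set carries almost all of the mass of f, and there g n is
    eventually equal to f. *)
Lemma csum_dominated (I : choiceType) (f : I -> C) (g : nat -> I -> C) :
  asum f -> (forall n i, cabs (g n i) <= cabs (f i)) ->
  (forall i, \forall n \near \oo, g n i = f i) ->
  cabs (csum (g n) - csum f) @[n --> \oo] --> (0 : R).
Proof.
move=> hf gf gcvg; apply/cvgrPdist_le => e e0.
have [|s us hs] := psum_tail (fun i => cabs_ge0 (f i)) hf (e := e / 2).
  by rewrite divr_gt0.
have near_s : \forall n \near \oo, forall i, i \in s -> g n i = f i.
  elim: s us {hs} => [_|x s ih /= /andP[_ us]]; first by apply: nearW => n i.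
  near=> n => i; rewrite in_cons => /orP[/eqP ->|].
    near: n; exact: gcvg.
  move: i; near: n; exact: ih.
near=> n.
have hn : forall i, i \in s -> g n i = f i by near: n; exact: near_s.
have ag : asum (g n) by exact: asum_le hf (gf n).
rewrite sub0r normrN ger0_norm ?cabs_ge0// -csumB//.
have h0 i : 0 <= (if i \in s then 0 else cabs (f i)) by case: ifP => // _; exact: cabs_ge0.
have ftail : (psum (fun i => 2 * (if i \in s then 0 else cabs (f i)))%R < +oo)%E.
  by rewrite psumZ// lte_mul_pinfty// (lt_trans hs) ?ltry.
have [|ad nd] := @anorm_le _ (fun i => g n i - f i) _ ftail.
  move=> i; case: ifP => [/hn ->|_]; first by rewrite subrr cabs0 mulr0.
  by rewrite (le_trans (cabsB _ _))// mulr2n mulrDl !mul1r lerD2r.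
rewrite (le_trans (cabs_csum ad))// (le_trans nd)//.
rewrite psumZ// fineM ?ge0_fin_numE ?psum_ge0 ?(lt_trans hs) ?ltry//=.
have := hs; rewrite [X in (X < _)%E](psum_fin h0) ?(lt_trans hs) ?ltry// lte_fin; lra.
Unshelve. all: by end_near. Qed.

End ComplexSums.

(** * Square-summable families *)

Arguments csum : simpl never.
Arguments inner : simpl never.
Arguments rsum : simpl never.

Section L2.
Variable R : realType.
Local Notation C := R[i].

Lemma le_of_sqr (a b : R) : 0 <= b -> a ^+ 2 <= b ^+ 2 -> a <= b.
Proof. by move=> b0 h; rewrite leNgt; apply/negP => ba; nra. Qed.

Definition nsq (I : choiceType) (x : I -> C) : R := fine (sqnorm x).

Section OneIndex.
Variable I : choiceType.
Implicit Types x y z : I -> C.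

Lemma sqnormE x : sqnorm x = psum (fun i => cabs (x i) ^+ 2).
Proof. by []. Qed.

Lemma sqnorm_ge0 x : (0 <= sqnorm x)%E.
Proof. by apply: psum_ge0 => i; exact: sqr_ge0. Qed.

Lemma nsq_ge0 x : 0 <= nsq x.
Proof. by rewrite fine_ge0// sqnorm_ge0. Qed.

Lemma l2_sqnorm x : l2 x -> sqnorm x = (nsq x)%:E.
Proof. by move=> h; apply: psum_fin => // i; exact: sqr_ge0. Qed.

Lemma l2_le x (M : R) : (sqnorm x <= M%:E)%E -> l2 x /\ nsq x <= M.
Proof.
move=> h; have lx : l2 x by rewrite /l2 (le_lt_trans h)// ltry.
by split => //; rewrite -lee_fin -l2_sqnorm.
Qed.

Lemma nsq_term x i : l2 x -> cabs (x i) ^+ 2 <= nsq x.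
Proof.
move=> lx; rewrite -lee_fin -l2_sqnorm//.
by apply: (psum_ge_term (f := fun i => cabs (x i) ^+ 2)) => j; exact: sqr_ge0.
Qed.

Lemma l2D x y : l2 x -> l2 y -> l2 (fun i => x i + y i).
Proof.
move=> lx ly.
apply: (@le_lt_trans _ _ (psum (fun i => 2 * cabs (x i) ^+ 2 + 2 * cabs (y i) ^+ 2)%R)).
  by apply: le_psum => i; exact: cabsD_sqr.
have h (z : I -> C) i : 0 <= cabs (z i) ^+ 2 by exact: sqr_ge0.
have h2 (z : I -> C) i : 0 <= 2 * cabs (z i) ^+ 2 by rewrite mulr_ge0.
by rewrite (psumD (h2 x) (h2 y)) !psumZ// lte_add_pinfty// lte_mul_pinfty.
Qed.

Lemma sqnormZ (a : C) x : sqnorm (fun i => a * x i) = ((cabs a ^+ 2)%:E * sqnorm x)%E.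
Proof.
rewrite !sqnormE -psumZ ?sqr_ge0//; last by move=> i; exact: sqr_ge0.
by congr psum; apply/funext => i; rewrite cabsM exprMn.
Qed.

Lemma l2Z (a : C) x : l2 x -> l2 (fun i => a * x i).
Proof. by move=> lx; rewrite /l2 sqnormZ lte_mul_pinfty// lee_fin sqr_ge0. Qed.

Lemma l2_lin (a : C) x y : l2 x -> l2 y -> l2 (fun i => a * x i + y i).
Proof. by move=> lx ly; apply: l2D => //; exact: l2Z. Qed.

Lemma l2_0 : l2 (fun _ : I => 0 : C).
Proof. by rewrite /l2 sqnormE; under eq_fun do rewrite cabs0 expr0n; rewrite psum0. Qed.

Lemma sqnorm_unimod (u : I -> C) x : (forall i, cabs (u i) = 1) ->
  sqnorm (fun i => u i * x i) = sqnorm x.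
Proof. by move=> u1; congr psum; apply/funext => i; rewrite cabsM u1 mul1r. Qed.

Lemma sqnorm_conj x : sqnorm (fun i => (x i)^*) = sqnorm x.
Proof. by congr psum; apply/funext => i; rewrite cabsJ. Qed.

Lemma sqnorm_delta (i : I) : sqnorm (delta R i) = 1%E.
Proof.
rewrite sqnormE (@psum_single R I i) ?sqr_ge0// /delta ?eqxx ?cabs1 ?expr1n//.
by move=> j /negbTE ->; rewrite cabs0 expr0n.
Qed.

Lemma l2_delta (i : I) : l2 (delta R i).
Proof. by rewrite /l2 sqnorm_delta ltry. Qed.

Definition restr (s : seq I) x : I -> C := fun i => if i \in s then x i else 0.

Definition corestr (s : seq I) x : I -> C := fun i => if i \in s then 0 else x i.

Lemma l2_restr s x : l2 x -> l2 (restr s x).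
Proof.
apply: le_lt_trans; apply: le_psum => i; rewrite /restr; case: ifP => // _.
by rewrite cabs0 expr0n sqr_ge0.
Qed.

Lemma l2_corestr s x : l2 x -> l2 (corestr s x).
Proof.
apply: le_lt_trans; apply: le_psum => i; rewrite /corestr; case: ifP => // _.
by rewrite cabs0 expr0n sqr_ge0.
Qed.

Lemma sqnorm_restr s x : (sqnorm (restr s x) <= sqnorm x)%E.
Proof.
apply: le_psum => i; rewrite /restr; case: ifP => // _.
by rewrite cabs0 expr0n sqr_ge0.
Qed.

Lemma restr_corestr s x i : x i = restr s x i + corestr s x i.
Proof. by rewrite /restr /corestr; case: ifP; rewrite ?addr0 ?add0r. Qed.

Lemma l2_corestr_small x (e : R) : l2 x -> 0 < e ->
  exists2 s, uniq s & nsq (corestr s x) < e.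
Proof.
move=> lx e0; have [s us hs] := psum_tail (fun i => sqr_ge0 (cabs (x i))) lx e0.
exists s => //; rewrite -lte_fin -l2_sqnorm; last exact: l2_corestr.
rewrite (le_lt_trans _ hs)//; apply: le_psum => i; rewrite /corestr.
by case: ifP; rewrite ?cabs0 ?expr0n.
Qed.

(** The Cauchy-Schwarz inequality, in a form that also gives summability: the
    discriminant of t^2 |x|^2 - 2 t S + |y|^2 is nonpositive. *)
Lemma cauchy_schwarz x y : l2 x -> l2 y ->
  asum (fun i => x i * y i) /\ anorm (fun i => x i * y i) ^+ 2 <= nsq x * nsq y.
Proof.
move=> lx ly; set f := fun i => x i * y i.
have key (t : R) : 0 <= t ->
    (psum (fun i => (2 * t) * cabs (f i))%R <= (t ^+ 2 * nsq x + nsq y)%R%:E)%E.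
  move=> t0; rewrite EFinD EFinM -!l2_sqnorm// !sqnormE -psumZ ?sqr_ge0//; last first.
    by move=> i; exact: sqr_ge0.
  rewrite -psumD => [|i|i]; rewrite ?mulr_ge0 ?sqr_ge0 ?cabs_ge0//.
  apply: le_psum => i; rewrite cabsM.
  have := sqr_ge0 (t * cabs (x i) - cabs (y i)); nra.
have af : asum f.
  have := key 1 ler01; rewrite mulr1 psumZ//; last by move=> i; exact: cabs_ge0.
  rewrite /asum; case: (psum _) => [r _||]; rewrite ?ltry ?ltNyr//.
  by rewrite gt0_muley ?lte_fin// leye_eq.
split => //; set S := anorm f; have S0 : 0 <= S by exact: anorm_ge0.
have {}key (t : R) : 0 <= t -> 2 * t * S <= t ^+ 2 * nsq x + nsq y.
  move=> t0; rewrite -lee_fin (le_trans _ (key t t0))// psumZ ?mulr_ge0//.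
    by rewrite asumP.
  by move=> i; exact: cabs_ge0.
have X0 := nsq_ge0 x; have Y0 := nsq_ge0 y.
have [X00|Xn0] := eqVneq (nsq x) 0.
  rewrite X00 mul0r; have [->|Sn0] := eqVneq S 0; first by rewrite expr0n.
  have Sp : 0 < S by rewrite lt_neqAle eq_sym Sn0.
  have := key ((nsq y + 1) / (2 * S)); rewrite divr_ge0 ?mulr_ge0 ?addr_ge0//.
  move=> /(_ isT); rewrite X00 mulr0 add0r.
  have -> : 2 * ((nsq y + 1) / (2 * S)) * S = nsq y + 1 by field.
  lra.
have Xp : 0 < nsq x by rewrite lt_neqAle eq_sym Xn0.
have := key (S / nsq x); rewrite divr_ge0// => /(_ isT).
have -> : 2 * (S / nsq x) * S = 2 * (S ^+ 2 / nsq x) by field.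
have -> : (S / nsq x) ^+ 2 * nsq x = S ^+ 2 / nsq x by field.
rewrite mulr2n mulrDl mul1r lerD2l ler_pdivrMr//; by rewrite mulrC.
Qed.

Lemma asum_inner x y : l2 x -> l2 y -> asum (fun i => (x i)^* * y i).
Proof.
move=> lx ly; have [] // := @cauchy_schwarz (fun i => (x i)^*) y.
by rewrite /l2 sqnorm_conj.
Qed.

Lemma inner_le x y : l2 x -> l2 y -> cabs (inner x y) ^+ 2 <= nsq x * nsq y.
Proof.
move=> lx ly; have lx' : l2 (fun i => (x i)^*) by rewrite /l2 sqnorm_conj.
have [a h] := cauchy_schwarz lx' ly.
have -> : nsq x = nsq (fun i => (x i)^*) by rewrite /nsq sqnorm_conj.
by apply: le_trans h; rewrite ler_sqr ?nnegrE ?cabs_ge0 ?anorm_ge0// cabs_csum.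
Qed.

Lemma inner_linr x (a : C) y z : l2 x -> l2 y -> l2 z ->
  inner x (fun i => a * y i + z i) = a * inner x y + inner x z.
Proof.
move=> lx ly lz; rewrite /inner.
under [X in csum X]eq_fun do rewrite mulrDr mulrCA.
have ay := asum_inner lx ly; have az := asum_inner lx lz.
by rewrite csumD ?csumZ//; exact: asumZ.
Qed.

Lemma inner_conj x y : inner y x = (inner x y)^*.
Proof.
rewrite /inner -csum_conj; congr csum; apply/funext => i.
by rewrite rmorphM /= conjcK mulrC.
Qed.

Lemma inner_self x : l2 x -> inner x x = (nsq x)%:C.
Proof.
move=> lx; rewrite /inner; under eq_fun do rewrite conjCM.
by rewrite csum_real rsum_ge0// => i; exact: sqr_ge0.
Qed.

Lemma inner_deltal (i : I) y : inner (delta R i) y = y i.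
Proof.
rewrite /inner (@csum_single R _ i) /delta ?eqxx ?conjE ?conjc_nat ?mul1r//.
by move=> j /negbTE ->; rewrite conjE conjc_nat mul0r.
Qed.

Lemma inner_deltar x (i : I) : inner x (delta R i) = (x i)^*.
Proof. by rewrite inner_conj inner_deltal. Qed.

(** Values outside l2 being meaningless, linearity is restricted to l2. *)
Definition linear_fun (phi : (I -> C) -> C) := forall (a : C) x y, l2 x -> l2 y ->
  phi (fun i => a * x i + y i) = a * phi x + phi y.

Lemma linear_fun_restr phi x (s : seq I) : linear_fun phi -> uniq s ->
  phi (restr s x) = \sum_(i <- s) x i * phi (delta R i).
Proof.
move=> lphi; have phi0 : phi (fun=> 0) = 0.
  have := lphi 1 _ _ l2_0 l2_0; rewrite !mul1r addr0.
  by move/eqP; rewrite -subr_eq subrr eq_sym => /eqP.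
elim: s => [_|i s ih /= /andP[is_ us]].
  by rewrite big_nil -[RHS]phi0; congr phi; apply/funext.
have fin (t : seq I) : uniq t -> l2 (restr t x).
  move=> ut; rewrite /l2 sqnormE.
  have [|a _] := @csum_seq R I t (fun i => restr t x i * restr t x i) ut.
    by move=> j jt; rewrite /restr (negbTE jt) mulr0.
  by move: a; rewrite /asum; under eq_fun do rewrite cabsM -expr2.
rewrite big_cons -ih// -(lphi (x i) _ _ (l2_delta i) (fin s us)).
congr phi; apply/funext => j; rewrite /restr /delta in_cons.
case: eqP => [->|_] /=; first by rewrite (negbTE is_) mulr1 addr0.
by rewrite mulr0 add0r.
Qed.

(** Uniformly bounded functionals converge as soon as they converge on the
    basis: a vector is finitely supported up to a small remainder. *)
Lemma functional_cvg (phi : nat -> (I -> C) -> C) (M : R) x :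
  (forall n, linear_fun (phi n)) ->
  (forall n y, l2 y -> cabs (phi n y) ^+ 2 <= M * nsq y) ->
  (forall i, cabs (phi n (delta R i)) @[n --> \oo] --> (0 : R)) ->
  l2 x -> cabs (phi n x) @[n --> \oo] --> (0 : R).
Proof.
move=> lphi bphi dphi lx; apply/cvgrPdist_le => e e0.
have M0 : 0 <= `|M| + 1 by rewrite addr_ge0.
have [|s us hs] := l2_corestr_small (e := (e / 2) ^+ 2 / (`|M| + 1)) lx.
  by rewrite divr_gt0 ?exprn_gt0 ?divr_gt0// ltr_wpDl.
have c1 : cabs (phi n (restr s x)) @[n --> \oo] --> (0 : R).
  apply: (@squeeze_cvgr _ _ _ _ (fun=> 0)
      (fun n => \sum_(i <- s) cabs (x i) * cabs (phi n (delta R i)))).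
  - apply: nearW => n; rewrite cabs_ge0/= linear_fun_restr// (le_trans (cabs_sum _ _ _))//.
    by apply: ler_sum => i _; rewrite cabsM.
  - exact: cvg_cst.
  - elim: (s) => [|i t ih]; first by under eq_fun do rewrite big_nil; exact: cvg_cst.
    under eq_fun do rewrite big_cons.
    have h := cvgD (cvgM (cvg_cst (cabs (x i))) (dphi i)) ih.
    by rewrite mulr0 addr0 in h; exact: h.
move/cvgrPdist_le : c1 => /(_ (e / 2)); rewrite divr_gt0// => /(_ isT) c1.
near=> n.
have hn : `|0 - cabs (phi n (restr s x))| <= e / 2 by near: n.
move: hn; rewrite !sub0r !normrN !ger0_norm ?cabs_ge0// => hn.
have -> : x = fun i => 1 * restr s x i + corestr s x i.
  by apply/funext => i; rewrite mul1r -restr_corestr.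
rewrite (lphi n 1 _ _ (l2_restr s lx) (l2_corestr s lx)) mul1r.
rewrite (le_trans (cabsD _ _))//.
suff hc : cabs (phi n (corestr s x)) <= e / 2 by lra.
have e20 : 0 <= e / 2 by rewrite divr_ge0// ltW.
apply: (le_of_sqr e20); apply: (le_trans (bphi n _ (l2_corestr s lx))).
apply: (@le_trans _ _ ((`|M| + 1) * nsq (corestr s x))).
  by rewrite ler_wpM2r ?nsq_ge0// (le_trans (ler_norm M))// lerDl.
by rewrite mulrC -ler_pdivlMr ?ltW// ltr_wpDl.
Unshelve. all: by end_near. Qed.

Lemma functional_ext (phi psi : (I -> C) -> C) (M N : R) x :
  linear_fun phi -> linear_fun psi ->
  (forall y, l2 y -> cabs (phi y) ^+ 2 <= M * nsq y) ->
  (forall y, l2 y -> cabs (psi y) ^+ 2 <= N * nsq y) ->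
  (forall i, phi (delta R i) = psi (delta R i)) ->
  l2 x -> phi x = psi x.
Proof.
move=> lphi lpsi bphi bpsi e lx.
have : cabs (phi x - psi x) @[n --> \oo] --> (0 : R).
  apply: (@functional_cvg (fun _ y => phi y - psi y) (2 * M + 2 * N)) => //.
  - by move=> _ a y z ly lz; rewrite lphi// lpsi//; ring.
  - move=> _ y ly; rewrite (le_trans (cabsD_sqr _ _))// cabsN.
    by have := bphi y ly; have := bpsi y ly; nra.
  - by move=> i; rewrite e subrr cabs0; exact: cvg_cst.
move=> /(cvg_unique _ (@cvg_cst _ _ _ _ _)) /= h.
by apply/eqP; rewrite -subr_eq0 -cabs_eq0 h.
Qed.

End OneIndex.

Lemma l2_inj (I J : choiceType) (h : J -> I) (x : I -> C) :
  injective h -> l2 x -> l2 (fun j => x (h j)).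
Proof.
move=> hinj; apply: le_lt_trans.
by apply: (psum_inj_le hinj (f := fun i => cabs (x i) ^+ 2)) => i; exact: sqr_ge0.
Qed.

Lemma sqnorm_bij (I J : choiceType) (h : J -> I) (x : I -> C) :
  bijective h -> sqnorm (fun j => x (h j)) = sqnorm x.
Proof. by move=> b; rewrite !sqnormE (psum_bij (h := h) _ b). Qed.

Lemma sqnorm_pair (I J : choiceType) (x : I * J -> C) :
  sqnorm x = \esum_(i in [set: I]) sqnorm (fun j => x (i, j)).
Proof. by rewrite sqnormE psum_pair// => p; exact: sqr_ge0. Qed.

Lemma sqnorm_tens (I J : choiceType) (x : I -> C) (y : J -> C) : l2 y ->
  sqnorm (tens x y) = (sqnorm x * sqnorm y)%E.
Proof.
move=> ly; rewrite sqnorm_pair.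
rewrite (eq_esum (b := fun i => ((nsq y * cabs (x i) ^+ 2)%:E))); last first.
  by move=> i _; rewrite /tens /= sqnormZ [in LHS]l2_sqnorm// -EFinM mulrC.
rewrite -/(psum (fun i => nsq y * cabs (x i) ^+ 2)%R).
by rewrite psumZ ?nsq_ge0// ?(l2_sqnorm ly)// 1?muleC// => i; exact: sqr_ge0.
Qed.

Lemma l2_tens (I J : choiceType) (x : I -> C) (y : J -> C) : l2 x -> l2 y ->
  l2 (tens x y) /\ nsq (tens x y) = nsq x * nsq y.
Proof.
move=> lx ly; rewrite /l2 /nsq sqnorm_tens// (l2_sqnorm lx) (l2_sqnorm ly).
by rewrite -EFinM ltry.
Qed.

End L2.

(** * Bounded operators *)

Section Operators.
Variable R : realType.
Local Notation C := R[i].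

Section TwoIndices.
Variables I J : choiceType.
Implicit Types T S : op R I J.

Lemma linear_op_coord T j : linear_op T -> linear_fun (fun x => T x j).
Proof. by move=> [_ lT] a x y lx ly; rewrite lT. Qed.

Lemma op_coord_le T (M : R) x j : l2 x -> l2 (T x) ->
  (sqnorm (T x) <= M%:E * sqnorm x)%E -> cabs (T x j) ^+ 2 <= M * nsq x.
Proof.
move=> lx lTx h; rewrite (le_trans (nsq_term j lTx))// -lee_fin EFinM.
by rewrite -!l2_sqnorm.
Qed.

(** The coordinates of the two operators are functionals to which
    functional_ext applies. *)
Lemma bounded_op_ext S T x : bounded_op S -> bounded_op T ->
  (forall i, S (delta R i) = T (delta R i)) -> l2 x -> S x = T x.
Proof.
move=> [lS [M bS]] [lT [N bT]] e lx; apply/funext => j.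
apply: (@functional_ext R I (fun x => S x j) (fun x => T x j) M N) => //.
- exact: linear_op_coord.
- exact: linear_op_coord.
- by move=> y ly; apply: op_coord_le => //; [apply lS|exact: bS].
- by move=> y ly; apply: op_coord_le => //; [apply lT|exact: bT].
- by move=> i; rewrite e.
Qed.

Lemma unitary_bounded T : unitary_op T -> bounded_op T.
Proof. by move=> [lT nT _]; split => //; exists 1 => x lx; rewrite mul1e nT. Qed.

(** To bound an operator it suffices to bound it on finitely supported vectors:
    its coordinates are continuous, and finite partial sums of the squared norm
    of the image pass to the limit. *)
Lemma bound_of_restr T (M : R) : (forall j, linear_fun (fun x => T x j)) ->
  (forall j, exists N : R, forall x, l2 x -> cabs (T x j) ^+ 2 <= N * nsq x) ->
  (forall s x, uniq s -> l2 x ->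
     (sqnorm (T (restr s x)) <= M%:E * sqnorm (restr s x))%E) ->
  0 <= M -> forall x, l2 x -> (sqnorm (T x) <= M%:E * sqnorm x)%E.
Proof.
move=> lT bT fT M0 x lx.
have /choice[s hs] (n : nat) : exists s : seq I, uniq s /\ nsq (corestr s x) < n.+1%:R^-1.
  by have [|s us h] := l2_corestr_small (e := n.+1%:R^-1) lx; [rewrite invr_gt0|exists s].
have cT j : cabs (T (restr (s n) x) j) @[n --> \oo] --> cabs (T x j).
  have [N hN] := bT j.
  apply/cvgrPdist_le => e e0.
  have c0 : (`|N| * n.+1%:R^-1) @[n --> \oo] --> (0 : R).
    rewrite -[X in _ --> X](mulr0 `|N|); apply: cvgMr; exact: cvg_harmonic.
  near=> n.
  rewrite (le_trans (cabs_dist _ _))//.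
  have -> : T x j = T (restr (s n) x) j + T (corestr (s n) x) j.
    rewrite -[T (restr _ _) j]mul1r -lT; [|exact: l2_restr|exact: l2_corestr].
    by congr (T _ j); apply/funext => i; rewrite mul1r -restr_corestr.
  rewrite addrC addKr; apply: le_of_sqr; first exact: ltW.
  apply: (le_trans (hN _ (l2_corestr (s n) lx))).
  apply: (@le_trans _ _ (`|N| * n.+1%:R^-1)).
    rewrite (le_trans (ler_wpM2r (nsq_ge0 _) (ler_norm N)))// ler_wpM2l//.
    by apply: ltW; have [] := hs n.
  near: n; move/cvgrPdist_le : c0 => /(_ (e ^+ 2)); rewrite exprn_gt0// => /(_ isT).
  by apply: filterS => n; rewrite sub0r normrN ger0_norm// mulr_ge0.
rewrite (l2_sqnorm lx) -EFinM; apply: psum_le_seq => [j|t ut]; first exact: sqr_ge0.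
rewrite lee_fin.
have ct : (\sum_(j <- t) cabs (T (restr (s n) x) j) ^+ 2) @[n --> \oo] -->
    \sum_(j <- t) cabs (T x j) ^+ 2.
  elim: (t) => [|j u ih].
    by rewrite big_nil; under eq_fun do rewrite big_nil; exact: cvg_cst.
  rewrite big_cons; under eq_fun do rewrite big_cons.
  by apply: cvgD ih; apply: cvgM; exact: cT.
apply: (cvgr_to_le ct); apply: nearW => n.
rewrite -lee_fin (le_trans (psum_ge_seq _ _))//; first by move=> j; exact: sqr_ge0.
rewrite -/(sqnorm _) EFinM -(l2_sqnorm lx).
rewrite (le_trans (fT _ _ _ lx))//; first by have [] := hs n.
by rewrite lee_wpmul2l ?lee_fin// sqnorm_restr.
Unshelve. all: by end_near. Qed.

End TwoIndices.

Lemma bounded_comp (I J K : choiceType) (S : op R J K) (T : op R I J) :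
  bounded_op S -> bounded_op T -> bounded_op (S \o T).
Proof.
move=> [[lS aS] [M bS]] [[lT aT] [N bT]]; split.
  split=> [x lx|a x y lx ly]; first by apply: lS; exact: lT.
  by rewrite /= aT// aS//; exact: lT.
exists (`|M| * N) => x lx; rewrite (le_trans (bS _ (lT _ lx)))//.
rewrite (@le_trans _ _ (`|M|%:E * sqnorm (T x))%E)//.
  by rewrite lee_wpmul2r ?sqnorm_ge0// lee_fin ler_norm.
by rewrite EFinM -muleA lee_wpmul2l ?lee_fin// bT.
Qed.

Lemma unitary_comp (I J K : choiceType) (S : op R J K) (T : op R I J) :
  unitary_op S -> unitary_op T -> unitary_op (S \o T).
Proof.
move=> [[lS aS] nS sS] [[lT aT] nT sT]; split.
- split=> [x lx|a x y lx ly]; first by apply: lS; exact: lT.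
  by rewrite /= aT// aS//; exact: lT.
- by move=> x lx; rewrite /= nS ?nT//; exact: lT.
- move=> z /sS[y ly <-]; have [x lx <-] := sT _ ly.
  by exists x.
Qed.

(** The norm that a contraction loses cannot be restored by another one. *)
Lemma unitary_of_inverse (I J : choiceType) (T : op R I J) (S : op R J I) :
  linear_op T -> linear_op S ->
  (forall x, l2 x -> (sqnorm (T x) <= sqnorm x)%E) ->
  (forall y, l2 y -> (sqnorm (S y) <= sqnorm y)%E) ->
  (forall x, l2 x -> S (T x) = x) -> (forall y, l2 y -> T (S y) = y) ->
  unitary_op T.
Proof.
move=> lT lS bT bS ST TS; split => //.
- move=> x lx; apply/eqP; rewrite eq_le bT//= -{1}(ST x lx) bS//.
  by case: lT => + _; exact.
- by move=> y ly; exists (S y); [case: lS => + _; exact|exact: TS].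
Qed.

(** When h is bijective and u unimodular, a permutation of the basis up to
    phases; h leads from a target index to its source. *)
Definition monomial (I J : choiceType) (u : J -> C) (h : J -> I) : op R I J :=
  fun x j => u j * x (h j).

Lemma monomial_unitary (I J : choiceType) (u : J -> C) (h : J -> I) :
  (forall j, cabs (u j) = 1) -> bijective h -> unitary_op (monomial u h).
Proof.
move=> u1 bh; have n x : sqnorm (monomial u h x) = sqnorm x.
  by rewrite (sqnorm_unimod (fun j => x (h j)) u1) (sqnorm_bij _ bh).
split=> //.
- split=> [x|a x y _ _]; first by rewrite /l2 n.
  by apply/funext => j; rewrite /monomial; ring.
- move=> y ly; have [g hg gh] := bh; exists (fun i => (u (g i))^-1 * y (g i)).
    rewrite /l2 -n (_ : monomial _ _ _ = y)//; apply/funext => j.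
    by rewrite /monomial hg mulVKf// -cabs_eq0 u1 oner_eq0.
  by apply/funext => j; rewrite /monomial hg mulVKf// -cabs_eq0 u1 oner_eq0.
Qed.

Lemma esum_sqnorm_le (K I J : choiceType) (x : K -> I -> C) (y : K -> J -> C) (M : R) :
  0 <= M -> (forall k, l2 (x k)) ->
  (forall k, (sqnorm (y k) <= M%:E * sqnorm (x k))%E) ->
  (\esum_(k in [set: K]) sqnorm (y k) <= M%:E * \esum_(k in [set: K]) sqnorm (x k))%E.
Proof.
move=> M0 lx h.
have -> : \esum_(k in [set: K]) sqnorm (x k) = psum (fun k => nsq (x k)).
  by apply: eq_esum => k _; rewrite l2_sqnorm.
rewrite -psumZ//; last by move=> k; exact: nsq_ge0.
by apply: le_esum => k _; rewrite EFinM -l2_sqnorm.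
Qed.

Section Legs.
Variables I J K : choiceType.

Lemma leg12E (T : op R (I * J)%type (I * J)%type) (x : I * J * K -> C) i j k :
  leg12 T x (i, j, k) = T (fun p => x (p, k)) (i, j).
Proof. by rewrite /leg12; congr (T _ _); apply/funext => -[]. Qed.

Lemma leg23E (T : op R (J * K)%type (J * K)%type) (x : I * J * K -> C) i j k :
  leg23 T x (i, j, k) = T (fun p => x (i, p.1, p.2)) (j, k).
Proof. by []. Qed.

Lemma bounded_leg12 (T : op R (I * J)%type (I * J)%type) :
  bounded_op T -> bounded_op (leg12 (K := K) T).
Proof.
move=> [[lT aT] [M bT]].
have bsw : bijective (fun p : K * (I * J) => (p.2, p.1)).
  by exists (fun p : (I * J) * K => (p.2, p.1)) => -[].
have lsl (x : I * J * K -> C) k : l2 x -> l2 (fun p => x (p, k)).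
  by move=> lx; apply: (l2_inj (h := fun p => (p, k)) _ lx) => p p' [].
have e (x : I * J * K -> C) :
    sqnorm x = \esum_(k in [set: K]) sqnorm (fun p => x (p, k)).
  by rewrite -(sqnorm_bij x bsw) sqnorm_pair.
have b x : l2 x -> (sqnorm (leg12 (K := K) T x) <= `|M|%:E * sqnorm x)%E.
  move=> lx; rewrite [leLHS]e (e x).
  apply: esum_sqnorm_le => // k; first exact: lsl.
  rewrite (_ : (fun p => _) = T (fun p => x (p, k))); last first.
    by apply/funext => -[i j]; rewrite leg12E.
  rewrite (le_trans (bT _ (lsl x k lx)))//.
  by rewrite lee_wpmul2r ?sqnorm_ge0// lee_fin ler_norm.
split; last by exists `|M|.
split=> [x lx|a x y lx ly].
  by rewrite /l2 (le_lt_trans (b x lx))// lte_mul_pinfty// lee_fin.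
apply/funext => -[[i j] k]; rewrite !leg12E.
by rewrite (aT a (fun p => x (p, k)) (fun p => y (p, k)))//; exact: lsl.
Qed.

Lemma bounded_leg23 (T : op R (J * K)%type (J * K)%type) :
  bounded_op T -> bounded_op (leg23 (I := I) T).
Proof.
move=> [[lT aT] [M bT]].
have bsw : bijective (fun p : I * (J * K) => (p.1, p.2.1, p.2.2)).
  by exists (fun p : (I * J) * K => (p.1.1, (p.1.2, p.2))) => [[? []]|[[]]].
have lsl (x : I * J * K -> C) i : l2 x -> l2 (fun p => x (i, p.1, p.2)).
  move=> lx; apply: (l2_inj (h := fun p : J * K => (i, p.1, p.2)) _ lx).
  by move=> [? ?] [? ?] [-> ->].
have e (x : I * J * K -> C) :
    sqnorm x = \esum_(i in [set: I]) sqnorm (fun p => x (i, p.1, p.2)).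
  by rewrite -(sqnorm_bij x bsw) sqnorm_pair.
have b x : l2 x -> (sqnorm (leg23 (I := I) T x) <= `|M|%:E * sqnorm x)%E.
  move=> lx; rewrite [leLHS]e (e x).
  apply: esum_sqnorm_le => // i; first exact: lsl.
  rewrite (_ : (fun p => _) = T (fun p => x (i, p.1, p.2))); last first.
    by apply/funext => -[].
  rewrite (le_trans (bT _ (lsl x i lx)))//.
  by rewrite lee_wpmul2r ?sqnorm_ge0// lee_fin ler_norm.
split; last by exists `|M|.
split=> [x lx|a x y lx ly].
  by rewrite /l2 (le_lt_trans (b x lx))// lte_mul_pinfty// lee_fin.
apply/funext => -[[i j] k]; rewrite !leg23E.
by rewrite (aT a (fun p => x (i, p.1, p.2)) (fun p => y (i, p.1, p.2)))//; exact: lsl.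
Qed.

End Legs.

End Operators.

(** * Bounded measurable complex functions and their integrals *)

Section ComplexIntegral.
Context d (T : measurableType d) (R : realType).
Local Notation C := R[i].
Implicit Types f g : T -> C.

Definition cmeasurable f := measurable_fun [set: T] (fun z => complex.Re (f z)) /\
  measurable_fun [set: T] (fun z => complex.Im (f z)).

Definition bmeasurable f := cmeasurable f /\ exists M : R, forall z, cabs (f z) <= M.

Lemma cmeasurableD f g : cmeasurable f -> cmeasurable g -> cmeasurable (fun z => f z + g z).
Proof.
move=> [f1 f2] [g1 g2]; split.
  by under eq_fun do rewrite raddfD; exact: measurable_funD.
by under eq_fun do rewrite raddfD; exact: measurable_funD.
Qed.

Lemma cmeasurableM f g : cmeasurable f -> cmeasurable g -> cmeasurable (fun z => f z * g z).
Proof.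
move=> [f1 f2] [g1 g2]; split.
  by under eq_fun do rewrite Re_mul; apply: measurable_funB; exact: measurable_funM.
by under eq_fun do rewrite Im_mul; apply: measurable_funD; exact: measurable_funM.
Qed.

Lemma cmeasurable_cst (c : C) : cmeasurable (fun=> c).
Proof. by split; exact: measurable_cst. Qed.

Lemma cmeasurable_conj f : cmeasurable f -> cmeasurable (fun z => (f z)^*).
Proof.
move=> [f1 f2]; split.
  by under eq_fun do rewrite /= Re_conjc.
by under eq_fun do rewrite /= Im_conjc; exact: measurable_funN.
Qed.

Lemma cmeasurable_real (f : T -> R) : measurable_fun [set: T] f -> cmeasurable (fun z => (f z)%:C).
Proof. by move=> mf; split => //; exact: measurable_cst. Qed.

Lemma measurable_cabs_sqr f : cmeasurable f -> measurable_fun [set: T] (fun z => cabs (f z) ^+ 2).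
Proof.
move=> [f1 f2]; under eq_fun do rewrite cabs_sqr.
by apply: measurable_funD; exact: measurable_funX.
Qed.

Lemma bmeasurable_cst (c : C) : bmeasurable (fun=> c).
Proof. by split; [exact: cmeasurable_cst|exists (cabs c)]. Qed.

Lemma bmeasurableD f g : bmeasurable f -> bmeasurable g -> bmeasurable (fun z => f z + g z).
Proof.
move=> [mf [M bf]] [mg [N bg]]; split; first exact: cmeasurableD.
by exists (M + N) => z; rewrite (le_trans (cabsD _ _))// lerD.
Qed.

Lemma bmeasurableM f g : bmeasurable f -> bmeasurable g -> bmeasurable (fun z => f z * g z).
Proof.
move=> [mf [M bf]] [mg [N bg]]; split; first exact: cmeasurableM.
by exists (M * N) => z; rewrite cabsM ler_pM ?cabs_ge0.
Qed.

Lemma bmeasurable_conj f : bmeasurable f -> bmeasurable (fun z => (f z)^*).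
Proof.
move=> [mf [M bf]]; split; first exact: cmeasurable_conj.
by exists M => z; rewrite cabsJ.
Qed.

Lemma bmeasurableZ (c : C) f : bmeasurable f -> bmeasurable (fun z => c * f z).
Proof. by move=> bf; apply: bmeasurableM => //; exact: bmeasurable_cst. Qed.

Lemma bmeasurableN f : bmeasurable f -> bmeasurable (fun z => - f z).
Proof. by move=> /(bmeasurableZ (-1)); under eq_fun do rewrite mulN1r. Qed.

Lemma bmeasurableB f g : bmeasurable f -> bmeasurable g -> bmeasurable (fun z => f z - g z).
Proof. by move=> bf bg; apply: bmeasurableD => //; exact: bmeasurableN. Qed.

Lemma bmeasurable_sum (I : Type) (s : seq I) (F : I -> T -> C) :
  (forall i, bmeasurable (F i)) -> bmeasurable (fun z => \sum_(i <- s) F i z).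
Proof.
move=> bF; elim: s => [|i s ih].
  by under eq_fun do rewrite big_nil; exact: bmeasurable_cst.
by under eq_fun do rewrite big_cons; exact: bmeasurableD.
Qed.

Lemma bmeasurable_real (f : T -> R) (M : R) : measurable_fun [set: T] f ->
  (forall z, `|f z| <= M) -> bmeasurable (fun z => (f z)%:C).
Proof.
move=> mf bf; split; first exact: cmeasurable_real.
by exists M => z; rewrite cabsR.
Qed.

Lemma bmeasurable_indic (B : set T) : measurable B -> bmeasurable (fun z => (\1_B z)%:C).
Proof.
move=> mB; apply: (@bmeasurable_real _ 1); first exact: measurable_indic.
by move=> z; rewrite indicE ger0_norm//; case: (_ \in _).
Qed.

Variables (mu : {measure set T -> \bar R}) (D : set T).
Hypotheses (mD : measurable D) (finD : (mu D < +oo)%E).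

Definition cint f : C :=
  (\int[mu]_(z in D) complex.Re (f z)) +i* (\int[mu]_(z in D) complex.Im (f z)).

Lemma bounded_integrable (h : T -> R) (M : R) : measurable_fun [set: T] h ->
  (forall z, `|h z| <= M) -> mu.-integrable D (EFin \o h).
Proof.
move=> mh bh; apply: measurable_bounded_integrable => //.
  exact: measurable_funTS.
by exists M; split; [exact: num_real|move=> x Mx y _; exact: le_trans (bh y) (ltW Mx)].
Qed.

Lemma integrable_Re f : bmeasurable f -> mu.-integrable D (EFin \o (fun z => complex.Re (f z))).
Proof.
by move=> [[mf _] [M bf]]; apply: (@bounded_integrable _ M) => // z; rewrite (le_trans (cabs_Re _)).
Qed.

Lemma integrable_Im f : bmeasurable f -> mu.-integrable D (EFin \o (fun z => complex.Im (f z))).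
Proof.
by move=> [[_ mf] [M bf]]; apply: (@bounded_integrable _ M) => // z; rewrite (le_trans (cabs_Im _)).
Qed.

Lemma cintD f g : bmeasurable f -> bmeasurable g ->
  cint (fun z => f z + g z) = cint f + cint g.
Proof.
move=> bf bg; rewrite /cint; apply: complex_eqP => /=.
  under eq_Rintegral do rewrite raddfD.
  by rewrite (RintegralD mD (integrable_Re bf) (integrable_Re bg)).
under eq_Rintegral do rewrite raddfD.
by rewrite (RintegralD mD (integrable_Im bf) (integrable_Im bg)).
Qed.

Lemma cintZ (c : C) f : bmeasurable f -> cint (fun z => c * f z) = c * cint f.
Proof.
move=> bf; have h1 := integrable_Re bf; have h2 := integrable_Im bf.
have hz (h : T -> R) (a : R) : mu.-integrable D (EFin \o h) ->
    mu.-integrable D (EFin \o (fun z => a * h z)).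
  by move=> ih; exact: (integrableZl mD a ih).
rewrite /cint; apply: complex_eqP; rewrite ?Re_mul ?Im_mul /=.
  under eq_Rintegral do rewrite Re_mul.
  by rewrite (RintegralB mD (hz _ _ h1) (hz _ _ h2)) (RintegralZl _ mD h1) (RintegralZl _ mD h2).
under eq_Rintegral do rewrite Im_mul.
by rewrite (RintegralD mD (hz _ _ h2) (hz _ _ h1)) (RintegralZl _ mD h1) (RintegralZl _ mD h2).
Qed.

Lemma cintB f g : bmeasurable f -> bmeasurable g ->
  cint (fun z => f z - g z) = cint f - cint g.
Proof.
move=> bf bg; rewrite -[in RHS](mulN1r (cint g)) -cintZ//.
rewrite -cintD//; last exact: bmeasurableZ.
by congr cint; apply/funext => z; rewrite mulN1r.
Qed.

Lemma cint0 : cint (fun=> 0) = 0.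
Proof. by rewrite /cint /= Rintegral_cst// mul0r. Qed.

Lemma cint_sum (I : Type) (s : seq I) (F : I -> T -> C) :
  (forall i, bmeasurable (F i)) ->
  cint (fun z => \sum_(i <- s) F i z) = \sum_(i <- s) cint (F i).
Proof.
move=> bF; elim: s => [|i s ih].
  by under eq_fun do rewrite big_nil; rewrite big_nil cint0.
under eq_fun do rewrite big_cons.
by rewrite big_cons cintD ?ih//; exact: bmeasurable_sum.
Qed.

Lemma cint_conj f : bmeasurable f -> cint (fun z => (f z)^*) = (cint f)^*.
Proof.
move=> bf; apply: complex_eqP; rewrite /cint /=.
  by apply: eq_Rintegral => z _; case: (f z).
rewrite -[RHS]mulN1r -(RintegralZl _ mD (integrable_Im bf)).
by apply: eq_Rintegral => z _; case: (f z) => a b /=; rewrite mulN1r.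
Qed.

Lemma cint_real (h : T -> R) : cint (fun z => (h z)%:C) = (\int[mu]_(z in D) h z)%:C.
Proof. by rewrite /cint /= Rintegral_cst// mul0r. Qed.

Definition sqint f : R := \int[mu]_(z in D) (cabs (f z) ^+ 2).

Lemma integrable_sqint f : bmeasurable f ->
  mu.-integrable D (EFin \o (fun z => cabs (f z) ^+ 2)).
Proof.
move=> [mf [M bf]]; apply: (@bounded_integrable _ (M ^+ 2)).
  exact: measurable_cabs_sqr.
move=> z; rewrite ger0_norm ?sqr_ge0// lerXn2r ?nnegrE ?cabs_ge0//.
exact: le_trans (cabs_ge0 _) (bf z).
Qed.

Lemma sqint_ge0 f : 0 <= sqint f.
Proof. by apply: Rintegral_ge0 => z _; exact: sqr_ge0. Qed.

Lemma cint_sqint f : cint (fun z => (f z)^* * f z) = (sqint f)%:C.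
Proof. by under eq_fun do rewrite conjCM; rewrite cint_real. Qed.

Lemma sqint_le f g : bmeasurable f -> bmeasurable g ->
  (forall z, cabs (f z) <= cabs (g z)) -> sqint f <= sqint g.
Proof.
move=> bf bg h; apply: le_Rintegral => //; try exact: integrable_sqint.
by move=> z _; rewrite lerXn2r ?nnegrE ?cabs_ge0.
Qed.

Lemma sqint_le_cst f (M : R) : bmeasurable f -> (forall z, cabs (f z) <= M) ->
  sqint f <= M ^+ 2 * fine (mu D).
Proof.
move=> bf h; rewrite -(Rintegral_cst mu mD); apply: le_Rintegral => //.
- exact: integrable_sqint.
- by apply: (@bounded_integrable _ `|M ^+ 2|) => //; exact: measurable_cst.
- move=> z _; rewrite lerXn2r ?nnegrE ?cabs_ge0//.
  exact: le_trans (cabs_ge0 _) (h z).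
Qed.

Lemma sqintD f g : bmeasurable f -> bmeasurable g ->
  sqint (fun z => f z + g z) <= 2 * sqint f + 2 * sqint g.
Proof.
move=> bf bg; have h1 := integrable_sqint bf; have h2 := integrable_sqint bg.
rewrite -(RintegralZl _ mD h1) -(RintegralZl _ mD h2) -RintegralD//; last 2 first.
- exact: (integrableZl mD 2 h1).
- exact: (integrableZl mD 2 h2).
apply: le_Rintegral => //; first exact: integrable_sqint (bmeasurableD bf bg).
- exact: (integrableD mD (integrableZl mD 2 h1) (integrableZl mD 2 h2)).
- by move=> z _; exact: cabsD_sqr.
Qed.

Lemma sqintM f g (M : R) : bmeasurable f -> bmeasurable g -> (forall z, cabs (f z) <= M) ->
  sqint (fun z => f z * g z) <= M ^+ 2 * sqint g.
Proof.
move=> bf bg h; have h2 := integrable_sqint bg.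
rewrite -(RintegralZl _ mD h2); apply: le_Rintegral => //.
- exact: integrable_sqint (bmeasurableM bf bg).
- exact: (integrableZl mD _ h2).
- move=> z _; rewrite cabsM exprMn ler_wpM2r ?sqr_ge0// lerXn2r ?nnegrE ?cabs_ge0//.
  exact: le_trans (cabs_ge0 _) (h z).
Qed.

Lemma Rintegral_bounded_cvg (h : nat -> T -> R) (h0 : T -> R) (M : R) :
  (forall n, measurable_fun [set: T] (h n)) ->
  (forall n z, `|h n z| <= M) ->
  (forall z, h n z @[n --> \oo] --> h0 z) ->
  (\int[mu]_(z in D) h n z) @[n --> \oo] --> \int[mu]_(z in D) h0 z.
Proof.
move=> mh bh ch.
have mh0 : measurable_fun [set: T] h0.
  by apply: (measurable_fun_cvg (h := h)) => // z _; exact: ch.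
have bh0 z : `|h0 z| <= M.
  by apply: (cvgr_to_le (cvg_norm (ch z))); apply: nearW => n; exact: bh.
apply: fine_cvg.
rewrite [X in _ --> X](_ : _ = \int[mu]_(z in D) (h0 z)%:E)%E; last first.
  rewrite fineK//; apply: integrable_fin_num => //.
  exact: (bounded_integrable mh0 bh0).
apply: (dominated_cvg mD (g := fun=> M%:E)).
- by move=> n; apply/measurable_EFinP; exact: measurable_funTS.
- by move=> z _; apply/fine_cvgP; split; [exact: nearW|exact: ch].
- by [].
- by apply: (@bounded_integrable (fun=> M) `|M|) => //; exact: measurable_cst.
- by move=> n z _; rewrite /= lee_fin bh.
Qed.

Lemma sqint_bounded_cvg (F : nat -> T -> C) f (M : R) :
  (forall n, bmeasurable (F n)) -> bmeasurable f ->
  (forall n z, cabs (F n z) <= M) -> (forall z, cabs (f z) <= M) ->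
  (forall z, cabs (F n z - f z) @[n --> \oo] --> (0 : R)) ->
  sqint (fun z => F n z - f z) @[n --> \oo] --> (0 : R).
Proof.
move=> bF bf hF hf cF.
have -> : (0 : R) = \int[mu]_(z in D) 0 by rewrite Rintegral_cst// mul0r.
apply: (@Rintegral_bounded_cvg _ _ ((M + M) ^+ 2)).
- by move=> n; apply: measurable_cabs_sqr; have [] := bmeasurableB (bF n) bf.
- move=> n z; rewrite ger0_norm ?sqr_ge0//.
  have h : cabs (F n z - f z) <= M + M by rewrite (le_trans (cabsB _ _))// lerD.
  by rewrite lerXn2r ?nnegrE ?cabs_ge0// (le_trans _ h)// cabs_ge0.
- move=> z; under eq_fun do rewrite expr2.
  by rewrite -[X in nbhs X](mulr0 (0 : R)); exact: cvgM.
Qed.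

End ComplexIntegral.

(** * Fourier coefficients on the unit interval *)

Section Fourier.
Variable R : realType.
Local Notation C := R[i].
Local Notation T := (measurableTypeR R).
Implicit Types (f g : T -> C) (n s : int) (t : R).

Definition unit_itv : set T := `[0%R, 1%R]%classic.

Lemma measurable_unit_itv : measurable unit_itv.
Proof. exact: measurable_itv. Qed.

Lemma leb_unit_itv : lebesgue_measure unit_itv = 1%E.
Proof. by rewrite lebesgue_measure_itv/= lte_fin ltr01 oppr0 adde0. Qed.

Lemma fin_unit_itv : (lebesgue_measure unit_itv < +oo)%E.
Proof. by rewrite leb_unit_itv ltry. Qed.

Local Notation leb := (@lebesgue_measure R).
Local Notation mI := measurable_unit_itv.
Local Notation fI := fin_unit_itv.

Definition ucint f : C := cint leb unit_itv f.
Definition usq f : R := sqint leb unit_itv f.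

(** The character t |-> exp (2 pi i n t). *)
Definition echar n t : C := cos (pi *+ 2 * n%:~R * t) +i* sin (pi *+ 2 * n%:~R * t).

Arguments echar : simpl never.

Lemma echar0 t : echar 0 t = 1.
Proof. by rewrite /echar mulr0 mul0r cos0 sin0. Qed.

Lemma echarD m n t : echar (m + n) t = echar m t * echar n t.
Proof.
rewrite /echar intrD mulrDr mulrDl cosD sinD; apply: complex_eqP => //=.
by rewrite addrC.
Qed.

Lemma echar_conj n t : (echar n t)^* = echar (- n) t.
Proof.
rewrite /echar mulrNz mulrN mulNr cosN sinN.
by apply: complex_eqP.
Qed.

Lemma cabs_echar n t : cabs (echar n t) = 1.
Proof. by rewrite cabsE /= cos2Dsin2 sqrtr1. Qed.

Lemma echarN n t : echar (- n) t = (echar n t)^-1.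
Proof. by rewrite -echar_conj cabs_unit_conj// cabs_echar. Qed.

Lemma echar_exp n t : echar n t = (echar 1 t) ^ n.
Proof.
have h (k : nat) : echar k t = (echar 1 t) ^ k.
  by elim: k => [|k ih]; rewrite ?echar0// -addn1 PoszD echarD ih exprzDr// unitfE -cabs_eq0 cabs_echar oner_eq0.
by case: n => k //; rewrite NegzE echarN h -exprnN.
Qed.

Lemma bmeasurable_echar n : @bmeasurable _ T R (echar n).
Proof.
split; last by exists 1 => t; rewrite cabs_echar.
split => /=; apply: continuous_measurable_fun => t.
  apply: (@continuous_comp _ _ _ (fun t => pi *+ 2 * n%:~R * t) cos); last exact: continuous_cos.
  exact: mulrl_continuous.
apply: (@continuous_comp _ _ _ (fun t => pi *+ 2 * n%:~R * t) sin); last exact: continuous_sin.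
exact: mulrl_continuous.
Qed.

Lemma sin_pi_int n : sin (pi *+ 2 * n%:~R : R) = 0.
Proof.
have h (k : nat) : sin (pi *+ 2 * k%:R : R) = 0.
  by rewrite mulr_natr; elim: k => [|k ih]; rewrite ?mulr0n ?sin0// mulrS addrC sinD2pi.
case: n => k; first exact: h.
by rewrite NegzE mulrNz mulrN sinN h oppr0.
Qed.

Lemma cos_pi_int n : cos (pi *+ 2 * n%:~R : R) = 1.
Proof.
have h (k : nat) : cos (pi *+ 2 * k%:R : R) = 1.
  by rewrite mulr_natr; elim: k => [|k ih]; rewrite ?mulr0n ?cos0// mulrS addrC cosD2pi.
case: n => k; first exact: h.
by rewrite NegzE mulrNz mulrN cosN h.
Qed.

Lemma ucint_echar n : ucint (echar n) = (n == 0)%:R.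
Proof.
have [->|n0] := eqVneq n 0.
  rewrite /ucint (_ : echar 0 = fun=> 1%:C); last by apply/funext => t; rewrite echar0.
  rewrite (cint_real _ mI) Rintegral_cst; last exact: mI.
  by rewrite [X in fine X](_ : _ = 1%E) ?mulr1//; exact: leb_unit_itv.
pose w : R := pi *+ 2 * n%:~R.
have w0 : w != 0 by rewrite mulf_neq0 ?intr_eq0// mulrn_eq0/= gt_eqF// pi_gt0.
have dl (t : R) : is_derive t 1 (fun t : R => w * t) w.
  by apply: is_derive_eq; rewrite /GRing.scale/= mulr1.
have cw : continuous (fun t : R => w * t) by exact: mulrl_continuous.
have cc : continuous (fun t => cos (w * t)).
  by move=> t; apply: (@continuous_comp _ _ _ (fun t => w * t) cos); [exact: cw|exact: continuous_cos].
have cs : continuous (fun t => sin (w * t)).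
  by move=> t; apply: (@continuous_comp _ _ _ (fun t => w * t) sin); [exact: cw|exact: continuous_sin].
have ftc (f F : R -> R) : continuous f -> (forall t, is_derive t 1 F (f t)) -> F 1 = F 0 ->
    \int[leb]_(t in unit_itv) f t = 0.
  move=> cf dF F01; rewrite /Rintegral (@continuous_FTC2 _ f F 0 1)//.
  - by rewrite F01 subee.
  - exact: continuous_subspaceT.
  - have cF t : {for t, continuous F}.
      by apply: differentiable_continuous; apply/derivable1_diffP; have [] := dF t.
    split.
    + by move=> t _; have [] := dF t.
    + by apply: cvg_at_right_filter; exact: cF.
    + by apply: cvg_at_left_filter; exact: cF.
  - by move=> t _; rewrite derive1E; have [_ ->] := dF t.
rewrite /ucint /cint; apply: complex_eqP => /=.
  apply: (ftc _ (fun t => w^-1 * sin (w * t))) => //.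
  - move=> t; have h := is_deriveZ w^-1 (is_derive1_comp (is_derive_sin (w * t)) (dl t)).
    apply: (@is_derive_eq _ _ _ _ _ _ _ _ h).
    by rewrite /GRing.scale/= mulrCA mulVf// mulr1.
  - by rewrite mulr1 mulr0 sin0 sin_pi_int.
apply: (ftc _ (fun t => - w^-1 * cos (w * t))) => //.
- move=> t; have h := is_deriveZ (- w^-1) (is_derive1_comp (is_derive_cos (w * t)) (dl t)).
  apply: (@is_derive_eq _ _ _ _ _ _ _ _ h).
  by rewrite /GRing.scale/= mulNr mulNr mulrN opprK mulrCA mulVf// mulr1.
- by rewrite mulr1 mulr0 cos0 cos_pi_int.
Qed.

End Fourier.

Arguments echar : simpl never.

Section Bessel.
Variable R : realType.
Local Notation C := R[i].
Local Notation T := (measurableTypeR R).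
Local Notation mI := (@measurable_unit_itv R).
Local Notation fI := (@fin_unit_itv R).
Implicit Types (f g : T -> C) (n s : int) (t : R).

Lemma usq_ge0 f : 0 <= usq f.
Proof. exact: sqint_ge0. Qed.

Definition fourier f n : C := ucint (fun t => f t * echar (- n) t).

Lemma bmeasurable_fourier f n : bmeasurable f -> bmeasurable (fun t => f t * echar (- n) t).
Proof. by move=> bf; apply: bmeasurableM => //; exact: bmeasurable_echar. Qed.

Lemma fourierD f g n : bmeasurable f -> bmeasurable g ->
  fourier (fun t => f t + g t) n = fourier f n + fourier g n.
Proof.
move=> bf bg; rewrite /fourier /ucint.
under eq_fun do rewrite mulrDl.
by rewrite (cintD mI fI (bmeasurable_fourier n bf) (bmeasurable_fourier n bg)).
Qed.

Lemma fourierZ (c : C) f n : bmeasurable f -> fourier (fun t => c * f t) n = c * fourier f n.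
Proof.
move=> bf; rewrite /fourier /ucint.
under eq_fun do rewrite -mulrA.
by rewrite (cintZ mI fI c (bmeasurable_fourier n bf)).
Qed.

Lemma fourierB f g n : bmeasurable f -> bmeasurable g ->
  fourier (fun t => f t - g t) n = fourier f n - fourier g n.
Proof.
move=> bf bg; rewrite -[in RHS](mulN1r (fourier g n)) -fourierZ// -fourierD//.
  by congr fourier; apply/funext => t; rewrite mulN1r.
exact: bmeasurableZ.
Qed.

Lemma fourier_sum (I : Type) (r : seq I) (F : I -> T -> C) n :
  (forall i, bmeasurable (F i)) ->
  fourier (fun t => \sum_(i <- r) F i t) n = \sum_(i <- r) fourier (F i) n.
Proof.
move=> bF; rewrite /fourier /ucint; under eq_fun do rewrite mulr_suml.
by rewrite (cint_sum mI fI)// => i; exact: bmeasurable_fourier.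
Qed.

Lemma fourier_conj f n : bmeasurable f -> fourier (fun t => (f t)^*) n = (fourier f (- n))^*.
Proof.
move=> bf; rewrite /fourier /ucint -(cint_conj mI fI (bmeasurable_fourier _ bf)).
by congr cint; apply/funext => t; rewrite conjcM opprK echar_conj.
Qed.

Lemma fourier_shift f m n : fourier (fun t => echar m t * f t) n = fourier f (n - m).
Proof.
congr ucint; apply/funext => t.
by rewrite mulrAC mulrC -echarD opprB addrC.
Qed.

Lemma fourier_cst (c : C) n : fourier (fun=> c) n = c * (n == 0)%:R.
Proof.
have -> : (fun=> c) = fun t => c * echar 0 t by apply/funext => t; rewrite echar0 mulr1.
rewrite fourierZ; last exact: bmeasurable_echar.
rewrite /fourier; under eq_fun do rewrite -echarD.
by rewrite ucint_echar add0r oppr_eq0.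
Qed.

Lemma fourier_echar m n : fourier (@echar R m) n = (n == m)%:R.
Proof.
have -> : fourier (@echar R m) n = fourier (fun t => echar m t * (fun=> 1) t) n.
  by congr fourier; apply/funext => t; rewrite mulr1.
by rewrite fourier_shift fourier_cst mul1r subr_eq0.
Qed.

(** Trigonometric polynomials, as lists of pairs (frequency, coefficient). *)
Definition tpoly (l : seq (int * C)) t : C := \sum_(p <- l) p.2 * echar p.1 t.

Lemma bmeasurable_monom (p : int * C) : @bmeasurable _ T R (fun t => p.2 * echar p.1 t).
Proof. by apply: bmeasurableZ; exact: bmeasurable_echar. Qed.

Lemma bmeasurable_tpoly l : @bmeasurable _ T R (tpoly l).
Proof. by apply: bmeasurable_sum => p; exact: bmeasurable_monom. Qed.

Lemma fourier_tpoly l n : fourier (tpoly l) n = \sum_(p <- l) p.2 * (n == p.1)%:R.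
Proof.
rewrite fourier_sum; last by move=> p; exact: bmeasurable_monom.
by apply: eq_bigr => p _; rewrite fourierZ ?fourier_echar//; exact: bmeasurable_echar.
Qed.

Lemma ucint_tpoly_conj f l : bmeasurable f ->
  ucint (fun t => (tpoly l t)^* * f t) = \sum_(p <- l) p.2^* * fourier f p.1.
Proof.
move=> bf; rewrite /ucint.
have -> : (fun t => (tpoly l t)^* * f t) =
    fun t => \sum_(p <- l) p.2^* * (f t * echar (- p.1) t).
  apply/funext => t; rewrite /tpoly conjE conjc_sum mulr_suml; apply: eq_bigr => p _.
  by rewrite conjcM echar_conj -mulrA [_ * f t]mulrC.
rewrite (cint_sum mI fI); last first.
  by move=> p; apply: bmeasurableZ; exact: bmeasurable_fourier.
apply: eq_bigr => p _; rewrite (cintZ mI fI)//; exact: bmeasurable_fourier.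
Qed.

(** Bessel's inequality: the distance from f to its partial Fourier sum is
    nonnegative. *)
Lemma bessel f : bmeasurable f -> l2 (fourier f) /\ nsq (fourier f) <= usq f.
Proof.
move=> bf; apply: l2_le; rewrite sqnormE.
apply: psum_le_seq => [n|s us]; first exact: sqr_ge0.
rewrite lee_fin; pose l := [seq (n, fourier f n) | n <- s].
have el (F : C -> C -> C) : \sum_(p <- l) F p.2 (fourier f p.1) = \sum_(n <- s) F (fourier f n) (fourier f n).
  by rewrite big_map.
have h0 : 0 <= usq (fun t => f t - tpoly l t) by exact: sqint_ge0.
have bl := bmeasurable_tpoly l; have bfc := bmeasurable_conj bf; have blc := bmeasurable_conj bl.
have e : (usq (fun t => f t - tpoly l t))%:C =
    (usq f)%:C - (\sum_(n <- s) cabs (fourier f n) ^+ 2)%:C.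
  rewrite /usq -!(cint_sqint _ mI).
  have -> : (fun t => (f t - tpoly l t)^* * (f t - tpoly l t)) = fun t =>
      ((f t)^* * f t - (tpoly l t)^* * f t) - ((f t)^* * tpoly l t - (tpoly l t)^* * tpoly l t).
    by apply/funext => t; rewrite !conjE conjcB; ring.
  have b1 := bmeasurableM bfc bf; have b2 := bmeasurableM blc bf.
  have b3 := bmeasurableM bfc bl; have b4 := bmeasurableM blc bl.
  rewrite (cintB mI fI (bmeasurableB b1 b2) (bmeasurableB b3 b4)).
  rewrite (cintB mI fI b1 b2) (cintB mI fI b3 b4).
  have es : cint (@lebesgue_measure R) (@unit_itv R) (fun t => (tpoly l t)^* * f t) =
      (\sum_(n <- s) cabs (fourier f n) ^+ 2)%:C.
    rewrite -/(ucint _) ucint_tpoly_conj// (el (fun a b => a^* * b)) rmorph_sum.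
    by apply: eq_bigr => n _; rewrite conjCM.
  have -> : (fun t => (f t)^* * tpoly l t) = fun t => ((tpoly l t)^* * f t)^*.
    by apply/funext => t; rewrite !conjE conjcM conjcK mulrC.
  rewrite (cint_conj mI fI b2) es conjc_real.
  have -> : cint (@lebesgue_measure R) (@unit_itv R) (fun t => (tpoly l t)^* * tpoly l t) =
      (\sum_(n <- s) cabs (fourier f n) ^+ 2)%:C.
    rewrite -/(ucint _) ucint_tpoly_conj// big_map rmorph_sum; apply: eq_big_seq => n ns /=.
    rewrite fourier_tpoly big_map (bigD1_seq n)//= eqxx mulr1 big1 ?addr0 ?conjCM//.
    by move=> m /negbTE mn; rewrite eq_sym mn mulr0.
  by rewrite subrr subr0.
have : usq (fun t => f t - tpoly l t) = usq f - \sum_(n <- s) cabs (fourier f n) ^+ 2.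
  by apply: complexI; rewrite e -rmorphB.
lra.
Qed.

Lemma l2_fourier f : bmeasurable f -> l2 (fourier f).
Proof. by move=> /bessel[]. Qed.

Lemma fourier_le f n : bmeasurable f -> cabs (fourier f n) ^+ 2 <= usq f.
Proof. by move=> bf; have [lf h] := bessel bf; exact: le_trans (nsq_term n lf) h. Qed.

Lemma usq_le f (M : R) : bmeasurable f -> (forall t, cabs (f t) <= M) -> usq f <= M ^+ 2.
Proof.
move=> bf h; have := sqint_le_cst mI fI bf h.
by rewrite [X in fine X](_ : _ = 1%E) ?mulr1//; exact: leb_unit_itv.
Qed.

Lemma fourier_le_sup f n (M : R) : bmeasurable f -> (forall t, cabs (f t) <= M) ->
  cabs (fourier f n) <= M.
Proof.
move=> bf h; have M0 := le_trans (cabs_ge0 _) (h 0).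
by apply: le_of_sqr => //; exact: le_trans (fourier_le n bf) (usq_le bf h).
Qed.

(** ** Approximation by trigonometric polynomials *)

(** The functions for which the characters are complete. Bounded Borel functions
    of exp (2 pi i t) are reached through the stability of this class under
    sums, products and bounded limits. *)
Definition approximable f := bmeasurable f /\ forall e : R, 0 < e ->
  exists l, usq (fun t => f t - tpoly l t) <= e.

Lemma approximable_tpoly l : approximable (tpoly l).
Proof.
split=> [|e e0]; first exact: bmeasurable_tpoly.
exists l; under eq_fun do rewrite subrr.
apply: le_trans (ltW e0); rewrite (le_trans (@usq_le _ 0 _ _))//.
- exact: bmeasurable_cst.
- by move=> t; rewrite cabs0.
- by rewrite expr0n.
Qed.

Lemma approximable_echar n : approximable (echar n).
Proof.
rewrite (_ : echar n = tpoly [:: (n, 1)]); first exact: approximable_tpoly.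
by apply/funext => t; rewrite /tpoly big_seq1 mul1r.
Qed.

Lemma approximable_cst (c : C) : approximable (fun=> c).
Proof.
rewrite (_ : (fun=> c) = tpoly [:: (0, c)]); first exact: approximable_tpoly.
by apply/funext => t; rewrite /tpoly big_seq1 echar0 mulr1.
Qed.

(** The approximation error only enters through the triangle inequality. *)
Lemma approximable_closed f : bmeasurable f ->
  (forall e : R, 0 < e -> exists2 g, approximable g & usq (fun t => f t - g t) <= e) ->
  approximable f.
Proof.
move=> bf h; split => // e e0.
have e4 : 0 < e / 4 by rewrite divr_gt0.
have [g [bg ag] hg] := h _ e4; have [l hl] := ag _ e4; exists l.
have -> : (fun t => f t - tpoly l t) = fun t => (f t - g t) + (g t - tpoly l t).
  by apply/funext => t; rewrite addrA subrK.
apply: (le_trans (sqintD mI fI (bmeasurableB bf bg) (bmeasurableB bg (bmeasurable_tpoly l)))).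
move: hg hl; rewrite /usq; lra.
Qed.

Lemma approximableD f g : approximable f -> approximable g -> approximable (fun t => f t + g t).
Proof.
move=> [bf af] [bg ag]; split; first exact: bmeasurableD.
move=> e e0; have e4 : 0 < e / 4 by rewrite divr_gt0.
have [l hl] := af _ e4; have [k hk] := ag _ e4; exists (l ++ k).
have -> : (fun t => f t + g t - tpoly (l ++ k) t) =
    fun t => (f t - tpoly l t) + (g t - tpoly k t).
  by apply/funext => t; rewrite /tpoly big_cat /=; ring.
apply: (le_trans (sqintD mI fI (bmeasurableB bf (bmeasurable_tpoly l))
  (bmeasurableB bg (bmeasurable_tpoly k)))).
move: hl hk; rewrite /usq; lra.
Qed.

Lemma tpolyM l k t : tpoly l t * tpoly k t =
  tpoly [seq (p.1 + r.1, p.2 * r.2) | p <- l, r <- k] t.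
Proof.
rewrite /tpoly big_allpairs_dep /= mulr_suml; apply: eq_bigr => p _.
by rewrite mulr_sumr; apply: eq_bigr => r _; rewrite echarD; ring.
Qed.

Lemma approximableM f g : approximable f -> approximable g -> approximable (fun t => f t * g t).
Proof.
have pre f1 f2 (M : R) (e : R) : bmeasurable f1 -> (forall t, cabs (f1 t) <= M) ->
    approximable f2 -> 0 < e ->
    exists l, usq (fun t => f1 t * f2 t - f1 t * tpoly l t) <= e.
  move=> b1 bM [b2 a2] e0; have M0 : 0 < M ^+ 2 + 1 by rewrite ltr_wpDl ?sqr_ge0.
  have [l hl] := a2 _ (divr_gt0 e0 M0); exists l.
  under eq_fun do rewrite -mulrBr.
  have b3 := bmeasurableB b2 (bmeasurable_tpoly l).
  apply: (le_trans (sqintM mI fI b1 b3 bM)).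
  apply: (@le_trans _ _ ((M ^+ 2 + 1) * usq (fun t => f2 t - tpoly l t))).
    by rewrite ler_wpM2r ?sqint_ge0// lerDl.
  by rewrite mulrC -ler_pdivlMr.
move=> af ag; have [bf _] := af; have [bg _] := ag.
apply: approximable_closed; first exact: bmeasurableM.
move=> e e0; have [_ [M bM]] := bf.
have [l hl] := pre _ _ _ _ bf bM ag e0.
exists (fun t => f t * tpoly l t) => //.
apply: approximable_closed; first by apply: bmeasurableM => //; exact: bmeasurable_tpoly.
move=> e' e'0; have [_ [N bN]] := bmeasurable_tpoly l.
have [k hk] := pre _ _ _ _ (bmeasurable_tpoly l) bN af e'0.
exists (fun t => tpoly l t * tpoly k t).
  by under eq_fun do rewrite tpolyM; exact: approximable_tpoly.
by under eq_fun do rewrite [f _ * _]mulrC.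
Qed.

Lemma approximableZ (c : C) f : approximable f -> approximable (fun t => c * f t).
Proof. by apply: approximableM; exact: approximable_cst. Qed.

Lemma approximableB f g : approximable f -> approximable g -> approximable (fun t => f t - g t).
Proof.
move=> af /(approximableZ (-1)) ag; have := approximableD af ag.
by congr approximable; apply/funext => t; rewrite mulN1r.
Qed.

Lemma approximable_cvg (F : nat -> T -> C) f (M : R) :
  (forall n : nat, approximable (F n)) -> bmeasurable f ->
  (forall (n : nat) t, cabs (F n t) <= M) -> (forall t, cabs (f t) <= M) ->
  (forall t, cabs (F n t - f t) @[n --> \oo] --> (0 : R)) -> approximable f.
Proof.
move=> aF bf hF hf cF; apply: approximable_closed => // e e0.
have := sqint_bounded_cvg mI fI (fun n : nat => (aF n).1) bf hF hf cF.
move/cvgrPdist_le/(_ _ e0) => [n _ /(_ n (leqnn n))] /=.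
rewrite sub0r normrN ger0_norm ?sqint_ge0// => h.
exists (F n) => //; apply: le_trans h; apply: (sqint_le mI fI).
- exact: bmeasurableB bf (aF n).1.
- exact: bmeasurableB (aF n).1 bf.
- by move=> t; rewrite cabs_distC.
Qed.

(** Both sides are linear in g and continuous for the L2 norm, so that g may be
    a character. *)
Lemma fourierM f g n : bmeasurable f -> approximable g ->
  fourier (fun t => f t * g t) n = csum (fun s => fourier f (n - s) * fourier g s).
Proof.
move=> bf [bg ag].
have l2s h : bmeasurable h -> l2 (fun s => fourier h (n - s)).
  move=> bh; apply: (l2_inj (h := fun s => n - s) _ (l2_fourier bh)).
  by move=> s s' /addrI/oppr_inj.
pose D h := fourier (fun t => f t * h t) n - csum (fun s => fourier f (n - s) * fourier h s).
have [_ [M bM]] := bf.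
pose K := 2 * M ^+ 2 + 2 * usq f.
have Kpos : 0 <= K.
  by have := usq_ge0 f; have := sqr_ge0 M; rewrite /K; lra.
have DK h : bmeasurable h -> cabs (D h) ^+ 2 <= K * usq h.
  move=> bh; apply: (le_trans (cabsD_sqr _ _)); rewrite cabsN.
  have h1 : cabs (fourier (fun t => f t * h t) n) ^+ 2 <= M ^+ 2 * usq h.
    apply: (le_trans (fourier_le _ (bmeasurableM bf bh))).
    exact: (sqintM mI fI bf bh bM).
  have h2 : cabs (csum (fun s => fourier f (n - s) * fourier h s)) ^+ 2 <= usq f * usq h.
    have [as_ hs] := cauchy_schwarz (l2s _ bf) (l2_fourier bh).
    have h3 : cabs (csum (fun s => fourier f (n - s) * fourier h s)) ^+ 2 <=
        anorm (fun s => fourier f (n - s) * fourier h s) ^+ 2.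
      by rewrite lerXn2r ?nnegrE ?cabs_ge0 ?anorm_ge0 ?cabs_csum.
    apply: (le_trans h3); apply: (le_trans hs); apply: ler_pM; rewrite ?nsq_ge0//.
      have bij : bijective (fun s => n - s).
        by exists (fun s => n - s) => s; rewrite opprB addrC subrK.
      by rewrite /nsq (sqnorm_bij (fourier f) bij); have [_] := bessel bf.
    by have [_] := bessel bh.
  rewrite /K; nra.
have Dmonom (p : int * C) : D (fun t => p.2 * echar p.1 t) = 0.
  rewrite /D (@csum_single _ _ p.1); last first.
    move=> s sp; have := fourier_tpoly [:: p] s; rewrite /tpoly big_seq1.
    under [X in fourier X]eq_fun do rewrite big_seq1.
    by move=> ->; rewrite (negbTE sp) !mulr0.
  have := fourier_tpoly [:: p] p.1; rewrite /tpoly big_seq1.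
  under [X in fourier X]eq_fun do rewrite big_seq1.
  move=> ->; rewrite eqxx mulr1 -fourier_shift mulrC -fourierZ; last first.
    by apply: bmeasurableM => //; exact: bmeasurable_echar.
  apply/eqP; rewrite subr_eq0; apply/eqP; congr fourier; apply/funext => t; ring.
have DD h k : bmeasurable h -> bmeasurable k -> D (fun t => h t + k t) = D h + D k.
  move=> bh bk; rewrite /D; under [X in fourier X]eq_fun do rewrite mulrDr.
  rewrite (fourierD _ (bmeasurableM bf bh) (bmeasurableM bf bk)).
  under [X in csum X]eq_fun do rewrite fourierD// mulrDr.
  have [a1 _] := cauchy_schwarz (l2s _ bf) (l2_fourier bh).
  have [a2 _] := cauchy_schwarz (l2s _ bf) (l2_fourier bk).
  by rewrite csumD//; ring.
have Dtp l : D (tpoly l) = 0.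
  elim: l => [|p l ih].
    have -> : tpoly [::] = fun t => (0 : int, 0 : C).2 * echar (0 : int, 0 : C).1 t.
      by apply/funext => t; rewrite /tpoly big_nil mul0r.
    exact: Dmonom.
  have -> : tpoly (p :: l) = fun t => p.2 * echar p.1 t + tpoly l t.
    by apply/funext => t; rewrite /tpoly big_cons.
  rewrite DD; [|exact: bmeasurable_monom|exact: bmeasurable_tpoly].
  by rewrite Dmonom ih addr0.
have Dg (e : R) : 0 < e -> cabs (D g) ^+ 2 <= K * e.
  move=> e0; have [l hl] := ag _ e0.
  have bl := bmeasurable_tpoly l.
  have -> : D g = D (fun t => g t - tpoly l t).
    have {1}-> : g = fun t => (g t - tpoly l t) + tpoly l t.
      by apply/funext => t; rewrite subrK.
    by rewrite DD ?Dtp ?addr0//; exact: bmeasurableB.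
  apply: (le_trans (DK _ (bmeasurableB bg bl))).
  by rewrite ler_wpM2l.
apply/eqP; rewrite -subr_eq0 -/(D g) -cabs_eq0; apply/eqP.
apply: contrapT => /eqP Dn0; have Dp : 0 < cabs (D g) by rewrite lt_neqAle eq_sym Dn0 cabs_ge0.
have K1 : 0 < K + 1 by rewrite ltr_wpDl.
have := Dg (cabs (D g) ^+ 2 / (2 * (K + 1))); rewrite divr_gt0 ?exprn_gt0 ?mulr_gt0//.
move=> /(_ isT); apply/negP; rewrite -ltNge mulrA ltr_pdivrMr ?mulr_gt0//.
have : 0 < cabs (D g) ^+ 2 by rewrite exprn_gt0.
nra.
Qed.

End Bessel.

Section LayerCake.
Context d (T : measurableType d) (R : realType).
Implicit Types f g : T -> R.

Lemma count_below (N : nat) (y : R) : 0 <= y -> y <= N%:R ->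
  y - 1 <= \sum_(k < N) (k.+1%:R <= y)%R%:R <= y.
Proof.
move=> y0 yN; apply/andP; split.
  elim: N yN => [|N ih] yN; first by rewrite big_ord0; move: yN; lra.
  rewrite big_ord_recr /=; have [yN'|Ny] := lerP y N%:R.
    by rewrite (le_trans (ih yN'))// lerDl.
  rewrite (eq_bigr (fun=> 1)); last first.
    by move=> k _; rewrite (le_trans _ (ltW Ny))// ler_nat.
  rewrite sumr_const card_ord; have : 0 <= (N.+1%:R <= y)%R%:R :> R by [].
  by move: yN; rewrite -natr1; lra.
elim: N {yN} => [|N ih]; first by rewrite big_ord0.
rewrite big_ord_recr /=; case: (lerP N.+1%:R y) => /= h; last by rewrite addr0.
apply: le_trans h; rewrite -(natr1 N) mulr1n lerD2r.
have : \sum_(k < N) (k.+1%:R <= y)%R%:R <= \sum_(k < N) (1 : R).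
  by apply: ler_sum => k _; case: (k.+1%:R <= y)%R.
by rewrite sumr_const card_ord.
Qed.

(** Induction on bounded measurable functions: with values in [0, 1], such a
    function is within 1/N of the average of the indicators of its level sets
    {f >= k/N}. *)
Lemma bounded_measurable_ind (P : (T -> R) -> Prop) :
  (forall B : set T, measurable B -> P (\1_B)) ->
  (forall (a : R) f g, P f -> P g -> P (fun z => a * f z + g z)) ->
  (forall f (M : R), measurable_fun [set: T] f -> (forall z, `|f z| <= M) ->
    (forall e : R, 0 < e -> exists2 g, P g & forall z, `|f z - g z| <= e) -> P f) ->
  forall f (M : R), measurable_fun [set: T] f -> (forall z, `|f z| <= M) -> P f.
Proof.
move=> Pind Plin Plim.
have P0 : P (fun=> 0).
  have := Pind _ measurable0; congr P; apply/funext => z.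
  by rewrite indicE in_set0.
have P1 : P (fun=> 1).
  have := Pind _ measurableT; congr P; apply/funext => z.
  by rewrite indicE in_setT.
have Pscale a f : P f -> P (fun z => a * f z).
  by move=> /(Plin a)/(_ P0); under eq_fun do rewrite addr0.
have Psum (N : nat) (F : 'I_N -> T -> R) : (forall k, P (F k)) ->
    P (fun z => \sum_(k < N) F k z).
  elim: N F => [|N ih] F PF; first by under eq_fun do rewrite big_ord0.
  under eq_fun do rewrite big_ord_recl.
  have := Plin 1 _ _ (PF ord0) (ih (fun k => F (lift ord0 k)) (fun k => PF _)).
  by under eq_fun do rewrite mul1r.
have P01 f : measurable_fun [set: T] f -> (forall z, 0 <= f z <= 1) -> P f.
  move=> mf f01; apply: (Plim _ 1) => // [z|e e0].
    by have /andP[h0 h1] := f01 z; rewrite ger0_norm.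
  pose N := (Num.truncn e^-1).+1.
  have N0 : 0 < N%:R :> R by rewrite ltr0n.
  have Ne : N%:R^-1 <= e.
    by rewrite -[leRHS]invrK lef_pV2 ?posrE ?invr_gt0// ltW// truncnS_gt.
  exists (fun z => N%:R^-1 * \sum_(k < N) \1_[set z | k.+1%:R <= N%:R * f z] z).
    apply/Pscale/Psum => k; apply: Pind.
    have -> : [set z | k.+1%:R <= N%:R * f z] = setT `&` (fun z => N%:R * f z) @^-1` `[k.+1%:R, +oo[.
      by apply/seteqP; split => z; rewrite /= in_itv/= andbT// => -[].
    have : measurable_fun [set: T] (fun z => N%:R * f z).
      by apply: measurable_funM => //; exact: measurable_cst.
    by apply => //; exact: measurable_itv.
  move=> z; have /andP[h0 h1] := f01 z.
  have y0 : 0 <= N%:R * f z by rewrite mulr_ge0.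
  have yN : N%:R * f z <= N%:R by rewrite ler_piMr.
  have /andP[c1 c2] := count_below y0 yN.
  rewrite (eq_bigr (fun k : 'I_N => (k.+1%:R <= N%:R * f z)%R%:R)); last first.
    by move=> k _; rewrite indicE; congr ((nat_of_bool _)%:R); apply/idP/idP; rewrite inE.
  apply: le_trans Ne; rewrite -[leRHS]mulr1.
  have -> : f z - N%:R^-1 * \sum_(k < N) (k.+1%:R <= N%:R * f z)%R%:R =
      N%:R^-1 * (N%:R * f z - \sum_(k < N) (k.+1%:R <= N%:R * f z)%R%:R).
    by rewrite mulrBr mulKf ?gt_eqF.
  have iN : 0 <= N%:R^-1 :> R by rewrite invr_ge0 ltW.
  rewrite normrM (ger0_norm iN) ler_pM2l ?invr_gt0//.
  by rewrite ler_norml; apply/andP; split; lra.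
move=> f M mf bf.
have M0 : 0 < `|M| + 1 by rewrite ltr_wpDl.
pose K := `|M| + 1.
have := Plin (2 * K) (fun z => (f z + K) / (2 * K)) (fun z => (- K) * 1).
have -> : (fun z => 2 * K * ((f z + K) / (2 * K)) + - K * 1) = f.
  by apply/funext => z; field; rewrite gt_eqF.
apply; last exact: Pscale.
apply: P01 => [|z].
  apply: measurable_funM; last exact: measurable_cst.
  by apply: measurable_funD => //; exact: measurable_cst.
have := bf z; have := ler_norm M; rewrite ler_norml => hM /andP[h1 h2].
rewrite ler_pdivlMr ?mulr_gt0// mul0r ler_pdivrMr ?mulr_gt0// /K.
by apply/andP; split; lra.
Qed.

End LayerCake.

(** ** Bounded Borel functions on a circle *)

Section Cubic.
Variable R : realType.
Implicit Types x y : R.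

(** The smooth step fixes 0, 1/2 and 1; its iterates tend to the step function of
    threshold 1/2 on [0, 1]. Thus the indicator of a level set of h is a bounded
    limit of polynomials in h. *)
Definition smoothstep x : R := 3 * x ^+ 2 - 2 * x ^+ 3.

Definition halfstep x : R := if x < 1 / 2 then 0 else if x == 1 / 2 then 1 / 2 else 1.

Lemma smoothstep01 x : 0 <= x <= 1 -> 0 <= smoothstep x <= 1.
Proof.
move=> /andP[x0 x1]; rewrite /smoothstep; apply/andP; split; last first.
  have -> : 3 * x ^+ 2 - 2 * x ^+ 3 = 1 - (1 - x) ^+ 2 * (1 + 2 * x) by ring.
  by rewrite gerBl mulr_ge0 ?sqr_ge0//; lra.
have -> : 3 * x ^+ 2 - 2 * x ^+ 3 = x ^+ 2 * (3 - 2 * x) by ring.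
by rewrite mulr_ge0 ?sqr_ge0//; lra.
Qed.

Lemma iter_smoothstep01 n x : 0 <= x <= 1 -> 0 <= iter n smoothstep x <= 1.
Proof. by move=> x01; elim: n => [//|n ih]; rewrite iterS smoothstep01. Qed.

Lemma iter_smoothstep_sym n x :
  iter n smoothstep (1 - x) = 1 - iter n smoothstep x.
Proof. by elim: n => [//|n ih]; rewrite !iterS ih /smoothstep; ring. Qed.

Lemma cvg_iter_smoothstep_lt x : 0 <= x -> x < 1 / 2 ->
  iter n smoothstep x @[n --> \oo] --> (0 : R).
Proof.
move=> x0 x12; pose l := 3 * x - 2 * x ^+ 2.
have l0 : 0 <= l by rewrite /l; nra.
have l1 : l < 1 by rewrite /l; nra.
have h n : 0 <= iter n smoothstep x <= l ^+ n /\ iter n smoothstep x <= x.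
  elim: n => [|n [/andP[h1 h2] h3]].
    by rewrite /= expr0 x0 lexx; split => //; lra.
  have e : smoothstep (iter n smoothstep x) = (iter n smoothstep x) *
    (3 * (iter n smoothstep x) - 2 * (iter n smoothstep x) ^+ 2) by rewrite /smoothstep; ring.
  rewrite iterS; set y := iter n smoothstep x in h1 h2 h3 e *.
  have le_l : 3 * y - 2 * y ^+ 2 <= l by rewrite /l; nra.
  have ge0 : 0 <= 3 * y - 2 * y ^+ 2 by nra.
  rewrite e; split; [apply/andP; split|].
  - by rewrite mulr_ge0.
  - by rewrite (exprSr l) ler_pM.
  - by rewrite (le_trans _ h3)// ler_piMr// (le_trans le_l)// ltW.
apply: (@squeeze_cvgr _ _ _ _ (fun=> 0) (fun n => l ^+ n)).
- by apply: nearW => n; have [/andP[-> ->]] := h n.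
- exact: cvg_cst.
- by apply: cvg_expr; rewrite ger0_norm.
Qed.

Lemma cvg_iter_smoothstep x : 0 <= x <= 1 ->
  iter n smoothstep x @[n --> \oo] --> halfstep x.
Proof.
move=> /andP[x0 x1]; rewrite /halfstep.
case: ltP => [|h]; first exact: cvg_iter_smoothstep_lt.
case: eqP => [->|/eqP n12].
  have -> : (fun n => iter n smoothstep (1 / 2)) = fun=> 1 / 2.
    by apply/funext; elim=> [//|n ih]; rewrite iterS ih /smoothstep; field.
  exact: cvg_cst.
have gt12 : 1 / 2 < x by rewrite lt_neqAle eq_sym n12.
have -> : (fun n => iter n smoothstep x) = fun n => 1 - iter n smoothstep (1 - x).
  by apply/funext => n; rewrite iter_smoothstep_sym; ring.
have [y0 y12] : 0 <= 1 - x /\ 1 - x < 1 / 2 by split; lra.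
by have := cvgB (cvg_cst (1 : R)) (cvg_iter_smoothstep_lt y0 y12); rewrite subr0; exact.
Qed.

End Cubic.

Section Circle.
Variable R : realType.
Local Notation C := R[i].
Local Notation T := (measurableTypeR R).
Local Notation T2 := (measurableTypeR R * measurableTypeR R)%type.
Implicit Types (f g : T -> C) (t : R).

Definition rapproximable (h : T -> R) := approximable (fun t => (h t)%:C : C).

Lemma rapproximableM (h k : T -> R) : rapproximable h -> rapproximable k ->
  rapproximable (fun t => h t * k t).
Proof.
move=> ah ak; rewrite /rapproximable; under eq_fun do rewrite rmorphM.
exact: approximableM.
Qed.

Lemma rapproximableD (h k : T -> R) : rapproximable h -> rapproximable k ->
  rapproximable (fun t => h t + k t).
Proof.
move=> ah ak; rewrite /rapproximable; under eq_fun do rewrite rmorphD.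
exact: approximableD.
Qed.

Lemma rapproximable_cst (a : R) : rapproximable (fun=> a).
Proof. exact: approximable_cst. Qed.

Lemma rapproximableZ (a : R) (h : T -> R) : rapproximable h ->
  rapproximable (fun t => a * h t).
Proof. by apply: rapproximableM; exact: rapproximable_cst. Qed.

Lemma rapproximableB (h k : T -> R) : rapproximable h -> rapproximable k ->
  rapproximable (fun t => h t - k t).
Proof.
move=> ah /(rapproximableZ (-1)); under eq_fun do rewrite mulN1r.
exact: rapproximableD.
Qed.

Lemma rapproximable_measurable (h : T -> R) : rapproximable h -> measurable_fun [set: T] h.
Proof. by move=> [[[mh _] _] _]. Qed.

Lemma rapproximable_cvg (h : nat -> T -> R) (h0 : T -> R) (M : R) :
  (forall n, rapproximable (h n)) -> (forall n t, `|h n t| <= M) ->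
  (forall t, h n t @[n --> \oo] --> h0 t) -> rapproximable h0.
Proof.
move=> ah hM ch.
have mh0 : measurable_fun [set: T] h0.
  apply: (measurable_fun_cvg (h := h)) => [n|t _]; last exact: ch.
  exact: rapproximable_measurable.
have hM0 t : `|h0 t| <= M.
  by apply: (cvgr_to_le (cvg_norm (ch t))); apply: nearW => n; exact: hM.
apply: (approximable_cvg (M := M) ah).
- exact: bmeasurable_real hM0.
- by move=> n t; rewrite cabsR.
- by move=> t; rewrite cabsR.
- move=> t; under eq_fun do rewrite -rmorphB /= cabsR.
  have := cvg_norm (cvgB (ch t) (cvg_cst (h0 t))); rewrite subrr normr0; exact.
Qed.

Lemma rapproximable_threshold (h : T -> R) :
  (forall t, 0 <= h t <= 1) -> rapproximable h ->
  rapproximable (\1_[set t | 1 / 2 <= h t]).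
Proof.
move=> h01 ah.
have an n : rapproximable (fun t => iter n (@smoothstep R) (h t)).
  elim: n => [//|n ih] /=.
  apply: rapproximableB; apply: rapproximableZ.
    by under eq_fun do rewrite expr2; exact: rapproximableM.
  by under eq_fun do rewrite exprS expr2; apply: rapproximableM => //; exact: rapproximableM.
have b n t : `|iter n (@smoothstep R) (h t)| <= 1.
  by have /andP[h0 h1] := iter_smoothstep01 n (h01 t); rewrite ger0_norm.
have astep : rapproximable (fun t => halfstep (h t)).
  by apply: (rapproximable_cvg an b) => t; exact: cvg_iter_smoothstep.
have -> : \1_[set t | 1 / 2 <= h t] = fun t =>
    3 * halfstep (h t) - 2 * (halfstep (h t) * halfstep (h t)).
  apply/funext => t; rewrite indicE /halfstep.
  case: ltP => [lt|ge].
    by rewrite memNset /=; [ring|rewrite leNgt lt].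
  rewrite mem_set//; case: eqP => _; last by rewrite mulr1n; ring.
  by rewrite mulr1n; field.
apply: rapproximableB; apply: rapproximableZ => //; exact: rapproximableM.
Qed.

Lemma rapproximable_level (h : T -> R) (M a : R) :
  (forall t, `|h t| <= M) -> rapproximable h ->
  rapproximable (\1_[set t | a <= h t]).
Proof.
move=> hM ah; have M0 : 0 <= M := le_trans (normr_ge0 _) (hM 0).
pose K := 2 * (M + `|a| + 1); have a0 := normr_ge0 a.
have K0 : 0 < K by rewrite /K; lra.
pose k t := 1 / 2 + K^-1 * (h t - a).
have k01 t : 0 <= k t <= 1.
  have := hM t; rewrite ler_norml => /andP[h1 h2].
  have := ler_norm a; have := ler_norm (- a); rewrite normrN => a1 a2.
  have : `|K^-1 * (h t - a)| <= 1 / 2.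
    rewrite normrM gtr0_norm ?invr_gt0// mulrC ler_pdivrMr// ler_norml.
    by apply/andP; split; rewrite /K; lra.
  by rewrite ler_norml /k => /andP[? ?]; apply/andP; split; lra.
have -> : [set t | a <= h t] = [set t | 1 / 2 <= k t].
  by apply/seteqP; split => t /=; rewrite /k lerDl pmulr_rge0 ?invr_gt0// subr_ge0.
apply: rapproximable_threshold => //; apply: rapproximableD; first exact: rapproximable_cst.
by apply: rapproximableZ; apply: rapproximableB => //; exact: rapproximable_cst.
Qed.

Definition circle (rho t : R) : T2 :=
  (rho * complex.Re (echar 1 t), rho * complex.Im (echar 1 t)).

Lemma toC_circle rho t : toC (circle rho t) = rho%:C * echar 1 t.
Proof. by apply: complex_eqP; rewrite ?Re_mul ?Im_mul /= mul0r ?subr0 ?addr0. Qed.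

Lemma cabs_circle rho t : cabs (toC (circle rho t)) = `|rho|.
Proof. by rewrite toC_circle cabsM cabsR cabs_echar mulr1. Qed.

Lemma measurable_circle rho : measurable_fun [set: T] (circle rho : T -> T2).
Proof.
have [[mre mim] _] := bmeasurable_echar R 1.
by apply: measurable_fun_pair; apply: measurable_funM => //; exact: measurable_cst.
Qed.

Lemma rapproximable_circle rho :
  rapproximable (fun t => (circle rho t).1) /\ rapproximable (fun t => (circle rho t).2).
Proof.
split; apply: rapproximableZ; rewrite /rapproximable.
  under eq_fun do rewrite ReJ_add echar_conj mulrC.
  by apply: approximableZ; apply: approximableD; exact: approximable_echar.
under eq_fun do rewrite ImJ_sub echar_conj mulrAC mulrC.
apply: approximableM; first exact: approximable_cst.
apply: approximableM; last exact: approximable_cst.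
by apply: approximableB; exact: approximable_echar.
Qed.

Lemma circle_le rho t : `|(circle rho t).1| <= `|rho| /\ `|(circle rho t).2| <= `|rho|.
Proof.
rewrite -(cabs_circle rho t); split; first exact: (cabs_Re (toC (circle rho t))).
exact: (cabs_Im (toC (circle rho t))).
Qed.

(** The sets with approximable indicator form a sigma-algebra, which contains
    the half-planes. *)
Lemma rapproximable_indic rho (B : set T2) : measurable B ->
  rapproximable (fun t => \1_B (circle rho t)).
Proof.
pose G (A : set T2) := rapproximable (fun t => \1_A (circle rho t)).
have GC A : G A -> G (~` A).
  move=> GA; rewrite /G [X in rapproximable X](_ : _ = fun t => 1 - \1_A (circle rho t)).
    by apply: rapproximableB => //; exact: rapproximable_cst.
  apply/funext => t; rewrite !indicE in_setC.
  by case: (_ \in A); rewrite /= ?mulr1n ?mulr0n ?subrr ?subr0.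
have GI A B' : G A -> G B' -> G (A `&` B').
  move=> GA GB; rewrite /G [X in rapproximable X](_ : _ =
    fun t => \1_A (circle rho t) * \1_B' (circle rho t)); first exact: rapproximableM.
  by apply/funext => t; rewrite indicI.
have G0 : G set0.
  rewrite /G [X in rapproximable X](_ : _ = fun=> 0); first exact: rapproximable_cst.
  by apply/funext => t; rewrite indicE in_set0.
have GU (F : (set T2)^nat) : (forall n, G (F n)) -> G (\bigcup_k F k).
  move=> GF; pose S (n : nat) : set T2 := \bigcup_(k < n) F k.
  have GS n : G (S n).
    elim: n => [|n ih]; first by rewrite /S bigcup_mkord big_ord0.
    have -> : S n.+1 = ~` (~` S n `&` ~` F n).
      by rewrite setCI !setCK /S !bigcup_mkord big_ord_recr.
    by apply: (GC); apply: (GI); exact: GC.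
  apply: (@rapproximable_cvg (fun n t => \1_(S n) (circle rho t)) _ 1) => //.
    by move=> n t; rewrite indicE ger0_norm//; case: (_ \in _).
  move=> t; rewrite indicE; have [|tF] := boolP (circle rho t \in \bigcup_k F k).
    rewrite inE => -[k _ Fk]; apply: cvg_near_cst; near=> n.
    rewrite indicE mem_set//; exists k => //=; near: n; exact: nbhs_infty_gt.
  apply: cvg_near_cst; near=> n.
  rewrite indicE memNset// => -[k _ Fk]; move/negP: tF; apply; rewrite inE.
  by exists k.
have GsigmaG : sigma_algebra setT G.
  by split => // A GA; rewrite setTD; exact: GC.
have half (h : T2 -> R) : (forall t, `|h (circle rho t)| <= `|rho|) ->
    rapproximable (fun t => h (circle rho t)) ->
    forall A : set R, measurable A -> G (h @^-1` A).
  move=> hle ah A mA; have mA' : (@ocitv R).-sigma.-measurable A by exact: mA.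
  rewrite RGenCInfty.measurableE in mA'.
  have smA := smallest_sub _ _ mA'.
  apply: (smA (fun A => G (h @^-1` A))).
    split; first by rewrite preimage_set0.
      by move=> A' GA; rewrite setTD preimage_setC; exact: GC.
    by move=> F GF; rewrite preimage_bigcup; exact: GU.
  move=> _ [a ->]; rewrite /G.
  rewrite [X in rapproximable X](_ : _ = \1_[set t | a <= h (circle rho t)]).
    exact: (rapproximable_level a hle ah).
  apply/funext => t; rewrite !indicE; congr ((nat_of_bool _)%:R).
  by apply/idP/idP; rewrite !inE /= in_itv /= andbT.
have [a1 a2] := rapproximable_circle rho.
move=> mB; have smB := smallest_sub _ _ mB; apply: (smB G) => //.
move=> A [[A' mA' <-]|[A' mA' <-]]; rewrite setTI.
  by apply: (half fst) => // t; have [] := circle_le rho t.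
by apply: (half snd) => // t; have [] := circle_le rho t.
Unshelve. all: by end_near. Qed.

Lemma approximable_circle rho (f : T2 -> C) : bmeasurable f ->
  approximable (fun t => f (circle rho t)).
Proof.
have real (h : T2 -> R) (M : R) : measurable_fun [set: T2] h -> (forall z, `|h z| <= M) ->
    rapproximable (fun t => h (circle rho t)).
  apply: (@bounded_measurable_ind _ T2 R (fun h => rapproximable (fun t => h (circle rho t)))).
  - by move=> B; exact: rapproximable_indic.
  - by move=> a h1 k ah ak; apply: rapproximableD => //; exact: rapproximableZ.
  - move=> h' M' mh bh happ; apply: approximable_closed.
      apply: (bmeasurable_real (M := M')) => [|t]; last exact: bh.
      exact: (measurableT_comp mh (measurable_circle rho)).
    move=> e e0; have s0 : 0 < Num.sqrt e by rewrite sqrtr_gt0.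
    have [g ag hg] := happ _ s0.
    exists (fun t => (g (circle rho t))%:C) => //.
    rewrite -[leRHS](sqr_sqrtr (ltW e0)); apply: usq_le => [|t]; last by rewrite -rmorphB /= cabsR.
    apply: bmeasurableB; last exact: ag.1.
    apply: (bmeasurable_real (M := M')) => [|t]; last exact: bh.
    exact: (measurableT_comp mh (measurable_circle rho)).
move=> [[mre mim] [M bM]].
have -> : (fun t => f (circle rho t)) = fun t =>
    (complex.Re (f (circle rho t)))%:C + 'i%C * (complex.Im (f (circle rho t)))%:C.
  by apply/funext => t; rewrite -complexE.
apply: approximableD; last apply: approximableZ.
  by apply: (real (fun z => complex.Re (f z)) M) => // z; exact: le_trans (cabs_Re _) (bM z).
by apply: (real (fun z => complex.Im (f z)) M) => // z; exact: le_trans (cabs_Im _) (bM z).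
Qed.

End Circle.

Section AdjointExt.
Variables (R : realType) (I : choiceType).
Local Notation C := R[i].

Lemma adjoint_ext (S T : op R I I) x y : bounded_op S -> bounded_op T ->
  (forall a b, (S (delta R a) b)^* = T (delta R b) a) ->
  l2 x -> l2 y -> inner (S x) y = inner x (T y).
Proof.
move=> [[lS aS] [M bS]] [[lT aT] [N bT]] e lx ly.
have inner_op (A : op R I I) (K : R) (z : I -> C) :
    (forall w, l2 w -> l2 (A w)) ->
    (forall a w v, l2 w -> l2 v -> A (fun i => a * w i + v i) = fun j => a * A w j + A v j) ->
    (forall w, l2 w -> (sqnorm (A w) <= K%:E * sqnorm w)%E) -> l2 z ->
    linear_fun (fun w => inner z (A w)) /\
    forall w, l2 w -> cabs (inner z (A w)) ^+ 2 <= (nsq z * `|K|) * nsq w.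
  move=> lA aA bA lz; split.
    by move=> a w v lw lv; rewrite aA// inner_linr//; exact: lA.
  move=> w lw; apply: (le_trans (inner_le lz (lA _ lw))).
  rewrite -mulrA ler_wpM2l ?nsq_ge0//.
  rewrite (@le_trans _ _ (K * nsq w))//; last by rewrite ler_wpM2r ?nsq_ge0 ?ler_norm.
  by rewrite -lee_fin EFinM -(l2_sqnorm lw) -(l2_sqnorm (lA _ lw)) bA.
have lin_self (z : I -> C) : l2 z -> linear_fun (inner z) /\
    forall w, l2 w -> cabs (inner z w) ^+ 2 <= nsq z * nsq w.
  by move=> lz; split=> [a w v lw lv|w lw]; [exact: inner_linr|exact: inner_le].
have step a : inner (S (delta R a)) y = inner (delta R a) (T y).
  have lSa := lS _ (l2_delta R a).
  have [l1 b1] := lin_self _ lSa.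
  have [l3 b3] := inner_op T N _ lT aT bT (l2_delta R a).
  apply: (functional_ext l1 l3 b1 b3) => // b.
  by rewrite inner_deltar inner_deltal e.
rewrite inner_conj [RHS]inner_conj; congr (_^*)%C.
have lTy := lT _ ly.
have [l1 b1] := lin_self _ lTy.
have [l3 b3] := inner_op S M _ lS aS bS ly.
apply: (functional_ext l3 l1 b3 b1) => // a.
by rewrite inner_conj step -inner_conj.
Qed.

End AdjointExt.

(** * Convolution operators on the integers *)

Section Conv.
Variable R : realType.
Local Notation C := R[i].
Local Notation T := (measurableTypeR R).
Implicit Types (f g : T -> C) (x y : int -> C) (s t a : int).

(** In the Fourier picture, where y stands for the function with coefficients
    y (- n), this is multiplication by f. *)
Definition convol f : op R int int := fun y t => csum (fun s => fourier f s * y (t + s)).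

Lemma shift_inj t : injective (fun s => t + s).
Proof. by move=> s s' /addrI. Qed.

Lemma shift_bij t : bijective (fun s => t + s).
Proof. by exists (fun s => - t + s) => s; rewrite addrA ?subrr ?addNr add0r. Qed.

Lemma asum_convol f y t : bmeasurable f -> l2 y ->
  asum (fun s => fourier f s * y (t + s)) /\ cabs (convol f y t) ^+ 2 <= usq f * nsq y.
Proof.
move=> bf ly; have lyt := l2_inj (@shift_inj t) ly.
have [lf hf] := bessel bf; have [a h] := cauchy_schwarz lf lyt.
split => //; apply: (@le_trans _ _ (anorm (fun s => fourier f s * y (t + s)) ^+ 2)).
  by rewrite lerXn2r ?nnegrE ?cabs_ge0 ?anorm_ge0 ?cabs_csum.
apply: (le_trans h); apply: ler_pM; rewrite ?nsq_ge0//.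
by rewrite /nsq (sqnorm_bij y (shift_bij t)).
Qed.

Lemma convol_linear f t : bmeasurable f -> linear_fun (fun y => convol f y t).
Proof.
move=> bf a x y lx ly; rewrite /convol.
have [a1 _] := asum_convol t bf lx; have [a2 _] := asum_convol t bf ly.
rewrite -csumZ// -csumD//; last exact: asumZ.
by congr csum; apply/funext => s; ring.
Qed.

Lemma convol_delta f a t : convol f (delta R a) t = fourier f (a - t).
Proof.
rewrite /convol (@csum_single R _ (a - t)) /delta.
  by rewrite (addrC t) subrK eqxx mulr1.
move=> s /eqP sn; case: eqP => [ets|_]; last by rewrite mulr0.
by case: sn; rewrite -ets (addrC t) addrK.
Qed.

Lemma convol_restr f y (s : seq int) t : bmeasurable f -> uniq s ->
  convol f (restr s y) t =
  fourier (fun u => f u * tpoly [seq (- a, y a) | a <- s] u) (- t).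
Proof.
move=> bf us; rewrite (linear_fun_restr _ (convol_linear t bf))// /tpoly.
under [in RHS]eq_fun do rewrite big_map mulr_sumr.
rewrite fourier_sum; last first.
  by move=> a; apply: bmeasurableM => //; apply: bmeasurableZ; exact: bmeasurable_echar.
apply: eq_bigr => a _; rewrite convol_delta /=.
have -> : (fun u => f u * (y a * echar (- a) u)) = fun u => y a * (echar (- a) u * f u).
  by apply/funext => u; ring.
rewrite fourierZ; last by apply: bmeasurableM => //; exact: bmeasurable_echar.
by rewrite fourier_shift opprK addrC.
Qed.

Lemma nsq_restr (I : choiceType) (s : seq I) (y : I -> C) : uniq s ->
  l2 (restr s y) /\ nsq (restr s y) = \sum_(a <- s) cabs (y a) ^+ 2.
Proof.
move=> us.
have [|as_ es] := @csum_seq R I s (fun i => (restr s y i)^* * restr s y i) us.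
  by move=> i si; rewrite /restr (negbTE si) mulr0.
have ls : l2 (restr s y).
  apply: le_lt_trans as_; apply: le_psum => i.
  by rewrite cabsM conjE cabsJ -expr2.
split => //; apply: complexI; rewrite -(inner_self ls) /inner es rmorph_sum.
by apply: eq_big_seq => i si; rewrite /restr si conjCM.
Qed.

Lemma usq_tpoly (s : seq int) (y : int -> C) : uniq s ->
  usq (tpoly [seq (- a, y a) | a <- s]) = \sum_(a <- s) cabs (y a) ^+ 2.
Proof.
move=> us; apply: complexI; rewrite -(cint_sqint _ (@measurable_unit_itv R)) -/(ucint _).
rewrite ucint_tpoly_conj; last exact: bmeasurable_tpoly.
rewrite big_map rmorph_sum; apply: eq_big_seq => a as_ /=.
rewrite fourier_tpoly big_map (bigD1_seq a)//= eqxx mulr1 big1 ?addr0 ?conjCM//.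
by move=> b /negbTE ab; rewrite eqr_opp eq_sym ab mulr0.
Qed.

Lemma convol_le f y (M : R) : bmeasurable f -> (forall u, cabs (f u) <= M) -> l2 y ->
  (sqnorm (convol f y) <= (M ^+ 2)%:E * sqnorm y)%E.
Proof.
move=> bf fM; apply: bound_of_restr.
- by move=> t; exact: convol_linear.
- by move=> t; exists (usq f) => x lx; have [] := asum_convol t bf lx.
- move=> s x us lx; have [ls ns] := nsq_restr x us.
  rewrite (l2_sqnorm ls) ns -(usq_tpoly x us) -EFinM.
  set p := tpoly _; have bp : bmeasurable p by exact: bmeasurable_tpoly.
  have -> : convol f (restr s x) = fun t => fourier (fun u => f u * p u) (- t).
    by apply/funext => t; rewrite convol_restr.
  have bN : bijective (@GRing.opp int) by exists -%R; exact: opprK.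
  rewrite (sqnorm_bij (fourier (fun u => f u * p u)) bN).
  have [lf hf] := bessel (bmeasurableM bf bp).
  rewrite (l2_sqnorm lf) lee_fin; apply: (le_trans hf).
  exact: (sqintM (@measurable_unit_itv R) (@fin_unit_itv R) bf bp fM).
- exact: sqr_ge0.
Qed.

Lemma convol_bounded f : bmeasurable f -> bounded_op (convol f).
Proof.
move=> bf; have [_ [M fM]] := bf; split; last by exists (M ^+ 2) => y; exact: convol_le.
split=> [y ly|a x y lx ly].
  by rewrite /l2 (le_lt_trans (convol_le bf fM ly))// lte_mul_pinfty// lee_fin sqr_ge0.
by apply/funext => t; rewrite (convol_linear t bf).
Qed.

Lemma convolM f g y : bmeasurable f -> approximable g -> l2 y ->
  convol f (convol g y) = convol (fun u => f u * g u) y.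
Proof.
move=> bf ag; have [bg _] := ag.
apply: (bounded_op_ext (S := convol f \o convol g)).
- by apply: bounded_comp; exact: convol_bounded.
- by apply: convol_bounded; exact: bmeasurableM.
- move=> a; apply/funext => t; rewrite /= convol_delta fourierM//.
  have b : bijective (fun s => a - t - s).
    by exists (fun s => a - t - s) => s; rewrite opprB addrC subrK.
  rewrite {1}/convol [RHS](csum_bij _ b); congr csum; apply/funext => s.
  by rewrite convol_delta; congr (fourier _ _ * fourier _ _); ring.
Qed.

End Conv.

(** * Functional calculus of a weighted shift *)

Section Phi.
Variable R : realType.
Local Notation C := R[i].
Local Notation T := (measurableTypeR R).
Local Notation T2 := (measurableTypeR R * measurableTypeR R)%type.
Local Notation LL := ((int * int) * (int * int))%type.
Implicit Types (f g : T2 -> C) (x y : LL -> C) (p : LL) (s : int).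

(** The translations of the index set along which the operator X moves. *)
Definition tau s p : LL := ((p.1.1 + s, p.1.2 + s), (p.2.1 + s, p.2.2 - s)).

(** Meaningful for p and p' on the same orbit of tau. *)
Definition lag p p' : int := p'.1.1 - p.1.1.

Definition orb (o : int * int * int) t : LL := ((t, o.1.1 + t), (o.1.2 + t, o.2 - t)).

Lemma tau_orb s t o : tau s (orb o t) = orb o (t + s).
Proof. by rewrite /tau /orb /= !addrA opprD addrA. Qed.

Lemma orb_bij : bijective (fun ot : int * int * int * int => orb ot.1 ot.2).
Proof.
exists (fun p => ((p.1.2 - p.1.1, p.2.1 - p.1.1, p.2.2 + p.1.1), p.1.1)).
  by move=> [[[a b] c] t]; rewrite /= !addrK subrK.
by move=> [[i j] [k l]]; rewrite /orb /= !subrK addrK.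
Qed.

Lemma tau0 p : tau 0 p = p.
Proof. by case: p => [[? ?] [? ?]]; rewrite /tau /= subr0 !addr0. Qed.

Lemma tauD s t p : tau s (tau t p) = tau (t + s) p.
Proof. by rewrite /tau /= !addrA opprD addrA. Qed.

Lemma lag_tau s p : lag p (tau s p) = s.
Proof. by rewrite /lag /= addrC addKr. Qed.

Lemma eq_tau_sym p p' : (p' == tau (lag p p') p) = (p == tau (lag p' p) p').
Proof.
have h a b : b == tau (lag a b) a -> a == tau (lag b a) b.
  move=> /eqP e; set s := lag a b in e.
  have -> : lag b a = - s by rewrite /s /lag opprB.
  by rewrite e tauD subrr tau0.
by apply/idP/idP; exact: h.
Qed.

Variables (r : R) (u : LL -> C).
Hypothesis u1 : forall p, cabs (u p) = 1.

Definition rmod p : R := r ^ (p.2.1 - p.1.1 + 1).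

Lemma rmod_tau s p : rmod (tau s p) = rmod p.
Proof. by congr (r ^ _); rewrite /=; ring. Qed.

Definition ofourier f p s : C := fourier (fun t => f (circle (rmod p) t)) s.

Lemma ofourier_tau f s p t : ofourier f (tau s p) t = ofourier f p t.
Proof. by rewrite /ofourier rmod_tau. Qed.

(** The operator f(X) for the weighted shift X with modulus rmod and phase
    u p / u (tau 1 p). *)
Definition Phi f : op R LL LL := fun x p =>
  csum (fun s => u p * (u (tau s p))^* * ofourier f p s * x (tau s p)).

Let slice x o : int -> C := fun t => (u (orb o t))^* * x (orb o t).

Let oradius (o : int * int * int) : R := r ^ (o.1.2 + 1).

Let osym f o : T -> C := fun t => f (circle (oradius o) t).

Let rmod_orb o t : rmod (orb o t) = oradius o.
Proof. by congr (r ^ _); rewrite /=; ring. Qed.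

Let bof f o : bmeasurable f -> bmeasurable (osym f o).
Proof. by move=> bf; have [] := approximable_circle (oradius o) bf. Qed.

Let l2_slice x o : l2 x -> l2 (slice x o).
Proof.
move=> lx; rewrite /l2 (sqnorm_unimod (u := fun t => (u (orb o t))^*) (fun t => x (orb o t))).
  by apply: (l2_inj _ lx) => t t' [].
by move=> t; rewrite cabsJ u1.
Qed.

Let sqnorm_slice x : sqnorm x = \esum_(o in [set: int * int * int]) sqnorm (slice x o).
Proof.
rewrite -(sqnorm_bij x orb_bij) sqnorm_pair; apply: eq_esum => o _.
rewrite (sqnorm_unimod (u := fun t => (u (orb o t))^*) (fun t => x (orb o t)))//.
by move=> t; rewrite cabsJ u1.
Qed.

Let asum_slice_convol f o x t : bmeasurable f -> l2 x ->
  asum (fun s => fourier (osym f o) s * slice x o (t + s)).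
Proof. by move=> bf lx; have [] := asum_convol t (bof o bf) (l2_slice o lx). Qed.

Lemma Phi_orb f x o t : bmeasurable f -> l2 x ->
  Phi f x (orb o t) = u (orb o t) * convol (osym f o) (slice x o) t.
Proof.
move=> bf lx; rewrite /convol -csumZ; last exact: asum_slice_convol.
congr csum; apply/funext => s; rewrite /slice tau_orb /ofourier rmod_orb.
by rewrite /osym conjE; ring.
Qed.

Let slice_Phi f x o : bmeasurable f -> l2 x ->
  slice (Phi f x) o = convol (osym f o) (slice x o).
Proof.
move=> bf lx; apply/funext => t; rewrite /slice Phi_orb// mulrA conjCM u1 expr1n.
by rewrite mul1r.
Qed.

Lemma Phi_le f x (M : R) : bmeasurable f -> (forall z, cabs (f z) <= M) -> l2 x ->
  (sqnorm (Phi f x) <= (M ^+ 2)%:E * sqnorm x)%E.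
Proof.
move=> bf fM lx; rewrite (sqnorm_slice (Phi f x)) (sqnorm_slice x).
apply: esum_sqnorm_le => [|o|o]; [exact: sqr_ge0|exact: l2_slice|].
by rewrite slice_Phi//; apply: convol_le; [exact: bof|move=> t; exact: fM|exact: l2_slice].
Qed.

Lemma asum_Phi f x p : bmeasurable f -> l2 x ->
  asum (fun s => u p * (u (tau s p))^* * ofourier f p s * x (tau s p)).
Proof.
move=> bf lx; have [g _ gh] := orb_bij; rewrite -(gh p).
set o := (g p).1; set t := (g p).2.
have := asumZ (u (orb o t)) (asum_slice_convol o t bf lx).
congr asum; apply/funext => s; rewrite /slice tau_orb /ofourier rmod_orb.
by rewrite /osym conjE; ring.
Qed.

Lemma Phi_linear f : bmeasurable f -> linear_op (Phi f).
Proof.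
move=> bf; have [_ [M fM]] := bf; split=> [x lx|a x y lx ly].
  by rewrite /l2 (le_lt_trans (Phi_le bf fM lx))// lte_mul_pinfty// lee_fin sqr_ge0.
apply/funext => p; rewrite /Phi.
have ax := asum_Phi p bf lx; have ay := asum_Phi p bf ly.
rewrite -csumZ// -csumD//; last exact: asumZ.
by congr csum; apply/funext => s; ring.
Qed.

Lemma l2_Phi f x : bmeasurable f -> l2 x -> l2 (Phi f x).
Proof. by move=> bf; apply: (Phi_linear bf).1. Qed.

Lemma Phi_bounded f : bmeasurable f -> bounded_op (Phi f).
Proof.
move=> bf; split; first exact: Phi_linear.
by have [_ [M fM]] := bf; exists (M ^+ 2) => x; exact: Phi_le.
Qed.

Lemma nsq_Phi_le f x (M : R) : bmeasurable f -> (forall z, cabs (f z) <= M) -> l2 x ->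
  nsq (Phi f x) <= M ^+ 2 * nsq x.
Proof.
move=> bf fM lx; rewrite -lee_fin EFinM -(l2_sqnorm lx) -(l2_sqnorm (l2_Phi bf lx)).
exact: Phi_le.
Qed.

(** On each orbit of tau, Phi is a convolution operator up to the phases u. *)
Lemma PhiM f g x : bmeasurable f -> bmeasurable g -> l2 x ->
  Phi f (Phi g x) = Phi (fun z => f z * g z) x.
Proof.
move=> bf bg lx; apply/funext => p; have [h _ gh] := orb_bij; rewrite -(gh p).
set o := (h p).1; set t := (h p).2.
rewrite (Phi_orb _ _ bf (l2_Phi bg lx)) (Phi_orb _ _ (bmeasurableM bf bg) lx).
rewrite slice_Phi// convolM//; [exact: bof|exact: approximable_circle|exact: l2_slice].
Qed.

Lemma Phi_lin (a : C) f g x : bmeasurable f -> bmeasurable g -> l2 x ->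
  Phi (fun z => a * f z + g z) x = fun p => a * Phi f x p + Phi g x p.
Proof.
move=> bf bg lx; apply/funext => p; rewrite /Phi.
have af := asum_Phi p bf lx; have ag := asum_Phi p bg lx.
have b1 : bmeasurable (fun t => f (circle (rmod p) t)) by have [] := approximable_circle (rmod p) bf.
have b2 : bmeasurable (fun t => g (circle (rmod p) t)) by have [] := approximable_circle (rmod p) bg.
rewrite -csumZ// -csumD//; last exact: asumZ.
congr csum; apply/funext => s; rewrite /ofourier.
by rewrite (fourierD _ (bmeasurableZ a b1) b2) (fourierZ _ _ b1); ring.
Qed.

Lemma eq_Phi f g x : (forall p t, f (circle (rmod p) t) = g (circle (rmod p) t)) ->
  Phi f x = Phi g x.
Proof.
move=> e; apply/funext => p; congr csum; apply/funext => s; congr (_ * _ * _).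
by congr fourier; apply/funext.
Qed.

(** The Fourier coefficients of a character form a basis vector. *)
Lemma Phi_echar f (n : int) (c : LL -> C) x :
  (forall p t, f (circle (rmod p) t) = c p * echar n t) ->
  Phi f x = fun p => c p * (u p * (u (tau n p))^* * x (tau n p)).
Proof.
move=> e; apply/funext => p; rewrite /Phi (@csum_single _ _ n).
  rewrite /ofourier (_ : fourier _ n = c p); first by rewrite conjE; ring.
  under eq_fun do rewrite e.
  by rewrite fourierZ ?fourier_echar ?eqxx ?mulr1//; exact: bmeasurable_echar.
move=> s sn; rewrite /ofourier (_ : fourier _ s = 0) ?mulr0 ?mul0r//.
under eq_fun do rewrite e.
rewrite fourierZ ?fourier_echar ?(negbTE sn) ?mulr0//; exact: bmeasurable_echar.
Qed.

Lemma Phi_radial f (c : LL -> C) x : (forall p t, f (circle (rmod p) t) = c p) ->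
  Phi f x = fun p => c p * x p.
Proof.
move=> e; rewrite (@Phi_echar f 0 c); last by move=> p t; rewrite e echar0 mulr1.
apply/funext => p; rewrite tau0 conjE [u p * _]mulrC -[(u p)^*%C]conjE conjCM u1 expr1n.
by rewrite mul1r.
Qed.

Lemma Phi1 x : Phi (fun=> 1) x = x.
Proof. by rewrite (@Phi_radial _ (fun=> 1))//; apply/funext => p; rewrite mul1r. Qed.

Lemma Phi_delta f p0 p : Phi f (delta R p0) p =
  if p0 == tau (lag p p0) p then u p * (u p0)^* * ofourier f p (lag p p0) else 0.
Proof.
have z s : s != lag p p0 ->
    u p * (u (tau s p))^* * ofourier f p s * delta R p0 (tau s p) = 0.
  move=> sl; rewrite /delta; case: eqP => [e|_]; last by rewrite mulr0.
  by move: sl; rewrite -e lag_tau eqxx.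
rewrite /Phi (csum_single z) /delta eq_sym; case: eqP => [<-|_]; last by rewrite mulr0.
by rewrite mulr1.
Qed.

Lemma Phi_adjoint f x y : bmeasurable f -> l2 x -> l2 y ->
  inner (Phi f x) y = inner x (Phi (fun z => (f z)^*) y).
Proof.
move=> bf lx ly; apply: adjoint_ext => //; try exact: Phi_bounded.
  by apply: Phi_bounded; exact: bmeasurable_conj.
move=> a b; rewrite !Phi_delta eq_tau_sym; case: eqP => [e|_]; last by rewrite conjc0.
have ba : bmeasurable (fun t => f (circle (rmod a) t)) by have [] := approximable_circle (rmod a) bf.
have -> : ofourier f b (lag b a) = ofourier f a (lag b a) by rewrite e ofourier_tau.
rewrite /ofourier fourier_conj// /lag opprB !conjcM conjE conjcK conjE.
by rewrite [(u b)^*%C * _]mulrC.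
Qed.

(** By functional_cvg it is enough to look at x in the basis, where this is
    bounded convergence for a single Fourier coefficient. *)
Lemma Phi_cvg0 (F : nat -> T2 -> C) (M : R) x y :
  (forall n, bmeasurable (F n)) -> (forall n z, cabs (F n z) <= M) ->
  (forall z, cabs (F n z) @[n --> \oo] --> (0 : R)) -> l2 x -> l2 y ->
  cabs (inner y (Phi (F n) x)) @[n --> \oo] --> (0 : R).
Proof.
move=> bF FM cF lx ly.
have lPhi n w : l2 w -> l2 (Phi (F n) w) by exact: l2_Phi.
have entry p0 p : cabs (Phi (F n) (delta R p0) p) @[n --> \oo] --> (0 : R).
  have bFc n : bmeasurable (fun t => F n (circle (rmod p) t)).
    by have [] := approximable_circle (rmod p) (bF n).
  have b0 : @bmeasurable _ T R (fun=> 0) by exact: bmeasurable_cst.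
  have M0 : 0 <= M := le_trans (cabs_ge0 _) (FM 0%N (0, 0)).
  have c0 : usq (fun t => F n (circle (rmod p) t) - 0) @[n --> \oo] --> (0 : R).
    apply: (sqint_bounded_cvg (@measurable_unit_itv R) (@fin_unit_itv R) bFc b0 (M := M)).
    - by move=> n t; exact: FM.
    - by move=> t; rewrite cabs0.
    - by move=> t; under eq_fun do rewrite subr0; exact: cF.
  have c1 : cabs (ofourier (F n) p (lag p p0)) @[n --> \oo] --> (0 : R).
    apply/cvgrPdist_le => e e0; move/cvgrPdist_le : c0 => /(_ (e ^+ 2)).
    rewrite exprn_gt0// => /(_ isT); apply: filterS => n.
    rewrite !sub0r !normrN ger0_norm ?usq_ge0// ger0_norm ?cabs_ge0// => h.
    apply: le_of_sqr; first exact: ltW.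
    apply: (le_trans (fourier_le _ (bFc n))); apply: le_trans h.
    by under [in leRHS]eq_fun do rewrite subr0.
  under eq_fun do rewrite Phi_delta; case: (_ == _).
    under eq_fun do rewrite !cabsM conjE cabsJ !u1 !mul1r.
    exact: c1.
  by under eq_fun do rewrite cabs0; exact: cvg_cst.
have coord p : cabs (Phi (F n) x p) @[n --> \oo] --> (0 : R).
  apply: (@functional_cvg R LL (fun n w => Phi (F n) w p) (M ^+ 2)) => //.
  - by move=> n; apply: linear_op_coord; exact: Phi_linear.
  - by move=> n w lw; apply: (le_trans (nsq_term p (lPhi n w lw))); exact: nsq_Phi_le.
under eq_fun do rewrite inner_conj cabsJ.
apply: (@functional_cvg R LL (fun n w => inner (Phi (F n) x) w) (M ^+ 2 * nsq x)) => //.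
- by move=> n a w v lw lv; apply: inner_linr => //; exact: lPhi.
- move=> n w lw; apply: (le_trans (inner_le (lPhi n x lx) lw)).
  by rewrite ler_wpM2r ?nsq_ge0// nsq_Phi_le.
- by move=> p; under eq_fun do rewrite inner_deltar cabsJ; exact: coord.
Qed.

(** The inverse is given by the conjugate symbol. *)
Lemma Phi_unitary f : bmeasurable f -> (forall z, cabs (f z) = 1) -> unitary_op (Phi f).
Proof.
move=> bf f1; have bfc := bmeasurable_conj bf.
have inv g h x : bmeasurable g -> bmeasurable h -> (forall z, g z * h z = 1) -> l2 x ->
    Phi g (Phi h x) = x.
  move=> bg bh gh lx; rewrite PhiM//.
  by rewrite (_ : (fun z => g z * h z) = fun=> 1) ?Phi1//; apply/funext.
have le1 g x : bmeasurable g -> (forall z, cabs (g z) = 1) -> l2 x ->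
    (sqnorm (Phi g x) <= sqnorm x)%E.
  move=> bg g1 lx; have := @Phi_le g x 1 bg; rewrite expr1n mul1e; apply => //.
  by move=> z; rewrite g1.
apply: (unitary_of_inverse (S := Phi (fun z => (f z)^*))).
- exact: Phi_linear.
- exact: Phi_linear.
- by move=> x; exact: le1.
- by move=> x; apply: le1 => // z; rewrite cabsJ.
- by move=> x; apply: inv => // z; rewrite -conjE conjCM f1 expr1n.
- by move=> x; apply: inv => // z; rewrite mulrC -conjE conjCM f1 expr1n.
Qed.

End Phi.

(** ** The spectral measure *)

Section MakeMeasure.
Context d (T : measurableType d) (R : realType).
Variable m : set T -> \bar R.
Hypotheses (m0 : m set0 = 0%E) (m_ge0 : forall B, (0 <= m B)%E).
Hypothesis m_sigma : semi_sigma_additive m.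

Definition measure_fun := m.

HB.instance Definition _ := @isMeasure.Build d T R measure_fun m0 m_ge0 m_sigma.

Lemma exists_measure : exists mu : {measure set T -> \bar R}, forall B, mu B = m B.
Proof. by exists measure_fun. Qed.

End MakeMeasure.

(* Comparing two values of Phi must not unfold the integrals in it. *)
Opaque Phi.

Section SpectralMeasure.
Variable R : realType.
Local Notation C := R[i].
Local Notation T2 := (measurableTypeR R * measurableTypeR R)%type.
Local Notation LL := ((int * int) * (int * int))%type.
Variables (r : R) (u : LL -> C).
Hypothesis u1 : forall p, cabs (u p) = 1.
Implicit Types (f g : T2 -> C) (x y : LL -> C) (B : set T2).
Local Notation Phi := (Phi r u).

Definition cindic B : T2 -> C := fun z => (\1_B z)%:C.

Lemma bmeasurable_cindic B : measurable B -> bmeasurable (cindic B).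
Proof. exact: bmeasurable_indic. Qed.

Definition sproj B : op R LL LL := Phi (cindic B).

Definition ip x f : C := inner x (Phi f x).

Lemma ip_lin x (a : C) f g : bmeasurable f -> bmeasurable g -> l2 x ->
  ip x (fun z => a * f z + g z) = a * ip x f + ip x g.
Proof.
move=> bf bg lx; rewrite /ip Phi_lin// inner_linr//; exact: l2_Phi.
Qed.

Lemma ipZ x (a : C) f : bmeasurable f -> l2 x -> ip x (fun z => a * f z) = a * ip x f.
Proof.
move=> bf lx; have b0 : @bmeasurable _ T2 R (fun=> 0) by exact: bmeasurable_cst.
have z : ip x (fun=> 0) = 0.
  by have := ip_lin 1 b0 b0 lx; under [X in ip x X]eq_fun do rewrite mulr0 addr0;
    rewrite mul1r => /eqP; rewrite -subr_eq subrr eq_sym => /eqP.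
by have := ip_lin a bf b0 lx; under [X in ip x X]eq_fun do rewrite addr0; rewrite z addr0.
Qed.

Lemma ipD x f g : bmeasurable f -> bmeasurable g -> l2 x ->
  ip x (fun z => f z + g z) = ip x f + ip x g.
Proof.
by move=> bf bg lx; have := ip_lin 1 bf bg lx; under [X in ip x X]eq_fun do rewrite mul1r; rewrite mul1r.
Qed.

Lemma ipB x f g : bmeasurable f -> bmeasurable g -> l2 x ->
  ip x (fun z => f z - g z) = ip x f - ip x g.
Proof.
move=> bf bg lx; rewrite ipD//; last exact: bmeasurableN.
by under [X in _ + ip x X]eq_fun do rewrite -mulN1r; rewrite ipZ// mulN1r.
Qed.

Lemma ip_le x f (M : R) : bmeasurable f -> 0 <= M -> (forall z, cabs (f z) <= M) -> l2 x ->
  cabs (ip x f) <= M * nsq x.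
Proof.
move=> bf M0 fM lx; apply: le_of_sqr; first by rewrite mulr_ge0 ?nsq_ge0.
rewrite /ip; apply: (le_trans (inner_le lx (l2_Phi _ u1 bf lx))).
rewrite exprMn mulrC (expr2 (nsq x)) mulrA ler_wpM2r ?nsq_ge0//.
exact: nsq_Phi_le.
Qed.

Lemma projM A B x : measurable A -> measurable B -> l2 x ->
  sproj (A `&` B) x = sproj A (sproj B x).
Proof.
move=> mA mB lx; rewrite /sproj.
rewrite (PhiM _ u1 (bmeasurable_cindic mA) (bmeasurable_cindic mB) lx).
have -> : cindic (A `&` B) = fun z => cindic A z * cindic B z.
  by apply/funext => z; rewrite /cindic indicI /= rmorphM.
by [].
Qed.

Lemma proj_idem B x : measurable B -> l2 x -> sproj B (sproj B x) = sproj B x.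
Proof. by move=> mB lx; rewrite -(projM mB mB lx) setIid. Qed.

Lemma proj_adjoint B x y : measurable B -> l2 x -> l2 y ->
  inner (sproj B x) y = inner x (sproj B y).
Proof.
move=> mB lx ly; have e : (fun z => (cindic B z)^*%C) = cindic B.
  by apply/funext => z; exact: conjc_real.
by rewrite /sproj (Phi_adjoint _ u1 (bmeasurable_cindic mB) lx ly) e.
Qed.

Lemma l2_proj B x : measurable B -> l2 x -> l2 (sproj B x).
Proof. by move=> mB; exact: (l2_Phi _ u1 (bmeasurable_cindic mB)). Qed.

Lemma ip_proj B x : measurable B -> l2 x -> ip x (cindic B) = (nsq (sproj B x))%:C.
Proof.
move=> mB lx; have lp := l2_proj mB lx.
by rewrite -(inner_self lp) (proj_adjoint mB lx lp) (proj_idem mB lx).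
Qed.

Lemma sum_indic_trivIset (F : (set T2)^nat) (n k : nat) z : trivIset setT F -> F k z ->
  \sum_(i < n) (\1_(F i) z) = (k < n)%N%:R :> R.
Proof.
move=> tF Fk; have e i : \1_(F i) z = (i == k)%:R :> R.
  rewrite indicE; case: eqP => [->|ik]; first by rewrite mem_set.
  rewrite memNset// => Fi; apply: ik; apply: tF => //.
  by exists z.
rewrite (eq_bigr (fun i : 'I_n => (i == k :> nat)%:R)); last by move=> i _; exact: e.
case: ltnP => kn; last first.
  by rewrite big1// => i _; case: eqP => // ik; have := ltn_ord i; rewrite ik ltnNge kn.
rewrite (bigD1 (Ordinal kn))//= eqxx big1 ?addr0// => i ik.
by case: eqP => // e'; case/eqP: ik; apply: val_inj.
Qed.

(** The indicators of the partial unions converge pointwise and boundedly to the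
    indicator of the union, whence countable additivity by Phi_cvg0. *)
Lemma exists_spectral_measure x : l2 x ->
  exists mu : {measure set T2 -> \bar R}, forall B, measurable B ->
    mu B = (complex.Re (inner x (sproj B x)))%:E.
Proof.
move=> lx.
pose m B : \bar R := if `[< measurable B >] then (nsq (sproj B x))%:E else 0%E.
have mE B : measurable B -> m B = (complex.Re (ip x (cindic B)))%:E.
  by move=> mB; rewrite /m asboolT// ip_proj.
have m0 : m set0 = 0%E.
  rewrite mE// [X in ip x X](_ : _ = fun z => 0 * cindic set0 z).
    by rewrite (ipZ _ (bmeasurable_cindic measurable0) lx) mul0r.
  by apply/funext => z; rewrite /cindic indicE in_set0 mul0r.
have m_ge0 B : (0 <= m B)%E by rewrite /m; case: ifP => // _; rewrite lee_fin nsq_ge0.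
have m_sigma : semi_sigma_additive m.
  move=> F mF tF mU; rewrite (mE _ mU).
  pose S n z : C := (\sum_(i < n) \1_(F i) z)%:C.
  have bS n : bmeasurable (S n).
    rewrite /S; under eq_fun do rewrite rmorph_sum /=.
    by apply: bmeasurable_sum => i; exact: bmeasurable_cindic.
  have bU := bmeasurable_cindic mU.
  have sumE n : (\sum_(0 <= i < n) m (F i))%E = (complex.Re (ip x (S n)))%:E.
    rewrite big_mkord; elim: n => [|n ih].
      rewrite big_ord0 [X in ip x X](_ : _ = fun z => 0 * cindic setT z).
        by rewrite (ipZ _ (bmeasurable_cindic measurableT) lx) mul0r.
      by apply/funext => z; rewrite /S big_ord0 mul0r.
    have -> : S n.+1 = fun z => S n z + cindic (F n) z.
      by apply/funext => z; rewrite /S big_ord_recr rmorphD.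
    rewrite (ipD (bS n) (bmeasurable_cindic (mF n)) lx).
    have := mE _ (mF n); move: ih.
    move: (ip x (S n)) (ip x (cindic (F n))) => a b ih hb.
    transitivity ((complex.Re a)%:E + (complex.Re b)%:E)%E.
      by rewrite -ih -hb big_ord_recr.
    by rewrite -EFinD -Re_add.
  under eq_fun do rewrite sumE.
  have cv : cabs (ip x (fun z => S n z - cindic (\bigcup_k F k) z)) @[n --> \oo] --> (0 : R).
    apply: (@Phi_cvg0 R r u u1 _ 1 x x _ _ _ lx lx).
    - by move=> n; exact: (bmeasurableB (bS n) bU).
    - move=> n z; rewrite /S /cindic -rmorphB /= cabsR.
      rewrite indicE; case: (boolP (z \in \bigcup_k F k)) => [|zF].
        rewrite inE => -[k _ Fk]; rewrite (sum_indic_trivIset n tF Fk).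
        by case: (k < n)%N; rewrite /= ?subrr ?sub0r ?normrN ?normr0 ?normr1.
      rewrite big1 ?subrr ?normr0// => i _; rewrite indicE memNset// => Fi.
      by move/negP: zF; apply; rewrite inE; exists i.
    - move=> z; rewrite /S /cindic indicE; apply: cvg_near_cst.
      have [|zF] := boolP (z \in \bigcup_k F k).
        rewrite inE => -[k _ Fk]; exists k.+1 => // n /= kn.
        by rewrite -rmorphB /= cabsR (sum_indic_trivIset n tF Fk) kn subrr normr0.
      apply: nearW => n; rewrite -rmorphB /= cabsR.
      rewrite big1 ?subrr ?normr0// => i _; rewrite indicE memNset// => Fi.
      by move/negP: zF; apply; rewrite inE; exists i.
  apply/fine_cvgP; split; first exact: nearW.
  apply/cvgrPdist_le => e e0; move/cvgrPdist_le : cv => /(_ e e0).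
  apply: filterS => n; rewrite sub0r normrN ger0_norm ?cabs_ge0// (ipB (bS n) bU lx) => h.
  by have h2 := le_trans (cabs_Re _) h; rewrite Re_sub distrC in h2; exact: h2.
have [mu hmu] := exists_measure m0 m_ge0 m_sigma.
by exists mu => B mB; rewrite hmu mE.
Qed.

End SpectralMeasure.

Section SpectralIntegral.
Variable R : realType.
Local Notation C := R[i].
Local Notation T2 := (measurableTypeR R * measurableTypeR R)%type.
Local Notation LL := ((int * int) * (int * int))%type.
Variables (r : R) (u : LL -> C).
Hypothesis u1 : forall p, cabs (u p) = 1.
Hypothesis r0 : 0 < r.
Implicit Types (f g : T2 -> C) (x y : LL -> C) (B : set T2).
Local Notation Phi := (Phi r u).
Local Notation sproj := (sproj r u).
Local Notation ip := (ip r u).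

Section OneVector.
Variables (x : LL -> C) (mu : {measure set T2 -> \bar R}).
Hypothesis lx : l2 x.
Hypothesis muE : forall B, measurable B -> mu B = (complex.Re (inner x (sproj B x)))%:E.

Let mT : measurable [set: T2] := measurableT.

Lemma mu_indic B : measurable B -> mu B = (nsq (sproj B x))%:E.
Proof. by move=> mB; rewrite (muE mB) -/(ip x (cindic B)) (ip_proj _ u1 mB lx). Qed.

Lemma proj_setT : sproj setT x = x.
Proof.
rewrite -[RHS](Phi1 r u1); congr (Phi _ x); apply/funext => z.
by rewrite /cindic indicE in_setT.
Qed.

Lemma mu_setT : mu setT = (nsq x)%:E.
Proof. by rewrite (mu_indic measurableT) proj_setT. Qed.

Lemma fin_mu : (mu setT < +oo)%E.
Proof. by rewrite mu_setT ltry. Qed.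

(** By definition of mu for indicators; both sides are linear and continuous for
    the sup norm. *)
Lemma Rintegral_ip (h : T2 -> R) (M : R) : measurable_fun [set: T2] h ->
  (forall z, `|h z| <= M) ->
  (\int[mu]_(z in setT) h z)%:C = ip x (fun z => (h z)%:C).
Proof.
move=> mh bh.
pose P (k : T2 -> R) := (measurable_fun [set: T2] k /\ exists M : R, forall z, `|k z| <= M) /\
  (\int[mu]_(z in setT) k z)%:C = ip x (fun z => (k z)%:C).
suff [] : P h by [].
have bm (k : T2 -> R) : P k -> bmeasurable (fun z => (k z)%:C).
  by move=> [[mk [N bk]] _]; exact: bmeasurable_real bk.
have im (k : T2 -> R) : P k -> mu.-integrable setT (EFin \o k).
  by move=> [[mk [N bk]] _]; exact: (bounded_integrable mT fin_mu mk bk).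
apply: (@bounded_measurable_ind _ T2 R P _ _ _ h M mh bh).
- move=> B mB; split.
    split; first exact: measurable_indic.
    by exists 1 => z; rewrite indicE ger0_norm//; case: (_ \in _).
  rewrite -/(cindic B) (ip_proj _ u1 mB lx) /Rintegral integral_indic// setIT.
  by rewrite (mu_indic mB).
- move=> a f g Pf Pg; have bf := bm f Pf; have bg := bm g Pg.
  have if_ := im f Pf; have ig := im g Pg.
  move: Pf Pg => [[mf [Mf hf]] ef] [[mg [Mg hg]] eg]; split.
    split.
      by apply: measurable_funD => //; apply: measurable_funM => //; exact: measurable_cst.
    exists (`|a| * Mf + Mg) => z; rewrite (le_trans (ler_normD _ _))// lerD// normrM.
    by rewrite ler_wpM2l.
  rewrite (RintegralD mT (integrableZl mT a if_) ig) (RintegralZl a mT if_).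
  rewrite rmorphD rmorphM /= ef eg -(ip_lin _ u1 a%:C bf bg lx).
  by congr ip; apply/funext => z; rewrite rmorphD rmorphM.
- move=> f N mf bf happ; split; first by split => //; exists N.
  have b1 : bmeasurable (fun z => (f z)%:C) by exact: bmeasurable_real bf.
  have i1 := bounded_integrable mT fin_mu mf bf.
  pose D := (\int[mu]_(z in setT) f z)%:C - ip x (fun z => (f z)%:C).
  have Dle (e : R) : 0 < e -> cabs D <= 2 * e * nsq x.
    move=> e0; have [g Pg hg] := happ e e0; have bg := bm g Pg; have i2 := im g Pg.
    have -> : D = (\int[mu]_(z in setT) (f z - g z))%:C - ip x (fun z => (f z)%:C - (g z)%:C).
      rewrite (RintegralB mT i1 i2) (ipB _ u1 b1 bg lx) rmorphB /= /D.
      by case: Pg => _ ->; rewrite opprB addrA subrK.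
    rewrite (le_trans (cabsB _ _))// mulrDl mulrDl !mul1r; apply: lerD; last first.
      apply: (ip_le _ u1 (bmeasurableB b1 bg)) => //; first exact: ltW.
      by move=> z; rewrite -rmorphB /= cabsR.
    rewrite cabsR.
    have mfg : measurable_fun [set: T2] (fun z => f z - g z).
      by apply: measurable_funB => //; case: Pg => -[].
    have ifg := bounded_integrable mT fin_mu mfg hg.
    apply: (le_trans (le_normr_Rintegral mT ifg)).
    have -> : e * nsq x = \int[mu]_(z in setT) e.
      by rewrite Rintegral_cst// (_ : fine _ = nsq x)//; have -> := mu_setT.
    apply: le_Rintegral => //.
    + have mn : measurable_fun [set: T2] (fun z => `|f z - g z|) by exact: measurableT_comp.
      by apply: (bounded_integrable mT fin_mu mn (M := e)) => z; rewrite normr_id.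
    + have mc := @measurable_cst _ _ T2 R setT e.
      by apply: (bounded_integrable mT fin_mu mc (M := `|e|)).
  apply/eqP; rewrite -subr_eq0 -/D -cabs_eq0; apply/eqP; apply: contrapT => /eqP Dn0.
  have Dp : 0 < cabs D by rewrite lt_neqAle eq_sym Dn0 cabs_ge0.
  have n0 := nsq_ge0 x; have n1 : 0 < nsq x + 1 by lra.
  have := Dle (cabs D / (4 * (nsq x + 1))); rewrite divr_gt0 ?mulr_gt0// => /(_ isT).
  apply/negP; rewrite -ltNge.
  have -> : 2 * (cabs D / (4 * (nsq x + 1))) * nsq x = cabs D * (nsq x / (2 * (nsq x + 1))).
    by field; rewrite gt_eqF.
  by rewrite gtr_pMr// ltr_pdivrMr ?mulr_gt0//; lra.
Qed.

Lemma cint_ip f : bmeasurable f -> cint mu setT f = ip x f.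
Proof.
move=> [[mre mim] [M fM]].
have b1 : forall z, `|complex.Re (f z)| <= M by move=> z; exact: le_trans (cabs_Re _) (fM z).
have b2 : forall z, `|complex.Im (f z)| <= M by move=> z; exact: le_trans (cabs_Im _) (fM z).
rewrite [LHS]complexE /= (Rintegral_ip mre b1) (Rintegral_ip mim b2) addrC.
rewrite -(ip_lin _ u1 _ (bmeasurable_real mim b2) (bmeasurable_real mre b1) lx).
by congr ip; apply/funext => z; rewrite [RHS]complexE addrC.
Qed.

End OneVector.

End SpectralIntegral.

Section SpectralResolution.
Variable R : realType.
Local Notation C := R[i].
Local Notation T2 := (measurableTypeR R * measurableTypeR R)%type.
Local Notation LL := ((int * int) * (int * int))%type.
Variables (r : R) (u : LL -> C).
Hypothesis u1 : forall p, cabs (u p) = 1.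
Hypothesis r0 : 0 < r.
Implicit Types (f g : T2 -> C) (x y : LL -> C) (B : set T2).
Local Notation Phi := (Phi r u).
Local Notation sproj := (sproj r u).
Local Notation ip := (ip r u).
Local Notation rmod := (rmod r).

Lemma rmod_gt0 p : 0 < rmod p.
Proof. exact: exprz_gt0. Qed.

(** The operator X, for r = |q| and u its gauge. *)
Definition wshift x : LL -> C := fun p => (rmod p)%:C * (u p * (u (tau 1 p))^* * x (tau 1 p)).

Definition wshift_uop : uop R LL := fun x y => [/\ l2 x, l2 y & y = wshift x].

Lemma tau_bij s : bijective (tau s).
Proof. by exists (tau (- s)) => p; rewrite tauD ?subrr ?addNr tau0. Qed.

Lemma wshift_uopP : is_uop wshift_uop.
Proof.
split.
- by move=> x y [].
- by move=> x y y' [_ _ ->] [_ _ ->].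
- move=> a x y x' y' [lx ly ey] [lx' ly' ey']; subst y y'; split.
  + exact: (l2_lin a lx lx').
  + exact: (l2_lin a ly ly').
  + by apply/funext => p; rewrite /wshift; ring.
Qed.

Lemma sqnorm_wshift x : sqnorm (wshift x) = psum (fun p => rmod p ^+ 2 * cabs (x p) ^+ 2).
Proof.
rewrite (psum_bij _ (tau_bij 1)); congr psum; apply/funext => p.
rewrite rmod_tau /wshift !cabsM cabsR conjE cabsJ !u1 !mul1r exprMn.
by rewrite (ger0_norm (ltW (rmod_gt0 p))).
Qed.

(** The disk of radius N, used to truncate the unbounded symbol. *)
Definition disk (N : nat) : set T2 := [set z | z.1 ^+ 2 + z.2 ^+ 2 <= N%:R ^+ 2].

Lemma measurable_sqr_norm : measurable_fun [set: T2] (fun z : T2 => z.1 ^+ 2 + z.2 ^+ 2).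
Proof.
by apply: measurable_funD; apply: measurable_funX; [exact: measurable_fst|exact: measurable_snd].
Qed.

Lemma measurable_disk N : measurable (disk N).
Proof.
have -> : disk N = setT `&` (fun z : T2 => z.1 ^+ 2 + z.2 ^+ 2) @^-1` `]-oo, N%:R ^+ 2].
  by apply/seteqP; split => z; rewrite /disk /= in_itv //= => -[].
by apply: measurable_sqr_norm => //; exact: measurable_itv.
Qed.

Lemma diskP N (z : T2) : disk N z <-> cabs (toC z) <= N%:R.
Proof.
rewrite /disk /= -(cabs_sqr (toC z)); split=> h; first by apply: le_of_sqr.
by rewrite lerXn2r ?nnegrE ?cabs_ge0.
Qed.

Lemma disk_circle N (p : LL) t : \1_(disk N) (circle (rmod p) t) = (rmod p <= N%:R)%R%:R :> R.
Proof.
rewrite indicE; congr ((nat_of_bool _)%:R).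
have e : cabs (toC (circle (rmod p) t)) = rmod p.
  by rewrite cabs_circle (ger0_norm (ltW (rmod_gt0 p))).
apply/idP/idP; first by rewrite inE diskP e.
by move=> h; rewrite inE diskP e.
Qed.

Lemma disk_near (z : T2) : \forall N \near \oo, \1_(disk N) z = 1 :> R.
Proof.
near=> N; rewrite indicE mem_set//; apply/diskP; near: N.
exact: nbhs_infty_ger.
Unshelve. all: by end_near. Qed.

Lemma rmod_near (p : LL) : \forall N \near \oo, (rmod p <= N%:R)%R.
Proof. exact: nbhs_infty_ger. Qed.

Lemma cmeasurable_toC : @cmeasurable _ T2 R (@toC R).
Proof. by split; [exact: measurable_fst|exact: measurable_snd]. Qed.

Definition trunc_id N : T2 -> C := fun z => (\1_(disk N) z)%:C * toC z.

Lemma trunc_id_le N z : cabs (trunc_id N z) <= N%:R /\ cabs (trunc_id N z) <= cabs (toC z).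
Proof.
rewrite /trunc_id cabsM cabsR indicE; case: (boolP (z \in disk N)).
  by rewrite inE => /diskP h; rewrite normr1 mul1r.
by rewrite normr0 mul0r cabs_ge0.
Qed.

Lemma bmeasurable_trunc_id N : bmeasurable (trunc_id N).
Proof.
split; last by exists N%:R => z; have [] := trunc_id_le N z.
apply: cmeasurableM; last exact: cmeasurable_toC.
exact: (bmeasurable_indic R (measurable_disk N)).1.
Qed.

Definition trunc_sqr N : T2 -> R := fun z => cabs (trunc_id N z) ^+ 2.

Lemma trunc_sqrE N z : trunc_sqr N z = \1_(disk N) z * cabs (toC z) ^+ 2.
Proof.
rewrite /trunc_sqr /trunc_id cabsM cabsR exprMn indicE.
by case: (_ \in _); rewrite ?normr1 ?normr0 ?expr1n ?expr0n.
Qed.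

Lemma measurable_trunc_sqr N : measurable_fun [set: T2] (trunc_sqr N).
Proof. by apply: measurable_cabs_sqr; have [] := bmeasurable_trunc_id N. Qed.

Lemma trunc_sqr_le N z : `|trunc_sqr N z| <= N%:R ^+ 2.
Proof.
rewrite /trunc_sqr ger0_norm ?sqr_ge0// lerXn2r ?nnegrE ?cabs_ge0//.
by have [] := trunc_id_le N z.
Qed.

Section OneVector.
Variables (x : LL -> C) (mu : {measure set T2 -> \bar R}).
Hypothesis lx : l2 x.
Hypothesis muE : forall B, measurable B -> mu B = (complex.Re (inner x (sproj B x)))%:E.

Let mT : measurable [set: T2] := measurableT.

Let finmu : (mu setT < +oo)%E := fin_mu u1 lx muE.

Definition trunc_wt N p : R := (rmod p <= N%:R)%R%:R * rmod p ^+ 2.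

Lemma trunc_wt_ge0 N p : 0 <= trunc_wt N p.
Proof. by rewrite mulr_ge0// sqr_ge0. Qed.

Lemma integral_trunc_sqr N : (\int[mu]_z (trunc_sqr N z)%:E)%E =
  psum (fun p => trunc_wt N p * cabs (x p) ^+ 2).
Proof.
have h0 p : 0 <= trunc_wt N p * cabs (x p) ^+ 2 by rewrite mulr_ge0 ?trunc_wt_ge0 ?sqr_ge0.
have fin : (psum (fun p => trunc_wt N p * cabs (x p) ^+ 2)%R < +oo)%E.
  apply: (@le_lt_trans _ _ (psum (fun p => N%:R ^+ 2 * cabs (x p) ^+ 2)%R)).
    apply: le_psum => p; rewrite ler_wpM2r ?sqr_ge0// /trunc_wt.
    case: (boolP (rmod p <= N%:R)%R) => [h|_]; last by rewrite mul0r sqr_ge0.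
    by rewrite mul1r lerXn2r ?nnegrE// ltW// rmod_gt0.
  rewrite psumZ ?sqr_ge0//; last by move=> p; exact: sqr_ge0.
  by rewrite lte_mul_pinfty// lee_fin sqr_ge0.
have ib := bounded_integrable mT finmu (measurable_trunc_sqr N) (trunc_sqr_le N).
rewrite -[LHS]fineK; last exact: integrable_fin_num.
rewrite (psum_fin h0 fin); congr EFin; apply: complexI.
rewrite -[fine (integral _ _ _)]/(\int[mu]_(z in setT) trunc_sqr N z).
rewrite (Rintegral_ip u1 lx muE (measurable_trunc_sqr N) (trunc_sqr_le N)).
rewrite /ip (@Phi_radial R r u u1 _ (fun p => (trunc_wt N p)%:C)); last first.
  move=> p t; rewrite trunc_sqrE disk_circle cabs_circle.
  by rewrite (ger0_norm (ltW (rmod_gt0 p))).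
rewrite -rsum_ge0// -csum_real /inner; congr csum; apply/funext => p.
by rewrite mulrCA conjCM -rmorphM.
Qed.

Lemma integral_sqr_cvg :
  (\int[mu]_z (trunc_sqr N z)%:E)%E @[N --> \oo] --> (\int[mu]_z (cabs (toC z) ^+ 2)%:E)%E.
Proof.
have e : (fun z => (cabs (toC z) ^+ 2)%:E) =
    fun z : T2 => limn (fun N => (trunc_sqr N z)%:E).
  apply/funext => z; apply/esym/cvg_lim => //; apply: cvg_near_cst.
  by apply: filterS (disk_near z) => N h; rewrite trunc_sqrE h mul1r.
rewrite e; apply: cvg_monotone_convergence => //.
- by move=> N; apply/measurable_EFinP; exact: measurable_trunc_sqr.
- by move=> N z _; rewrite lee_fin sqr_ge0.
- move=> z _ m n mn; rewrite lee_fin !trunc_sqrE ler_wpM2r ?sqr_ge0// !indicE.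
  case: (boolP (z \in disk m)); last by move=> _; case: (_ \in _).
  rewrite inE => /diskP h; rewrite mem_set//; apply/diskP.
  by rewrite (le_trans h)// ler_nat.
Qed.

(** By monotone convergence over the disks; a bounded radial symbol acts
    diagonally. *)
Lemma second_moment : (\int[mu]_z (cabs (toC z) ^+ 2)%:E)%E = sqnorm (wshift x).
Proof.
have cv := integral_sqr_cvg.
have nd : nondecreasing_seq (fun N => (\int[mu]_z (trunc_sqr N z)%:E)%E).
  move=> m n mn; rewrite !integral_trunc_sqr; apply: le_psum => p.
  rewrite ler_wpM2r ?sqr_ge0// /trunc_wt ler_wpM2r ?sqr_ge0//.
  case: (boolP (rmod p <= m%:R)%R) => [h|_]; last by case: (rmod p <= n%:R)%R.
  by rewrite (le_trans h)// ler_nat.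
have le_lim N : (\int[mu]_z (trunc_sqr N z)%:E <= \int[mu]_z (cabs (toC z) ^+ 2)%:E)%E.
  rewrite (cvg_unique _ cv (ereal_nondecreasing_cvgn nd))//.
  by apply: ereal_sup_ubound; exists N.
rewrite sqnorm_wshift; apply/eqP; rewrite eq_le; apply/andP; split.
  rewrite -(cvg_lim _ cv)//; apply: lime_le; first by apply/cvg_ex; eexists; exact: cv.
  apply: nearW => N; rewrite integral_trunc_sqr; apply: le_psum => p.
  rewrite ler_wpM2r ?sqr_ge0// /trunc_wt ler_piMl ?sqr_ge0//.
  by case: (rmod p <= N%:R)%R.
apply: psum_le_seq => [p|s us]; first by rewrite mulr_ge0 ?sqr_ge0.
have [N hN] : exists N : nat, forall p, p \in s -> (rmod p <= N%:R)%R.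
  elim: (s) => [|p t [N hN]]; first by exists 0%N.
  pose M := maxn N (Num.truncn (rmod p)).+1; exists M => p'.
  rewrite in_cons => /orP[/eqP ->|/hN h].
    by apply: (le_trans (ltW (truncnS_gt _))); rewrite ler_nat leq_maxr.
  by apply: (le_trans h); rewrite ler_nat leq_maxl.
apply: le_trans (le_lim N); rewrite integral_trunc_sqr.
have -> : \sum_(p <- s) rmod p ^+ 2 * cabs (x p) ^+ 2 =
    \sum_(p <- s) trunc_wt N p * cabs (x p) ^+ 2.
  by apply: eq_big_seq => p /hN h; rewrite /trunc_wt h mul1r.
by apply: psum_ge_seq => // p; rewrite mulr_ge0 ?trunc_wt_ge0 ?sqr_ge0.
Qed.

(** By dominated convergence over the disks, the second moment being finite. *)
Lemma first_moment : l2 (wshift x) -> inner x (wshift x) = cint mu setT (@toC R).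
Proof.
move=> ly; have dom2 : (\int[mu]_z (cabs (toC z) ^+ 2)%:E < +oo)%E by rewrite second_moment.
have mg : measurable_fun [set: T2] (fun z => 1 + cabs (toC z) ^+ 2 : R).
  apply: measurable_funD; first exact: measurable_cst.
  exact: measurable_cabs_sqr cmeasurable_toC.
have ig : mu.-integrable setT (EFin \o (fun z => 1 + cabs (toC z) ^+ 2 : R)).
  have i1 : mu.-integrable setT (EFin \o (fun=> 1 : R)).
    by apply: (bounded_integrable mT finmu (measurable_cst _) (M := 1)) => z; rewrite normr1.
  have i2 : mu.-integrable setT (EFin \o (fun z => cabs (toC z) ^+ 2)).
    apply/integrableP; split.
      by apply/measurable_EFinP; exact: measurable_cabs_sqr cmeasurable_toC.
    apply: le_lt_trans dom2; apply: ge0_le_integral => //.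
    - apply/measurable_EFinP; apply: measurableT_comp => //.
      exact: measurable_cabs_sqr cmeasurable_toC.
    - by apply/measurable_EFinP; exact: measurable_cabs_sqr cmeasurable_toC.
    - by move=> z _; rewrite lee_fin ger0_norm ?sqr_ge0.
  exact: (integrableD mT i1 i2).
have dct (k : T2 -> R) : measurable_fun [set: T2] k -> (forall z, `|k z| <= cabs (toC z)) ->
    (\int[mu]_(z in setT) (\1_(disk N) z * k z)) @[N --> \oo] --> \int[mu]_(z in setT) k z.
  move=> mk hk; have kg z : `|k z| <= 1 + cabs (toC z) ^+ 2.
    apply: (le_trans (hk z)); have := sqr_ge0 (cabs (toC z) - 1 / 2); nra.
  have ik : mu.-integrable setT (EFin \o k).
    apply: (le_integrable mT _ _ ig); first exact/measurable_EFinP.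
    by move=> z _ /=; rewrite lee_fin (le_trans (kg z))// ler_norm.
  apply: fine_cvg; rewrite fineK; last exact: integrable_fin_num.
  apply: (dominated_cvg mT (g := fun z => (1 + cabs (toC z) ^+ 2)%:E)) => //.
  - move=> N; apply/measurable_EFinP; apply: measurable_funM => //.
    exact: measurable_indic (measurable_disk N).
  - move=> z _; apply: cvg_near_cst; apply: filterS (disk_near z) => N h.
    by rewrite h mul1r.
  - move=> N z _ /=; rewrite lee_fin normrM (le_trans _ (kg z))//.
    by rewrite ler_piMl// indicE; case: (_ \in _); rewrite ?normr1 ?normr0.
have [mre mim] := cmeasurable_toC.
have cvre := dct _ mre (fun z => cabs_Re (toC z)).
have cvim := dct _ mim (fun z => cabs_Im (toC z)).
have ipE N : ip x (trunc_id N) = csum (fun p => (rmod p <= N%:R)%R%:R * ((x p)^* * wshift x p)).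
  rewrite /ip (@Phi_echar R r u _ 1 (fun p => (rmod p <= N%:R)%R%:R * (rmod p)%:C)); last first.
    by move=> p t; rewrite /trunc_id disk_circle toC_circle rmorph_nat mulrA.
  by congr csum; apply/funext => p; rewrite /wshift; ring.
have tr N : complex.Re (ip x (trunc_id N)) = \int[mu]_(z in setT) (\1_(disk N) z * complex.Re (toC z)) /\
    complex.Im (ip x (trunc_id N)) = \int[mu]_(z in setT) (\1_(disk N) z * complex.Im (toC z)).
  rewrite -(cint_ip u1 lx muE (bmeasurable_trunc_id N)).
  split; apply: eq_Rintegral => z _; rewrite /trunc_id ?Re_mul ?Im_mul.
    by rewrite mul0r subr0.
  by rewrite mul0r addr0.
have cvip : cabs (ip x (trunc_id N) - inner x (wshift x)) @[N --> \oo] --> (0 : R).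
  under eq_fun do rewrite ipE.
  apply: csum_dominated; first exact: asum_inner.
  - move=> N p; rewrite cabsM -[X in _ <= X]mul1r ler_wpM2r ?cabs_ge0//.
    by case: (rmod p <= N%:R)%R; rewrite ?cabs1 ?cabs0.
  - by move=> p; apply: filterS (rmod_near p) => N ->; rewrite mul1r.
have part (F : C -> R) : (forall a b, F (a - b) = F a - F b) -> (forall a, `|F a| <= cabs a) ->
    F (ip x (trunc_id N)) @[N --> \oo] --> F (inner x (wshift x)).
  move=> FB Fle; apply/cvgrPdist_le => e e0; move/cvgrPdist_le : cvip => /(_ e e0).
  apply: filterS => N; rewrite sub0r normrN ger0_norm ?cabs_ge0// => h.
  by rewrite distrC -FB; exact: le_trans (Fle _) h.
have cre := part (@complex.Re R) (@Re_sub R) (@cabs_Re R).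
have cim := part (@complex.Im R) (@Im_sub R) (@cabs_Im R).
have ere : (fun N => complex.Re (ip x (trunc_id N))) =
    fun N => \int[mu]_(z in setT) (\1_(disk N) z * complex.Re (toC z)).
  by apply/funext => N; exact: (tr N).1.
have eim : (fun N => complex.Im (ip x (trunc_id N))) =
    fun N => \int[mu]_(z in setT) (\1_(disk N) z * complex.Im (toC z)).
  by apply/funext => N; exact: (tr N).2.
rewrite ere in cre; rewrite eim in cim.
apply: complex_eqP; first exact: (cvg_unique (@Rhausdorff R) cre cvre).
exact: (cvg_unique (@Rhausdorff R) cim cvim).
Qed.

End OneVector.

End SpectralResolution.

Section FunCalc.
Variable R : realType.
Local Notation C := R[i].
Local Notation T2 := (measurableTypeR R * measurableTypeR R)%type.
Local Notation LL := ((int * int) * (int * int))%type.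
Variables (r : R) (u : LL -> C).
Hypothesis u1 : forall p, cabs (u p) = 1.
Hypothesis r0 : 0 < r.

Lemma sproj_full (D : set T2) (x : LL -> C) : (forall p t, D (circle (rmod r p) t)) ->
  sproj r u D x = x.
Proof.
move=> hD; rewrite -[RHS](Phi1 r u1); apply: eq_Phi => p t.
by rewrite /cindic indicE mem_set.
Qed.

Lemma cint_mkcond (mu : {measure set T2 -> \bar R}) (D : set T2) (f : T2 -> C) :
  cint mu D f = cint mu setT (fun z => cindic D z * f z).
Proof.
have e (g : T2 -> R) : \int[mu]_(z in D) g z = \int[mu]_(z in setT) (\1_D z * g z).
  rewrite Rintegral_mkcond; apply: eq_Rintegral => z _.
  by rewrite /patch indicE; case: (_ \in _); rewrite ?mul1r ?mul0r.
rewrite /cint; apply: complex_eqP => /=; rewrite e; apply: eq_Rintegral => z _.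
  by rewrite Re_mul /= mul0r subr0.
by rewrite Im_mul /= mul0r addr0.
Qed.

(** Only the values of f and of the indicator of D on the circles enter Phi. *)
Lemma wshift_fun_calc (D : set T2) (f : C -> C) : measurable D ->
  (forall p t, D (circle (rmod r p) t)) -> bmeasurable (fun z : T2 => f (toC z)) ->
  is_fun_calc (wshift_uop r u) D f (Phi r u (fun z => f (toC z))).
Proof.
move=> mD hD bf; have [[mre mim] [M fM]] := bf; split.
- exact: mD.
- exact: measurable_funTS mre.
- exact: measurable_funTS mim.
- by exists M => z _; exact: fM.
split; first exact: Phi_bounded.
have ex (x : LL -> C) : exists mu : {measure set T2 -> \bar R}, l2 x ->
    forall B, measurable B -> mu B = (complex.Re (inner x (sproj r u B x)))%:E.
  have [lx|nlx] := pselect (l2 x); last by exists (mzero : {measure set T2 -> \bar R}).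
  by have [mu hmu] := exists_spectral_measure r u1 lx; exists mu.
have [mu hmu] := choice ex.
exists (sproj r u), mu; split.
- split.
  + move=> B mB; split.
    * exact: Phi_linear (bmeasurable_cindic mB).
    * by move=> x lx; exact: (proj_idem _ u1 mB lx).
    * by move=> x y lx ly; exact: (proj_adjoint _ u1 mB lx ly).
  + by move=> x lx; exact: sproj_full.
  + by move=> A B x mA mB lx; exact: (projM _ u1 mA mB lx).
  + by move=> B x mB lx; exact: (hmu x lx B mB).
- split; first exact: wshift_uopP.
  + move=> x; split=> [[y [lx ly ey]]|[lx hx]].
      by split => //; rewrite (second_moment u1 r0 lx (hmu x lx)) -ey.
    exists (wshift r u x); split => //.
    by rewrite /l2 -(second_moment u1 r0 lx (hmu x lx)).
  + move=> x y [lx ly ey]; subst y.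
    exact: (first_moment u1 r0 lx (hmu x lx) ly).
- by move=> x lx; exact: sproj_full.
- move=> x lx.
  rewrite [RHS](_ : _ = cint (mu x) D (fun z => f (toC z)))//.
  have b1 : bmeasurable (fun z : T2 => cindic D z * f (toC z)).
    by apply: bmeasurableM => //; exact: bmeasurable_cindic.
  rewrite cint_mkcond (cint_ip u1 lx (hmu x lx) b1) /ip.
  congr inner; apply: eq_Phi => p t.
  by rewrite /cindic indicE mem_set// mul1r.
Qed.

End FunCalc.

(** * The Fourier coefficients of F *)

(** ** The coefficients of the Euler series and of their Cauchy products *)

Section RatioTest.
Variable R : realType.

Lemma psum_ratio (v : nat -> R) (l : R) (k0 : nat) : (forall k, 0 <= v k) ->
  0 <= l < 1 -> (forall k, (k0 <= k)%N -> v k.+1 <= l * v k) -> (psum v < +oo)%E.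
Proof.
move=> v0 /andP[l0 l1] h.
have h1 j : v (k0 + j)%N <= l ^+ j * v k0.
  elim: j => [|j ih]; first by rewrite addn0 expr0 mul1r.
  rewrite addnS (le_trans (h _ _)) ?leq_addr// exprS -mulrA.
  by rewrite ler_wpM2l.
have geo n : \sum_(j < n) l ^+ j <= (1 - l)^-1.
  rewrite -[leRHS]mul1r ler_pdivlMr ?subr_gt0// mulrC.
  have -> : (1 - l) * \sum_(j < n) l ^+ j = 1 - l ^+ n.
    elim: n => [|n ih]; first by rewrite big_ord0 mulr0 expr0 subrr.
    by rewrite big_ord_recr /= mulrDr ih exprS; ring.
  by rewrite gerBl exprn_ge0.
rewrite /psum -nneseries_esumT; last by move=> k; rewrite lee_fin.
apply: (@le_lt_trans _ _ (\sum_(k < k0) v k + (1 - l)^-1 * v k0)%:E); last exact: ltry.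
apply: lime_le; first by apply: is_cvg_nneseries => k _ _; rewrite lee_fin.
apply: nearW => n; rewrite sumEFin lee_fin big_mkord.
apply: (@le_trans _ _ (\sum_(k < k0 + n) v k)).
  rewrite -!(big_mkord xpredT) [leRHS](big_cat_nat _ (n := n)) ?leq_addl//=.
  by rewrite lerDl sumr_ge0.
rewrite big_split_ord/= lerD2l.
apply: (@le_trans _ _ (\sum_(j < n) l ^+ j * v k0)); first by apply: ler_sum => j _; exact: h1.
by rewrite -mulr_suml ler_wpM2r.
Qed.

(** Integer indices turn shifts of the index into bijections. *)
Definition zext (v : nat -> R) (n : int) : R := if n is Posz k then v k else 0.

Lemma psum_zext (f : int -> R) : (forall k : nat, f (Negz k) = 0) ->
  psum f = psum (fun k : nat => f k).
Proof.
move=> f0; rewrite (@psum_reindex R int nat Posz)//; first by move=> ? ? [].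
by case=> k hk; [case: (hk k)|exact: f0].
Qed.

Lemma cvg_expr_small (x e : R) : 0 <= x < 1 -> 0 < e -> exists k0, forall k, (k0 <= k)%N -> x ^+ k <= e.
Proof.
move=> /andP[x0 x1] e0; have : x ^+ k @[k --> \oo] --> (0 : R).
  by apply: cvg_expr; rewrite ger0_norm.
move=> /cvgrPdist_le/(_ e e0)[k0 _ h]; exists k0 => k hk.
by have := h k hk; rewrite /= sub0r normrN ger0_norm// exprn_ge0.
Qed.

End RatioTest.

Section QSeries.
Variables (R : realType) (r : R).
Hypotheses (r0 : 0 < r) (r1 : r < 1).
Implicit Types (k m n s t : int).

Let rn0 : r != 0. Proof. by rewrite gt_eqF. Qed.

Local Notation q2 := (r ^+ 2).

Lemma q2_gt0 : 0 < q2. Proof. exact: exprn_gt0. Qed.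

Lemma q2_lt1 : q2 < 1. Proof. by rewrite expr_lt1// ltW. Qed.

Lemma onem_q2X_gt0 (k : nat) : 0 < 1 - q2 ^+ k.+1.
Proof. by rewrite subr_gt0 expr_lt1// ?q2_lt1// ltW// q2_gt0. Qed.

(** The coefficients of the infinite product of the 1 + q2^k w, and of its
    inverse. *)
Fixpoint aN (k : nat) : R := if k is k'.+1 then q2 ^+ k' * aN k' / (1 - q2 ^+ k) else 1.

Fixpoint bN (k : nat) : R := if k is k'.+1 then - bN k' / (1 - q2 ^+ k) else 1.

Definition az := zext aN.
Definition bz := zext bN.

Lemma aN_gt0 (k : nat) : 0 < aN k.
Proof. by elim: k => [|k ih] //=; rewrite divr_gt0 ?onem_q2X_gt0// mulr_gt0// exprn_gt0// q2_gt0. Qed.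

Lemma az_ge0 k : 0 <= az k.
Proof. by case: k => k //=; rewrite ltW// aN_gt0. Qed.

Lemma az_rec k : az k = az k * r ^ (2 * k) + az (k - 1) * r ^ (2 * (k - 1)).
Proof.
case: k => [[|k]|k]; rewrite /az.
- by rewrite mulr0 expr0z mulr1 /= mul0r addr0.
- have -> : k.+1%:Z - 1 = k by rewrite -addn1 PoszD addrK.
  rewrite -!(exprz_exp r 2) /=.
  rewrite -[(r ^ 2) ^ k.+1]/(q2 ^+ k.+1) -[(r ^ 2) ^ k]/(q2 ^+ k).
  by field; rewrite gt_eqF// onem_q2X_gt0.
- by rewrite NegzE -opprD -[_.+1%:Z + 1]PoszD addn1 -!NegzE /= !mul0r addr0.
Qed.

Lemma bz_rec k : bz k + bz (k - 1) = r ^ (2 * k) * bz k.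
Proof.
case: k => [[|k]|k]; rewrite /bz.
- by rewrite mulr0 expr0z mul1r /= addr0.
- have -> : k.+1%:Z - 1 = k by rewrite -addn1 PoszD addrK.
  rewrite -!(exprz_exp r 2) /= -[(r ^ 2) ^ k.+1]/(q2 ^+ k.+1).
  by field; rewrite gt_eqF// onem_q2X_gt0.
- by rewrite NegzE -opprD -[_.+1%:Z + 1]PoszD addn1 -!NegzE /= mulr0 addr0.
Qed.

Lemma az_bz k : az k = (-1) ^ k * r ^ (k * k - k) * bz k.
Proof.
case: k => k; last by rewrite /= mulr0.
rewrite /az /bz /=; elim: k => [|k ih]; first by rewrite mul0r subr0 !expr0z !mul1r.
rewrite /= {}ih.
have -> : k.+1%:Z * k.+1%:Z - k.+1%:Z = (k%:Z * k%:Z - k%:Z) + 2 * k%:Z.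
  by rewrite -addn1 PoszD; ring.
rewrite (expfzDr _ (2 * _) rn0) -(exprz_exp r 2) -[(r ^ 2) ^ k]/(q2 ^+ k).
rewrite -[(-1) ^ k.+1]/((-1) ^+ k.+1) -[(-1) ^ k]/((-1) ^+ k) [(-1) ^+ k.+1]exprS.
rewrite ![q2 ^+ k.+1]exprS.
have := onem_q2X_gt0 k; rewrite exprS.
move: ((-1) ^+ k) (r ^ (k%:Z * k%:Z - k%:Z)) (q2 ^+ k) => x y z hz.
by field; rewrite gt_eqF.
Qed.

Lemma bN_le (k : nat) : `|bN k| <= (1 - q2)^-1 ^+ k.
Proof.
elim: k => [|k ih]; first by rewrite /= normr1 expr0.
rewrite /= normrM normrN [leRHS]exprSr ler_pM//.
rewrite normfV gtr0_norm ?onem_q2X_gt0// lef_pV2 ?posrE ?onem_q2X_gt0 ?subr_gt0 ?q2_lt1//.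
rewrite lerD2l lerN2 -[leRHS]expr1 ler_wiXn2l//; [exact/ltW/q2_gt0|exact/ltW/q2_lt1].
Qed.

(** Since q2^k tends to 0, consecutive terms eventually shrink by half. *)
Lemma psum_aN (t : R) : 0 <= t -> (psum (fun k : nat => (aN k * t ^+ k)%R) < +oo)%E.
Proof.
move=> t0; have q1 : 0 < 1 - q2 by rewrite subr_gt0 q2_lt1.
have [||k0 hk0] := @cvg_expr_small R q2 ((1 - q2) / (2 * (t + 1))).
- by rewrite (ltW q2_gt0) q2_lt1.
- by rewrite divr_gt0// mulr_gt0// ltr_wpDl.
apply: (@psum_ratio _ _ (1 / 2) k0).
- by move=> k; rewrite mulr_ge0 ?exprn_ge0// ltW// aN_gt0.
- by apply/andP; split; lra.
move=> k /hk0; rewrite /= ler_pdivlMr ?mulr_gt0 ?ltr_wpDl// => hk.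
have a0 := ltW (aN_gt0 k); have tk : 0 <= t ^+ k by rewrite exprn_ge0.
have d0 : 0 < 1 - q2 * q2 ^+ k by rewrite -exprS onem_q2X_gt0.
rewrite ?[q2 ^+ k.+1]exprS [t ^+ k.+1]exprS.
have -> : q2 ^+ k * aN k / (1 - q2 * q2 ^+ k) * (t * t ^+ k) =
  (q2 ^+ k * t / (1 - q2 * q2 ^+ k)) * (aN k * t ^+ k) by ring.
apply: ler_wpM2r; first exact: mulr_ge0.
rewrite ler_pdivrMr//.
have qk0 : 0 <= q2 ^+ k by rewrite exprn_ge0// ltW// q2_gt0.
have qk1 : q2 ^+ k <= 1 by rewrite exprn_ile1// ltW// ?q2_gt0// q2_lt1.
have : q2 * q2 ^+ k <= q2 by rewrite ler_piMr// ltW// q2_gt0.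
move: hk; move: (q2 ^+ k) qk0 qk1 => y y0 y1 hk hq.
nra.
Qed.

(** The ratio of consecutive terms tends to t. *)
Lemma psum_bN (t : R) : 0 <= t < 1 -> (psum (fun k : nat => (`|bN k| * t ^+ k)%R) < +oo)%E.
Proof.
move=> /andP[t0 t1]; pose l := (1 + t) / 2.
have l0 : 0 < l by rewrite /l; lra.
have tl : t < l by rewrite /l; lra.
have [||k0 hk0] := @cvg_expr_small R q2 (1 - t / l).
- by rewrite (ltW q2_gt0) q2_lt1.
- by rewrite subr_gt0 ltr_pdivrMr// mul1r.
apply: (@psum_ratio _ _ l k0).
- by move=> k; rewrite mulr_ge0 ?exprn_ge0.
- by apply/andP; split; rewrite /l; lra.
move=> k hk; have {hk}hk : q2 ^+ k.+1 <= 1 - t / l by apply: hk0; exact: leqW.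
have d0 := onem_q2X_gt0 k.
rewrite [bN _]/= normrM normrN normfV (gtr0_norm d0) [t ^+ k.+1]exprS.
have -> : `|bN k| / (1 - q2 ^+ k.+1) * (t * t ^+ k) =
  (t / (1 - q2 ^+ k.+1)) * (`|bN k| * t ^+ k) by ring.
apply: ler_wpM2r; first by rewrite mulr_ge0 ?exprn_ge0.
rewrite ler_pdivrMr//.
have : t = l * (t / l) by field; rewrite gt_eqF.
nra.
Qed.

(** The q-Bessel coefficients: the Cauchy product of the two series at r^m/z and
    r^m z. They are entire in r^m, so that m may be any integer. *)
Definition cterm m s k : R := r ^ (m * s + 2 * m * k) * (az k * bz (k + s)).

Definition cser m s : R := rsum (cterm m s).

Lemma rsummable_cterm m s : rsummable (cterm m s).
Proof.
rewrite /rsummable psum_zext; last by move=> k; rewrite /cterm /= mul0r mulr0 normr0.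
pose d := (1 - q2)^-1; have q1 : 0 < 1 - q2 by rewrite subr_gt0 q2_lt1.
have d1 : 1 <= d by rewrite invf_ge1// gerBl ltW// q2_gt0.
have d0 : 0 <= d by exact: le_trans d1.
pose t := r ^ (2 * m) * d.
have rpos z : 0 <= r ^ z by rewrite ltW// exprz_gt0.
have fin : (psum (fun k : nat => (r ^ (m * s) * d ^+ `|s|) * (aN k * t ^+ k))%R < +oo)%E.
  have t0 : 0 <= t by rewrite mulr_ge0.
  rewrite psumZ ?mulr_ge0 ?exprn_ge0//.
    by rewrite lte_mul_pinfty ?psum_aN// lee_fin mulr_ge0// exprn_ge0.
  by move=> k; rewrite mulr_ge0 ?exprn_ge0// ltW// aN_gt0.
apply: le_lt_trans fin; apply: le_psum => k.
have bk : `|bz (k%:Z + s)| <= d ^+ `|s| * d ^+ k.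
  case e : (k%:Z + s) => [j|j]; last by rewrite /bz /= normr0 mulr_ge0 ?exprn_ge0.
  rewrite /bz /= (le_trans (bN_le j))// -/d -exprD ler_weXn2l//.
  by lia.
rewrite /cterm /az /= !normrM (ger0_norm (rpos _)) (ger0_norm (ltW (aN_gt0 k))).
rewrite (expfzDr _ _ rn0) -(exprz_exp r (2 * m)) exprMn.
apply: (@le_trans _ _ (r ^ (m * s) * (r ^ (2 * m)) ^ k * (aN k * (d ^+ `|s| * d ^+ k)))).
  by rewrite ler_wpM2l ?mulr_ge0 ?exprn_ge0// ler_wpM2l// ltW// aN_gt0.
by rewrite -exprnP le_eqVlt; apply/orP; left; apply/eqP; ring.
Qed.

Lemma rsum_shift (f : int -> R) t : rsum (fun k => f (k + t)) = rsum f.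
Proof.
rewrite [RHS](@rsum_reindex R int int (fun k => k + t)) //; first exact: addIr.
by move=> i /(_ (i - t)); rewrite subrK.
Qed.

Lemma rsummable_shift (f : int -> R) t : rsummable f -> rsummable (fun k => f (k + t)).
Proof.
apply: le_lt_trans.
exact: (psum_inj_le (h := fun k => k + t) (@addIr _ t) (f := fun k => `|f k|)).
Qed.

(** Termwise, this is the recurrence of bz. *)
Lemma cser_alpha m s : cser m s + r ^ m * cser m (s - 1) = r ^ s * cser (m + 1) s.
Proof.
rewrite /cser -!rsumZ -rsumD; [|exact: rsummable_cterm|exact: rsummableZ (rsummable_cterm _ _)].
congr rsum; apply/funext => k; rewrite /cterm !mulrA -!(expfzDr _ _ rn0).
have -> : m + (m * (s - 1) + 2 * m * k) = m * s + 2 * m * k by ring.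
have -> : s + ((m + 1) * s + 2 * (m + 1) * k) = (m * s + 2 * m * k) + 2 * (k + s) by ring.
rewrite [in RHS](expfzDr _ _ rn0).
have := bz_rec (k + s); rewrite addrA => hb.
by rewrite -mulrDr hb; ring.
Qed.

(** Termwise, this is the recurrence of az, after a shift of the second sum. *)
Lemma cser_beta m s : r ^ s * cser m s = cser (m + 1) s + r ^ (m - 1) * cser (m + 1) (s + 1).
Proof.
rewrite /cser -[in X in _ = _ + _ * X](rsum_shift _ (-1)) -!rsumZ -rsumD; first last.
- by apply: rsummableZ; apply: rsummable_shift; exact: rsummable_cterm.
- exact: rsummable_cterm.
congr rsum; apply/funext => k; rewrite /cterm !mulrA -!(expfzDr _ _ rn0).
have -> : k - 1 + (s + 1) = k + s by ring.
have -> : m - 1 + ((m + 1) * (s + 1) + 2 * (m + 1) * (k - 1)) =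
  (s + (m * s + 2 * m * k)) + 2 * (k - 1) by ring.
have -> : (m + 1) * s + 2 * (m + 1) * k = (s + (m * s + 2 * m * k)) + 2 * k by ring.
rewrite !(expfzDr _ (2 * _) rn0) {1}(az_rec k); ring.
Qed.

(** After a shift of the summation index, az and bz are exchanged by az_bz. *)
Lemma cser_flip m s : cser m (- s) = (-1) ^ s * r ^ (- s) * cser (m + s) s.
Proof.
rewrite /cser -[LHS](rsum_shift _ s) -rsumZ; congr rsum; apply/funext => k.
rewrite /cterm addrK (az_bz (k + s)).
have e : bz k = (-1) ^ k * r ^ (- (k * k - k)) * az k.
  rewrite (az_bz k) !mulrA -invr_expz.
  have u1 : (-1 : R) ^ k * (-1) ^ k = 1 by rewrite -exprzMl ?mulrNN ?mulr1 ?exp1rz// unitrN1.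
  have x0 : r ^ (k * k - k) != 0 by rewrite expfz_neq0.
  by rewrite -[LHS]mul1r -{1}u1; field.
rewrite e.
have u1 : (-1 : R) ^ k * (-1) ^ k = 1 by rewrite -exprzMl ?mulrNN ?mulr1 ?exp1rz// unitrN1.
have -> : (-1 : R) ^ (k + s) = (-1) ^ k * (-1) ^ s by rewrite expfzDr// oppr_eq0 oner_eq0.
transitivity (((-1) ^ k * (-1) ^ k) * ((-1) ^ s * (r ^ (m * - s + 2 * m * (k + s)) *
  r ^ ((k + s) * (k + s) - (k + s)) * r ^ (- (k * k - k))) * (az k * bz (k + s)))); first ring.
rewrite u1 mul1r -!(expfzDr _ _ rn0).
transitivity ((-1) ^ s * (r ^ (- s) * r ^ ((m + s) * s + 2 * (m + s) * k)) * (az k * bz (k + s))); last ring.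
rewrite -(expfzDr _ _ rn0); congr (_ * r ^ _ * _); ring.
Qed.

(** Both sides satisfy cser_alpha and cser_beta, which determine c (m + 1) from
    c m and conversely, and they coincide for m = 1. *)
Lemma cser_sym m s : cser m s = cser (2 - m) (s - m + 1).
Proof.
have up n : (forall s, cser n s = cser (2 - n) (s - n + 1)) ->
    forall s, cser (n + 1) s = cser (2 - (n + 1)) (s - (n + 1) + 1).
  move=> h {}s; have x0 : r ^ s != 0 by rewrite expfz_neq0.
  apply: (mulfI x0); rewrite -cser_alpha !h.
  have -> : 2 - (n + 1) = 1 - n by ring.
  have -> : s - (n + 1) + 1 = s - n by ring.
  have := cser_beta (1 - n) (s - n).
  have -> : 1 - n + 1 = 2 - n by ring.
  have -> : s - 1 - n + 1 = s - n by ring.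
  rewrite (expfzDr s (- n) rn0) => hb.
  have y0 : r ^ (- n) != 0 by rewrite expfz_neq0.
  have z0 : r ^ n != 0 by rewrite expfz_neq0.
  apply: (mulfI y0); rewrite mulrDr !mulrA -(expfzDr _ _ rn0) addNr expr0z mul1r.
  have -> : r ^ (- n) * r ^ s * cser (1 - n) (s - n) = r ^ s * r ^ (- n) * cser (1 - n) (s - n) by ring.
  have e : 1 - n - 1 = - n by ring.
  by rewrite hb e addrC.
have down n : (forall s, cser (n + 1) s = cser (2 - (n + 1)) (s - (n + 1) + 1)) ->
    forall s, cser n s = cser (2 - n) (s - n + 1).
  move=> h {}s; have x0 : r ^ s != 0 by rewrite expfz_neq0.
  apply: (mulfI x0); rewrite cser_beta !h.
  have -> : 2 - (n + 1) = 1 - n by ring.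
  have -> : s - (n + 1) + 1 = s - n by ring.
  have -> : s + 1 - (n + 1) + 1 = s - n + 1 by ring.
  have := cser_alpha (1 - n) (s - n + 1).
  have -> : 1 - n + 1 = 2 - n by ring.
  have -> : s - n + 1 - 1 = s - n by ring.
  have -> : s - n + 1 = s + (1 - n) by ring.
  rewrite (expfzDr s _ rn0) => ha.
  have y0 : r ^ (1 - n) != 0 by rewrite expfz_neq0.
  apply: (mulfI y0).
  have -> : r ^ (1 - n) * (r ^ s * cser (2 - n) (s + (1 - n))) =
    r ^ s * r ^ (1 - n) * cser (2 - n) (s + (1 - n)) by ring.
  rewrite -ha mulrDr mulrA -(expfzDr _ _ rn0).
  have -> : 1 - n + (n - 1) = 0 by ring.
  by rewrite expr0z mul1r addrC.
suff h : forall (k : nat), (forall s, cser (1 + k%:Z) s = cser (2 - (1 + k%:Z)) (s - (1 + k%:Z) + 1)) /\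
    (forall s, cser (1 - k%:Z) s = cser (2 - (1 - k%:Z)) (s - (1 - k%:Z) + 1)).
  have -> : m = 1 + (m - 1) by ring.
  case: (m - 1) => k; first by have [h1 _] := h k; exact: h1.
  by rewrite NegzE; have [_ h2] := h k.+1; exact: h2.
elim=> [|k [ih1 ih2]].
  by split=> {}s; congr cser; ring.
split.
  have -> : 1 + k.+1%:Z = (1 + k%:Z) + 1 by rewrite -addn1 PoszD; ring.
  exact: (up (1 + k%:Z) ih1).
apply: (down (1 - k.+1%:Z)) => {}s.
have -> : 1 - k.+1%:Z + 1 = 1 - k%:Z by rewrite -addn1 PoszD; ring.
exact: ih2.
Qed.

End QSeries.

(** ** Power series with real coefficients *)

Section PowerSeries.
Variable R : realType.
Local Notation C := R[i].
Local Notation T2 := (measurableTypeR R * measurableTypeR R)%type.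
Implicit Types (v : int -> R) (w : C) (k : int).

Definition causal v := forall n : nat, v (Negz n) = 0.

Definition pterm v w k : C := (v k)%:C * w ^ k.

Definition pser v w : C := csum (pterm v w).

Definition converges v (t : R) := (psum (fun n : nat => (`|v n| * t ^+ n)%R) < +oo)%E.

Lemma cabs_pterm v w k : cabs (pterm v w k) = `|v k| * cabs w ^ k.
Proof. by rewrite /pterm cabsM cabsR cabs_exprz. Qed.

Lemma psum_pterm v w : causal v ->
  psum (fun k => cabs (pterm v w k)) = psum (fun n : nat => (`|v n| * cabs w ^+ n)%R).
Proof.
move=> hv; rewrite psum_zext => [|n]; last by rewrite cabs_pterm hv normr0 mul0r.
by congr psum; apply/funext => n; rewrite cabs_pterm.
Qed.

Lemma asum_pterm v w : causal v -> converges v (cabs w) -> asum (pterm v w).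
Proof. by move=> hv h; rewrite /asum psum_pterm. Qed.

Lemma converges_le v (s t : R) : 0 <= s <= t -> converges v t -> converges v s.
Proof.
move=> /andP[s0 st]; apply: le_lt_trans; apply: le_psum => n.
by rewrite ler_wpM2l// lerXn2r// nnegrE// (le_trans s0).
Qed.

Lemma pser_conj v w : causal v -> pser v w^* = (pser v w)^*.
Proof.
move=> hv; rewrite /pser -csum_conj; congr csum; apply/funext => -[n|n].
  rewrite /pterm conjcM conjc_real; congr (_ * _).
  by rewrite -[LHS]/(w^* ^+ n) -[_ ^ _]/(w ^+ n) -!conjE rmorphXn.
by rewrite /pterm hv !mul0r conjc0.
Qed.

Lemma pterm_shift v w k : causal v -> (v (k - 1))%:C * w ^ k = w * pterm v w (k - 1).
Proof.
move=> hv; case: k => [[|n]|n].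
- by rewrite /pterm (hv 0%N) !mul0r mulr0.
- have -> : n.+1%:Z - 1 = n by rewrite -addn1 PoszD addrK.
  by rewrite /pterm -[w ^ n.+1]/(w ^+ n.+1) exprS -[w ^ n]/(w ^+ n); ring.
- have -> : Negz n - 1 = Negz n.+1 by rewrite !NegzE -opprD -PoszD addn1.
  by rewrite /pterm hv !mul0r mulr0.
Qed.

Lemma shiftB1_bij : bijective (fun k : int => k - 1).
Proof. by exists (fun k : int => k + 1) => k; rewrite ?subrK ?addrK. Qed.

Lemma csum_pterm_shift v w : causal v -> converges v (cabs w) ->
  asum (fun k => (v (k - 1))%:C * w ^ k) /\
  csum (fun k => (v (k - 1))%:C * w ^ k) = w * pser v w.
Proof.
move=> hv h; have ha := asum_pterm hv h.
have -> : (fun k => (v (k - 1))%:C * w ^ k) = (fun k => w * pterm v w (k - 1)).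
  by apply/funext => k; rewrite pterm_shift.
have hs : asum (fun k => pterm v w (k - 1)) by apply: (asum_inj (bij_inj shiftB1_bij) ha).
split; first exact: asumZ.
by rewrite csumZ// -(csum_bij (pterm v w) shiftB1_bij).
Qed.

(** Use |w|^n <= |w| t^(n-1) for n >= 1. *)
Lemma pser_near0 v (t : R) : causal v -> 0 < t -> converges v t ->
  exists K : R, forall w, cabs w <= t -> cabs (pser v w - (v 0)%:C) <= K * cabs w.
Proof.
move=> hv t0 ht; exists (fine (psum (fun n : nat => `|v n| * t ^+ n)) / t) => w wt.
have hw : converges v (cabs w) by apply: converges_le ht; rewrite cabs_ge0.
have ha := asum_pterm hv hw.
pose d k : C := (v 0)%:C * (k == 0)%:R.
have hd : asum d by apply: (@asum_single _ _ 0) => k k0; rewrite /d (negbTE k0) mulr0.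
have -> : (v 0)%:C = csum d.
  by rewrite (csum_single (i0 := 0)) => [|k k0]; rewrite /d ?eqxx ?mulr1// (negbTE k0) mulr0.
rewrite /pser -csumB//.
pose g k : R := (cabs w / t) * (`|zext (fun n => v n) k| * t ^ k).
have g0 k : 0 <= g k.
  by rewrite /g !mulr_ge0 ?cabs_ge0 ?invr_ge0 ?(ltW t0)// exprz_ge0// ltW.
have gE : psum g = ((cabs w / t)%:E * psum (fun n : nat => (`|v n| * t ^+ n)%R))%E.
  rewrite psum_zext => [|n]; last by rewrite /g /= normr0 mul0r mulr0.
  by rewrite psumZ// => [|n]; rewrite !mulr_ge0 ?cabs_ge0 ?invr_ge0 ?exprn_ge0 ?(ltW t0).
have gfin : (psum g < +oo)%E.
  by rewrite gE lte_mul_pinfty// lee_fin !mulr_ge0 ?cabs_ge0 ?invr_ge0 ?(ltW t0).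
have [|h1 h2] := @anorm_le R int (fun k => pterm v w k - d k) g gfin.
  case=> [[|n]|n].
  - by rewrite /pterm /d expr0z eqxx subrr cabs0.
  - rewrite /d mulr0 subr0 cabs_pterm /g /= -[_ ^ n.+1]/(_ ^+ n.+1) -[t ^ n.+1]/(t ^+ n.+1).
    rewrite !exprS.
    have -> : cabs w / t * (`|v n.+1| * (t * t ^+ n)) = `|v n.+1| * (cabs w * t ^+ n).
      by field; rewrite gt_eqF.
    by rewrite !ler_wpM2l ?cabs_ge0// lerXn2r// nnegrE ?cabs_ge0// ltW.
  - by rewrite /d mulr0 subr0 /pterm hv mul0r cabs0.
rewrite (le_trans (cabs_csum h1))// (le_trans h2)// gE.
rewrite fineM//; first by rewrite /= le_eqVlt; apply/orP; left; apply/eqP; ring.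
by rewrite ge0_fin_numE// psum_ge0// => n; rewrite mulr_ge0// exprn_ge0// ltW.
Qed.

(** Partial sums are polynomials, so an entire series is a Borel function. *)
Lemma cmeasurable_pser v : causal v -> (forall t : R, 0 <= t -> converges v t) ->
  @cmeasurable _ T2 R (fun z => pser v (toC z)).
Proof.
move=> hv hc.
pose s n := [seq Posz j | j <- iota 0 n].
pose g n (z : T2) k := if k \in s n then pterm v (toC z) k else 0.
have us n : uniq (s n) by rewrite map_inj_uniq ?iota_uniq// => ? ? [].
have gE n z : csum (g n z) = \sum_(k <- s n) pterm v (toC z) k.
  have [|_ ->] := @csum_seq R int (s n) (g n z) (us n).
    by move=> i hi; rewrite /g (negbTE hi).
  by apply: eq_big_seq => i hi; rewrite /g hi.
have mid : @cmeasurable _ T2 R (fun z => toC z).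
  by split; [exact: measurable_fst|exact: measurable_snd].
have mX n : @cmeasurable _ T2 R (fun z => toC z ^+ n).
  elim: n => [|n ih].
    by have := @cmeasurable_cst _ T2 R 1; congr cmeasurable; apply/funext => z; rewrite expr0.
  have := cmeasurableM mid ih; congr cmeasurable; apply/funext => z; by rewrite exprS.
have mg n : @cmeasurable _ T2 R (fun z => csum (g n z)).
  have -> : (fun z : T2 => csum (g n z)) = (fun z => \sum_(k <- s n) pterm v (toC z) k).
    by apply/funext => z; exact: gE.
  rewrite /s; elim: (iota 0 n) => [|k l ih].
    have := @cmeasurable_cst _ T2 R 0; congr cmeasurable; apply/funext => z.
    by rewrite big_nil.
  have := cmeasurableD (cmeasurableM (@cmeasurable_cst _ T2 R (v k)%:C) (mX k)) ih.
  by congr cmeasurable; apply/funext => z; rewrite /= big_cons.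
have cv z : cabs (csum (g n z) - pser v (toC z)) @[n --> \oo] --> (0 : R).
  apply: csum_dominated.
  - by apply: asum_pterm => //; apply: hc; exact: cabs_ge0.
  - by move=> n i; rewrite /g; case: ifP => // _; rewrite cabs0 cabs_ge0.
  - case=> k; last by apply: nearW => n; rewrite /g; case: ifP => // _; rewrite /pterm hv mul0r.
    exists k.+1 => // n /= hn; rewrite /g ifT//.
    by apply/mapP; exists k => //; rewrite mem_iota.
have cvR (F : C -> R) : (forall a b, `|F a - F b| <= cabs (a - b)) ->
    forall z, F (csum (g n z)) @[n --> \oo] --> F (pser v (toC z)).
  move=> hF z; apply/cvgrPdist_le => e e0.
  have /cvgrPdist_le/(_ e e0)[N _ hN] := cv z.
  exists N => // n hn; rewrite distrC (le_trans (hF _ _))//.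
  by have := hN n hn; rewrite /= sub0r normrN ger0_norm// cabs_ge0.
split.
- apply: (measurable_fun_cvg (h := fun n z => complex.Re (csum (g n z)))) => [n|z _].
    by have [] := mg n.
  by apply: (cvR (fun a => complex.Re a)) => a b; rewrite -Re_sub cabs_Re.
- apply: (measurable_fun_cvg (h := fun n z => complex.Im (csum (g n z)))) => [n|z _].
    by have [] := mg n.
  by apply: (cvR (fun a => complex.Im a)) => a b; rewrite -Im_sub cabs_Im.
Qed.

End PowerSeries.

(** ** The two Euler products, and the function F of the functional calculus *)

Lemma cvg0_small (R : realType) (u : nat -> R) (e : R) : (forall n, 0 <= u n) ->
  u n @[n --> \oo] --> (0 : R) -> 0 < e -> exists N, forall n, (N <= n)%N -> u n < e.
Proof.
move=> u0 /cvgrPdist_lt/(_ e) h /h[N _ hN]; exists N => n hn.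
by have := hN n hn; rewrite /= sub0r normrN ger0_norm.
Qed.

Section EulerProducts.
Variables (R : realType) (r : R).
Hypotheses (r0 : 0 < r) (r1 : r < 1).
Local Notation C := R[i].
Local Notation T2 := (measurableTypeR R * measurableTypeR R)%type.
Local Notation q2 := (r ^+ 2).
Implicit Types (w : C) (k : int).

Definition aser w : C := pser (az r) w.
Definition bser w : C := pser (bz r) w.

Lemma causal_az : causal (az r). Proof. by []. Qed.
Lemma causal_bz : causal (bz r). Proof. by []. Qed.

Lemma converges_az (t : R) : 0 <= t -> converges (az r) t.
Proof.
move=> t0; rewrite /converges.
have -> : (fun n : nat => `|az r n| * t ^+ n) = (fun n => aN r n * t ^+ n).
  by apply/funext => n; rewrite ger0_norm// az_ge0.
exact: psum_aN.
Qed.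

Lemma converges_bz (t : R) : 0 <= t < 1 -> converges (bz r) t.
Proof. exact: psum_bN. Qed.

Lemma real_exprz (x : R) k : (x ^ k)%:C = x%:C ^ k.
Proof. exact: (fmorphXz (real_complex R)). Qed.

Let qz k : (r ^ (2 * k))%:C = q2%:C ^ k.
Proof. by rewrite -exprz_exp real_exprz. Qed.

Lemma aser_rec w : aser w = (1 + w) * aser (q2%:C * w).
Proof.
pose v k := az r k * r ^ (2 * k).
have hv : causal v by move=> n; rewrite /v mul0r.
have pv w' : pterm v w' = pterm (az r) (q2%:C * w').
  by apply/funext => k; rewrite /pterm /v rmorphM/= qz expfzMl mulrA.
have cv : converges v (cabs w).
  rewrite /converges -(psum_pterm w hv) pv (psum_pterm _ causal_az).
  by apply: converges_az; rewrite cabs_ge0.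
have [h1 h2] := csum_pterm_shift hv cv.
have e : aser (q2%:C * w) = pser v w by rewrite /aser /pser pv.
rewrite mulrDl mul1r e -h2 -(csumD (asum_pterm hv cv) h1).
rewrite /aser /pser; congr csum; apply/funext => k.
by rewrite /pterm /v -mulrDl -rmorphD/= -(az_rec r0 r1).
Qed.

Lemma bser_rec w : cabs w < 1 -> bser (q2%:C * w) = (1 + w) * bser w.
Proof.
move=> w1; have cb : converges (bz r) (cabs w) by apply: converges_bz; rewrite cabs_ge0.
have [h1 h2] := csum_pterm_shift causal_bz cb.
have ab := asum_pterm causal_bz cb.
rewrite mulrDl mul1r -[w * bser w]h2 -[X in X + _]/(csum (pterm (bz r) w)) -(csumD ab h1).
rewrite /bser /pser; congr csum; apply/funext => k.
rewrite /pterm -mulrDl -rmorphD/= (bz_rec r0 r1) expfzMl.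
have -> : (r ^ (2 * k) * bz r k)%:C = (r ^ (2 * k))%:C * (bz r k)%:C by rewrite rmorphM.
by rewrite qz; ring.
Qed.

Let cabs_q2X n w : cabs (q2%:C ^+ n * w) = q2 ^+ n * cabs w.
Proof. by rewrite cabsM cabsX cabsR ger0_norm// ltW// q2_gt0. Qed.

Lemma cvg_q2X (w : C) : cabs (q2%:C ^+ n * w) @[n --> \oo] --> (0 : R).
Proof.
have h : (q2 ^+ n * cabs w) @[n --> \oo] --> 0 * cabs w.
  by apply: cvgMl; apply: cvg_expr; rewrite ger0_norm ?q2_lt1// ltW// q2_gt0.
rewrite mul0r in h; have -> // : (fun n => cabs (q2%:C ^+ n * w)) = (fun n => q2 ^+ n * cabs w).
by apply/funext => n; rewrite cabs_q2X.
Qed.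

Lemma cvg_pser_q2X (v : int -> R) (t : R) w : causal v -> v 0 = 1 -> 0 < t -> converges v t ->
  cabs (pser v (q2%:C ^+ n * w) - 1) @[n --> \oo] --> (0 : R).
Proof.
move=> hv v0 t0 ht; have [K hK] := pser_near0 hv t0 ht.
have cv := cvg_q2X w.
apply/cvgrPdist_le => e e0.
have K0 : 0 < `|K| + 1 by rewrite ltr_wpDl.
have [|N hN] := cvg0_small (fun n => cabs_ge0 _) cv (e := Num.min t (e / (`|K| + 1))).
  by rewrite lt_min t0 divr_gt0.
exists N => // n hn; have := hN n hn.
rewrite lt_min sub0r normrN (ger0_norm (cabs_ge0 _))// => /andP[/ltW ht1 /ltW ht2].
have := hK _ ht1; rewrite v0 => h; apply: (le_trans h).
have kk : K <= `|K| + 1 by rewrite (le_trans (ler_norm K))// lerDl.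
apply: (le_trans (ler_wpM2r _ kk)); first exact: cabs_ge0.
by rewrite mulrC -ler_pdivlMr.
Qed.

Lemma cvg_aser w : cabs (aser (q2%:C ^+ n * w) - 1) @[n --> \oo] --> (0 : R).
Proof. by apply: (@cvg_pser_q2X _ 1) => //; exact: converges_az. Qed.

Lemma cvg_bser w : cabs (bser (q2%:C ^+ n * w) - 1) @[n --> \oo] --> (0 : R).
Proof.
apply: (@cvg_pser_q2X _ (1 / 2)).
- by [].
- by [].
- by lra.
- by apply: converges_bz; apply/andP; split; lra.
Qed.

Lemma aser_conj w : aser w^* = (aser w)^*.
Proof. exact: pser_conj causal_az. Qed.

Opaque aser bser.

(** The product of the two series is invariant under w |-> q2 w, hence equal to
    its value at 0. *)
Lemma aser_bser w : cabs w < 1 -> aser w * bser w = 1.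
Proof.
move=> w1.
have inv n : aser (q2%:C ^+ n * w) * bser (q2%:C ^+ n * w) = aser w * bser w.
  elim: n => [|n ih]; first by rewrite expr0 mul1r.
  have lt1 : cabs (q2%:C ^+ n * w) < 1.
    rewrite cabs_q2X; apply: le_lt_trans w1; apply: ler_piMl; first exact: cabs_ge0.
    by apply: exprn_ile1; apply: ltW; [exact: q2_gt0|exact: q2_lt1].
  apply: etrans ih; rewrite exprS -mulrA (bser_rec lt1).
  by rewrite (aser_rec (q2%:C ^+ n * w)) mulrCA mulrA.
apply/eqP; rewrite -subr_eq0 -cabs_eq0; apply/eqP.
have ca := cvg_aser w; have cb := cvg_bser w.
have lim0 : 3 * (cabs (aser (q2%:C ^+ n * w) - 1) + cabs (bser (q2%:C ^+ n * w) - 1))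
    @[n --> \oo] --> (0 : R).
  by rewrite -[X in _ --> X](mulr0 3) -[X in 3 * X](addr0 0); apply: cvgMr; apply: cvgD.
apply/eqP; rewrite eq_le cabs_ge0 andbT; apply/ler_addgt0Pr => e e0; rewrite add0r.
have [N1 h1] := cvg0_small (fun n => cabs_ge0 _) ca (@ltr01 R).
have [|N2 h2] := cvg0_small _ lim0 e0.
  by move=> n; rewrite mulr_ge0 ?addr_ge0 ?cabs_ge0.
pose n := maxn N1 N2.
have := h1 n (leq_maxl _ _); have := h2 n (leq_maxr _ _); rewrite -(inv n).
move: (aser _) (bser _) => a b /ltW hb ha.
apply: le_trans hb.
have -> : a * b - 1 = (a - 1) * (b - 1) + ((a - 1) + (b - 1)) by ring.
rewrite (le_trans (cabsD _ _))// cabsM.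
have := cabsD (a - 1) (b - 1); have := cabs_ge0 (a - 1); have := cabs_ge0 (b - 1).
move: ha; move: (cabs (a - 1)) (cabs (b - 1)) (cabs (_ + _)) => x y z x1 y0 x0 hz.
nra.
Qed.

Lemma aser_prod n w :
  aser w = (\prod_(k < n) (1 + q2%:C ^+ k * w)) * aser (q2%:C ^+ n * w).
Proof.
elim: n => [|n ih]; first by rewrite big_ord0 expr0 !mul1r.
by rewrite ih big_ord_recr/= -mulrA [q2%:C ^+ n.+1]exprS -(mulrA q2%:C) -aser_rec.
Qed.

Lemma aser_neq0 w : cabs w < 1 -> aser w != 0.
Proof.
move=> /aser_bser h; apply/eqP => h0; move: h; rewrite h0 mul0r => /esym/eqP.
by rewrite oner_eq0.
Qed.

(** Some q2^n w is in the unit disk, where aser has no zero. *)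
Lemma aser_eq0 w : (aser w == 0) = `[< exists k : nat, 1 + q2%:C ^+ k * w = 0 >].
Proof.
apply/eqP/asboolP => [h|[k hk]]; last first.
  by rewrite (aser_prod k.+1) big_ord_recr/= hk mulr0 mul0r.
have [N hN] := cvg0_small (fun n => cabs_ge0 _) (cvg_q2X w) (@ltr01 R).
have /aser_neq0 hne := hN N (leqnn N).
move: h; rewrite (aser_prod N) => /eqP; rewrite mulf_eq0 (negbTE hne) orbF.
by move=> /prodf_eq0[k _ /eqP hk]; exists k.
Qed.

End EulerProducts.

Opaque aser bser.

Lemma lim_quotient (K : numFieldType) (u c d : nat -> K) (a : K) :
  (forall n, u n = a * (c n / d n)) ->
  c @ \oo --> (1 : K) -> d @ \oo --> (1 : K) -> lim (u @ \oo) = a.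
Proof.
move=> hu c1 d1; apply: cvg_lim => //; rewrite (funext hu).
rewrite -[X in _ --> X]mulr1 -[X in _ * X](divr1 (1 : K)).
apply: cvgM; first exact: cvg_cst.
by apply: cvgM => //; apply: cvgV => //; exact: oner_neq0.
Qed.

Section QuantumExponential.
Variables (R : realType) (q : R[i]).
Local Notation C := R[i].
Local Notation T2 := (measurableTypeR R * measurableTypeR R)%type.
Local Notation r := (cabs q).
Local Notation q2 := (r ^+ 2).
Hypotheses (r0 : 0 < r) (r1 : r < 1).
Implicit Types (w : C).
Local Notation aser := (aser r).

Let rC0 : r%:C != 0 :> C.
Proof. by rewrite -cabs_eq0 cabsR normr_eq0 gt_eqF. Qed.

Let q2X (k : nat) : q2%:C ^+ k = `|q| ^+ (2 * k) :> C.
Proof. by rewrite normE exprM rmorphXn. Qed.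

Let conj_q2X (k : nat) w : (q2%:C ^+ k * w)^* = q2%:C ^+ k * w^* :> C.
Proof. by rewrite -!conjE rmorphM rmorphXn/= conjE conjc_real. Qed.

Let exceptional w : (exists k : nat, w = - `|q| ^- (2 * k)) <->
  exists k : nat, 1 + q2%:C ^+ k * w = 0.
Proof.
have n0 k : q2%:C ^+ k != 0 :> C by rewrite q2X normE expf_neq0.
split=> -[k hk]; exists k.
  by rewrite hk -q2X mulrN divff// subrr.
apply: (mulfI (n0 k)); rewrite -q2X mulrN divff//.
by apply/eqP; rewrite -subr_eq0 opprK addrC hk.
Qed.

Let partial_product w (n : nat) : aser w != 0 ->
  \prod_(k < n) ((1 + `|q| ^+ (2 * k) * conjc w) / (1 + `|q| ^+ (2 * k) * w)) =
  conjc (aser w) / aser w * (aser (q2%:C ^+ n * w) / conjc (aser (q2%:C ^+ n * w))).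
Proof.
move=> w0.
have e (w' : C) : \prod_(k < n) (1 + `|q| ^+ (2 * k) * w') = \prod_(k < n) (1 + q2%:C ^+ k * w').
  by apply: eq_bigr => k _; rewrite q2X.
have pw := aser_prod r0 r1 n w; have pc := aser_prod r0 r1 n w^*.
rewrite prodf_div !e.
rewrite -conj_q2X !aser_conj in pc.
have [P0 c0] : \prod_(k < n) (1 + q2%:C ^+ k * w) != 0 /\ aser (q2%:C ^+ n * w) != 0.
  by apply/andP; rewrite -negb_or -mulf_eq0 -pw.
move: pc pw P0 c0; move: (aser (q2%:C ^+ n * w)) (\prod_(k < n) (1 + q2%:C ^+ k * w)) => c P pc pw P0 c0.
have c0' : conjc c != 0 by rewrite -cabs_eq0 cabsJ cabs_eq0.
rewrite pc pw.
by field; rewrite P0 c0 c0'.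
Qed.

(** The partial products converge, in the topology of the complex field. *)
Lemma FqE w : Fq q w = if aser w == 0 then -1 else (aser w)^* / aser w.
Proof.
rewrite aser_eq0// /Fq (asbool_equiv_eq (exceptional w)).
case: ifPn => // hw; have w0 : aser w != 0 by rewrite aser_eq0.
have c1 : (fun n => aser (q2%:C ^+ n * w) : (C : numFieldType)) @ \oo --> (1 : (C : numFieldType)).
  apply/(@cvgrPdist_lt C C^o) => -[e e'] /[dup]; rewrite ltcE/= => /andP[/eqP-> e0] _.
  have [N hN] := cvg0_small (fun n => cabs_ge0 _) (cvg_aser r0 r1 w) e0.
  by exists N => // n hn; rewrite /= distrC normE ltcR; exact: hN.
have c2 : (fun n => aser (q2%:C ^+ n * conjc w) : (C : numFieldType)) @ \oo --> (1 : (C : numFieldType)).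
  apply/(@cvgrPdist_lt C C^o) => -[e e'] /[dup]; rewrite ltcE/= => /andP[/eqP-> e0] _.
  have [N hN] := cvg0_small (fun n => cabs_ge0 _) (cvg_aser r0 r1 w^*) e0.
  by exists N => // n hn; rewrite /= distrC normE ltcR; exact: hN.
apply: (@lim_quotient C _ _ _ _ _ c1 c2) => n.
by rewrite -(conj_q2X n w) aser_conj; exact: partial_product.
Qed.

Lemma cabs_Fq w : cabs (Fq q w) = 1.
Proof.
rewrite FqE; case: ifPn => [_|w0]; first by rewrite cabsN cabs1.
by rewrite cabsM cabsJ cabsV divff// cabs_eq0.
Qed.

Lemma bmeasurable_Fq : @bmeasurable _ T2 R (fun z => Fq q (toC z)).
Proof.
split; last by exists 1 => z; rewrite cabs_Fq.
have mS : @cmeasurable _ T2 R (fun z => aser (toC z)).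
  by apply: cmeasurable_pser => // t t0; exact: converges_az.
have mn := measurable_cabs_sqr mS.
have mi : measurable_fun [set: T2] (fun z => (cabs (aser (toC z)) ^+ 2) `^ (-1)).
  by apply: (measurableT_comp (measurable_powR _)) mn.
have m0 : measurable_fun [set: T2] (\1_[set z : T2 | cabs (aser (toC z)) ^+ 2 = 0] : T2 -> R).
  apply: measurable_indic.
  have -> : [set z : T2 | cabs (aser (toC z)) ^+ 2 = 0] =
    setT `&` (fun z => cabs (aser (toC z)) ^+ 2) @^-1` [set 0] by rewrite setTI.
  exact: mn.
have := cmeasurableD (cmeasurableM (cmeasurableM (cmeasurable_conj mS) (cmeasurable_conj mS))
  (cmeasurable_real mi)) (cmeasurableM (@cmeasurable_cst _ T2 R (-1)) (cmeasurable_real m0)).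
congr cmeasurable; apply/funext => z; rewrite FqE /=.
have -> : \1_[set z : T2 | cabs (aser (toC z)) ^+ 2 = 0] z = (aser (toC z) == 0)%:R :> R.
  rewrite indicE; congr ((nat_of_bool _)%:R); apply/idP/eqP => [|h]; rewrite inE /=; last by rewrite h cabs0 expr0n.
  by move=> /eqP; rewrite sqrf_eq0 cabs_eq0 => /eqP.
move: (aser (toC z)) => a; case: eqP => [->|/eqP a0].
  by rewrite conjc0 !mul0r add0r mulr1.
rewrite mulr0 addr0 powR_inv1 ?sqr_ge0// fmorphV/= -conjCM.
by field; rewrite -!cabs_eq0 cabsJ !cabs_eq0 a0.
Qed.

End QuantumExponential.

(** ** Fourier coefficients of F on the circles of the spectrum *)

Lemma csum_prod (R : realType) (I J : choiceType) (f : I -> R[i]) (g : J -> R[i]) :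
  asum f -> asum g ->
  asum (fun p : I * J => f p.1 * g p.2) /\
  csum (fun p : I * J => f p.1 * g p.2) = csum f * csum g.
Proof.
move=> sf sg.
have h : asum (fun p : I * J => f p.1 * g p.2).
  apply: asum_pair => [i|]; first exact: (asumZ (f i) sg).
  have -> : (fun i => anorm (fun j => f (i, j).1 * g (i, j).2)) =
      (fun i => anorm g * cabs (f i)).
    apply/funext => i; rewrite /anorm.
    have -> : (fun j => cabs (f (i, j).1 * g (i, j).2)) = (fun j => cabs (f i) * cabs (g j)).
      by apply/funext => j; rewrite cabsM.
    rewrite (psumZ (cabs_ge0 _) (fun j => cabs_ge0 (g j))).
    by rewrite (asumP sg) mulrC.
  rewrite (psumZ (anorm_ge0 g) (fun i => cabs_ge0 (f i))).
  by apply: lte_mul_pinfty sf => //; rewrite lee_fin anorm_ge0.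
split=> //; rewrite (csum_pair h) -(csumZr _ sf); congr csum; apply/funext => i.
exact: (csumZ (f i) sg).
Qed.

(** The series converges uniformly. *)
Lemma fourier_csum (R : realType) (f : measurableTypeR R -> R[i]) (d : int -> R[i]) n :
  bmeasurable f -> asum d -> (forall t, f t = csum (fun k => d k * echar k t)) ->
  fourier f n = d n.
Proof.
move=> mf sd hf; apply/eqP; rewrite -subr_eq0 -cabs_eq0 eq_le cabs_ge0 andbT.
apply/ler_addgt0Pr => e e0; rewrite add0r.
have d0 k : 0 <= cabs (d k) by exact: cabs_ge0.
have [s us hs] := psum_tail d0 sd (divr_gt0 e0 (@ltr0n R 2 : 0 < 2%:R)).
pose l := [seq (k, d k) | k <- s].
have ml := @bmeasurable_tpoly R l.
pose g k := if k \in s then 0 else d k.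
pose c k : R := if k \in s then 0 else cabs (d k).
have gE k : cabs (g k) = c k.
  by rewrite /g /c; case: ifP => // _; rewrite cabs0.
have g0 k : 0 <= c k by rewrite /c; case: ifP.
have gfin : (psum c < +oo)%E.
  exact: lt_trans hs (ltry _).
have ge : fine (psum c) <= e / 2.
  by rewrite -lee_fin -psum_fin// ltW.
have fl t : cabs (f t - tpoly l t) <= e / 2.
  have [|hl sl] := @csum_seq R int s (fun k => if k \in s then d k * echar k t else 0) us.
    by move=> k hk; rewrite (negbTE hk).
  have -> : tpoly l t = csum (fun k => if k \in s then d k * echar k t else 0).
    by rewrite sl /tpoly big_map; apply: eq_big_seq => k hk; rewrite hk.
  have sdt : asum (fun k => d k * echar k t).
    by apply: asum_le sd _ => k; rewrite cabsM cabs_echar mulr1.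
  rewrite hf -csumB//.
  have [k|h1 h2] := @anorm_le R int (fun k => d k * echar k t -
      (if k \in s then d k * echar k t else 0)) _ gfin.
    by rewrite /c; case: ifP => _; rewrite ?subrr ?cabs0// subr0 cabsM cabs_echar mulr1.
  exact: le_trans (cabs_csum h1) (le_trans h2 ge).
have h1 := fourier_le_sup n (bmeasurableB mf ml) fl.
rewrite fourierB// in h1.
have h2 : cabs (fourier (tpoly l) n - d n) <= e / 2.
  rewrite fourier_tpoly big_map.
  have -> : \sum_(k <- s) (k, d k).2 * (n == (k, d k).1)%:R = d n - g n.
    rewrite /g; case: ifPn => hn.
      rewrite subr0 (bigD1_seq n)//= eqxx mulr1 big1 ?addr0// => k kn.
      by rewrite eq_sym (negbTE kn) mulr0.
    rewrite subrr big1_seq// => k /= hk; case: eqP => [e1|_]; last by rewrite mulr0.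
    by rewrite e1 hk in hn.
  rewrite addrAC subrr add0r cabsN gE.
  by rewrite -lee_fin (le_trans _ (ltW hs))// (psum_ge_term n g0).
have -> : fourier f n - d n = (fourier f n - fourier (tpoly l) n) + (fourier (tpoly l) n - d n) by ring.
by rewrite (le_trans (cabsD _ _))// [leRHS]splitr lerD.
Qed.

Section FourierF.
Variables (R : realType) (q : R[i]).
Local Notation C := R[i].
Local Notation T2 := (measurableTypeR R * measurableTypeR R)%type.
Local Notation r := (cabs q).
Local Notation q2 := (r ^+ 2).
Hypotheses (r0 : 0 < r) (r1 : r < 1).
Implicit Types (w z : C) (m n s : int).
Local Notation aser := (aser r).
Local Notation bser := (bser r).

Let rX0 m : r ^ m != 0. Proof. by rewrite expfz_neq0// gt_eqF. Qed.

Let rposz m : 0 < r ^ m. Proof. exact: exprz_gt0. Qed.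

Let q2r m z : q2%:C * ((r ^ m)%:C * z) = (r ^ (m + 2))%:C * z.
Proof. by rewrite mulrA -rmorphM/= -[q2]/(r ^ 2) -expfzDr ?gt_eqF// [2 + m]addrC. Qed.

(** Inside the unit disk, bser is the inverse of aser. *)
Lemma Fq_inner w : cabs w < 1 -> Fq q w = aser (conjc w) * bser w.
Proof.
move=> w1; have a0 := aser_neq0 r0 r1 w1.
rewrite (FqE r0 r1) (negbTE a0) aser_conj; apply: (mulIf a0).
by rewrite divfK// -mulrA [bser w * _]mulrC aser_bser// mulr1.
Qed.

Lemma bmeasurable_Fq_circle (rho : R) :
  bmeasurable (fun t : measurableTypeR R => Fq q (toC (circle rho t))).
Proof. by have [] := approximable_circle rho (bmeasurable_Fq r0 r1). Qed.

Lemma pterm_circle (v : int -> R) m n t k :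
  pterm v ((r ^ m)%:C * echar n t) k = (v k * r ^ (m * k))%:C * echar (n * k) t.
Proof.
rewrite /pterm expfzMl mulrA -real_exprz -exprz_exp rmorphM/=; congr (_ * _).
by rewrite [echar n t]echar_exp [RHS]echar_exp exprz_exp.
Qed.

Lemma skew_bij : bijective (fun sk : int * int => (sk.2, sk.2 + sk.1)).
Proof.
exists (fun kl : int * int => (kl.2 - kl.1, kl.1)) => -[a b] /=; congr (_, _).
- by rewrite addrAC subrr add0r.
- by rewrite addrC subrK.
Qed.

Lemma fourier_Fq_inner m s : 0 < m ->
  fourier (fun t => Fq q (toC (circle (r ^ m) t))) s = (cser r m s)%:C.
Proof.
move=> m0; have rm1 : r ^ m < 1.
  by case: m m0 => // -[//|k] _; rewrite -[r ^ _]/(r ^+ k.+1) exprn_ilt1// ltW.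
pose F t (kl : int * int) := pterm (az r) (conjc (toC (circle (r ^ m) t))) kl.1 *
  pterm (bz r) (toC (circle (r ^ m) t)) kl.2.
pose G (sk : int * int) := (cterm r m sk.1 sk.2)%:C.
have FE t sk : F t (sk.2, sk.2 + sk.1) = G sk * echar sk.1 t.
  case: sk => a k.
  transitivity (pterm (az r) (conjc (toC (circle (r ^ m) t))) k *
    pterm (bz r) (toC (circle (r ^ m) t)) (k + a)); first by [].
  transitivity ((cterm r m a k)%:C * echar a t); last by [].
  rewrite /cterm toC_circle.
  have -> : conjc ((r ^ m)%:C * echar 1 t) = (r ^ m)%:C * echar (- 1) t.
    by rewrite conjcM conjc_real echar_conj.
  rewrite !pterm_circle mulrACA -rmorphM/= -echarD; congr (_%:C * echar _ t); last by ring.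
  rewrite mulrACA -expfzDr ?gt_eqF// mulrC; congr (r ^ _ * _); ring.
have [aF FS] : (forall t, asum (F t)) /\
    forall t, csum (F t) = Fq q (toC (circle (r ^ m) t)).
  suff h t : asum (F t) /\ csum (F t) = Fq q (toC (circle (r ^ m) t)).
    by split=> t; have [] := h t.
  have w1 : cabs (toC (circle (r ^ m) t)) < 1 by rewrite cabs_circle gtr0_norm.
  have ca : asum (pterm (az r) (conjc (toC (circle (r ^ m) t)))).
    apply: (asum_pterm (causal_az r)); apply: (converges_az r0 r1); exact: cabs_ge0.
  have cb : asum (pterm (bz r) (toC (circle (r ^ m) t))).
    apply: (asum_pterm (causal_bz r)); apply: (converges_bz r0 r1).
    by rewrite cabs_ge0.
  by rewrite (Fq_inner w1); exact: (csum_prod ca cb).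
have aG : asum G.
  apply: (asum_le (asum_inj (bij_inj skew_bij) (aF 0))) => sk.
  by rewrite FE cabsM cabs_echar mulr1.
have GE a : csum (fun k => G (a, k)) = (cser r m a)%:C by rewrite csum_real.
apply: (@fourier_csum R _ (fun a => (cser r m a)%:C) s (bmeasurable_Fq_circle _)).
  have [h1 h2] := psum_pair_fin (fun p => cabs_ge0 (G p)) aG.
  rewrite /asum h2 in aG; apply: le_lt_trans aG; apply: le_psum => a.
  by rewrite -GE (cabs_csum (h1 a)).
move=> t; rewrite -FS.
rewrite (csum_bij _ skew_bij) (csum_pair (asum_inj (bij_inj skew_bij) (aF t))).
congr csum; apply/funext => a.
rewrite -GE -csumZr; last exact: (asum_slice a aG).
by congr csum; apply/funext => k; rewrite (FE t (a, k)).
Qed.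

Lemma aser_circle z n : cabs z = 1 -> z != -1 -> aser ((r ^ n)%:C * z) != 0.
Proof.
move=> z1 zn; rewrite (aser_eq0 r0 r1); apply/negP => /asboolP[k].
rewrite mulrA -rmorphXn -rmorphM/= -exprM -[r ^+ _]/(r ^ (2 * k)%N%:Z) -expfzDr ?gt_eqF// => h.
have {}h : (r ^ ((2 * k)%N%:Z + n))%:C * z = -1 by apply/eqP; rewrite -subr_eq0 opprK addrC h.
have : r ^ ((2 * k)%N%:Z + n) = 1.
  by have := congr1 (@cabs R) h; rewrite cabsM z1 mulr1 cabsR gtr0_norm// cabsN cabs1.
by move=> e; rewrite e mul1r in h; rewrite h eqxx in zn.
Qed.

(** The recurrence of F along a ray; the two quotients of 1 + conj w by 1 + w at
    inverse radii differ by a power of the phase. *)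
Lemma Fq_step z n : cabs z = 1 -> z != -1 ->
  (1 + (r ^ n)%:C * z) * Fq q ((r ^ n)%:C * z) =
  (1 + (r ^ n)%:C * z^-1) * Fq q ((r ^ (n + 2))%:C * z).
Proof.
move=> z1 zn; have h1 := aser_circle n z1 zn; have h2 := aser_circle (n + 2) z1 zn.
have F1 := FqE r0 r1 ((r ^ n)%:C * z); rewrite (negbTE h1) in F1.
have F2 := FqE r0 r1 ((r ^ (n + 2))%:C * z); rewrite (negbTE h2) in F2.
have e := aser_rec r0 r1 ((r ^ n)%:C * z); rewrite q2r in e.
have cu : conjc (1 + (r ^ n)%:C * z) = 1 + (r ^ n)%:C * z^-1.
  by rewrite conjcD conjcM conjc1 conjc_real (cabs_unit_conj z1).
have gen (f1 f2 a b u v : C) : f1 = conjc a / a -> f2 = conjc b / b -> a = u * b ->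
    conjc u = v -> a != 0 -> u * f1 = v * f2.
  move=> -> -> -> <-; rewrite mulf_eq0 negb_or => /andP[u0 b0].
  by rewrite conjcM; field; rewrite u0 b0.
exact: (gen _ _ _ _ _ _ F1 F2 e cu h1).
Qed.

Lemma Fq_real (x : R) : Fq q x%:C = if aser x%:C == 0 then -1 else 1.
Proof.
rewrite (FqE r0 r1); case: ifPn => // h.
by rewrite conjE -aser_conj conjc_real divff.
Qed.

(** Two steps of induction on j, from j = 0 and j = 1, by Fq_step at the radii
    r^(-1-j) and r^(1+j). At z = -1 the zeros of aser are exactly the points where
    j is odd. *)
Lemma Fq_reflect z (j : nat) : cabs z = 1 ->
  Fq q ((r ^ (1 - j%:Z))%:C * z) = z ^ (- j%:Z) * Fq q ((r ^ (1 + j%:Z))%:C * z).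
Proof.
move=> z1; have z0 : z != 0 by rewrite -cabs_eq0 z1 oner_eq0.
have [zn|zn] := eqVneq z (-1).
  have rN (x : R) : x%:C * -1 = (- x)%:C :> C by rewrite mulrN1 rmorphN.
  rewrite zn !rN.
  have inner (k : nat) : Fq q (- r ^ (1 + k%:Z))%:C = 1.
    rewrite Fq_real ifN// aser_neq0// cabsR normrN gtr0_norm//.
    by rewrite -PoszD -[r ^ _]/(r ^+ k.+1) exprn_ilt1// ltW.
  rewrite inner mulr1.
  suff h : forall k : nat, Fq q (- r ^ (1 - k%:Z))%:C = (-1) ^ (- k%:Z) /\
      Fq q (- r ^ (1 - k.+1%:Z))%:C = (-1) ^ (- k.+1%:Z).
    exact: (proj1 (h j)).
  have step (n : int) : r ^ n != 1 -> Fq q (- r ^ n)%:C = Fq q (- r ^ (n + 2))%:C.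
    move=> n1; have e := aser_rec r0 r1 ((r ^ n)%:C * -1); rewrite q2r !rN in e.
    have gen (a b u : C) : a = u * b -> u != 0 -> (a == 0) = (b == 0).
      by move=> -> u0; rewrite mulf_eq0 (negbTE u0).
    have u0 : 1 + (- r ^ n)%:C != 0 :> C.
      rewrite -(rmorph1 (real_complex R)) -rmorphD/= -cabs_eq0 cabsR normr_eq0.
      by rewrite subr_eq0 eq_sym.
    have F1 := Fq_real (- r ^ n); have F2 := Fq_real (- r ^ (n + 2)).
    by rewrite (gen _ _ _ e u0) in F1; exact: etrans F1 (esym F2).
  have Fq_m1 : Fq q (-1)%:C = -1.
    rewrite Fq_real (aser_rec r0 r1) ifT//.
    have -> : 1 + (-1)%:C = 0 :> C by apply: complex_eqP; rewrite /= ?subrr ?addr0.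
    by rewrite mul0r.
  elim=> [|k [ih1 ih2]].
    split; first by have -> : 1 - 0%:Z = 1 + 0%:Z by []; rewrite (inner 0%N) oppr0 expr0z.
    by rewrite subrr expr0z Fq_m1 -[- 1%:Z]/(-1)%Z exprN1 invrN1.
  split=> //.
  rewrite step; last first.
    have -> : 1 - k.+2%:Z = - k.+1%:Z by lia.
    by rewrite -invr_expz invr_eq1 lt_eqF// -[r ^ _]/(r ^+ k.+1) exprn_ilt1// ltW.
  have -> : 1 - k.+2%:Z + 2 = 1 - k%:Z by lia.
  rewrite ih1 -!invr_expz; congr (_^-1).
  by rewrite -[(-1) ^ k]/((-1) ^+ k) -[(-1) ^ k.+2]/((-1) ^+ k.+2) !exprS; ring.
suff h : forall k : nat,
    Fq q ((r ^ (1 - k%:Z))%:C * z) = z ^ (- k%:Z) * Fq q ((r ^ (1 + k%:Z))%:C * z) /\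
    Fq q ((r ^ (1 - k.+1%:Z))%:C * z) = z ^ (- k.+1%:Z) * Fq q ((r ^ (1 + k.+1%:Z))%:C * z).
  exact: (proj1 (h j)).
have u0 n : 1 + (r ^ n)%:C * z != 0.
  by apply: contraNneq (aser_circle n z1 zn) => u0; rewrite (aser_rec r0 r1) u0 mul0r.
elim=> [|k [ih1 ih2]].
  split; first by rewrite oppr0 !addr0 expr0z mul1r.
  have gen (f0 f2 : C) : (1 + z) * f0 = (1 + z^-1) * f2 -> f0 = z ^ (- 1%:Z) * f2.
    have v0 : 1 + z != 0 by have := u0 0; rewrite expr0z mul1r.
    move=> h; apply: (mulfI v0); rewrite h -[- 1%:Z]/(-1)%Z exprN1.
    by field.
  have h := Fq_step 0 z1 zn.
  have {}h : (1 + z) * Fq q ((r ^ 0)%:C * z) = (1 + z^-1) * Fq q ((r ^ (0 + 2))%:C * z).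
    by move: h; rewrite expr0z !mul1r.
  exact: (gen _ _ h).
split=> //.
have e1 : 1 - k.+2%:Z + 2 = 1 - k%:Z by lia.
have e2 : 1 + k%:Z + 2 = 1 + k.+2%:Z by lia.
have e3 : 1 - k.+2%:Z = - (1 + k%:Z) by lia.
have e4 : - k.+2%:Z = - k%:Z + - 2 by lia.
have h1 := Fq_step (1 - k.+2%:Z) z1 zn; have h2 := Fq_step (1 + k%:Z) z1 zn.
have u1 := u0 (1 - k.+2%:Z).
rewrite e1 in h1; rewrite e2 in h2; rewrite e3 -invr_expz in h1 u1 *.
have rC : (r ^ (1 + k%:Z))^-1%:C = (r ^ (1 + k%:Z))%:C^-1 :> C by rewrite fmorphV.
rewrite rC in h1 u1 *.
have z2 : z ^ (- k.+2%:Z) = z ^ (- k%:Z) / (z * z) by rewrite e4 expfzDr.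
rewrite z2.
have gen (f1 f2 f3 f4 zk rho : C) : rho != 0 -> 1 + rho^-1 * z != 0 ->
    (1 + rho^-1 * z) * f1 = (1 + rho^-1 * z^-1) * f2 ->
    (1 + rho * z) * f3 = (1 + rho * z^-1) * f4 ->
    f2 = zk * f3 -> f1 = zk / (z * z) * f4.
  move=> x0 v0 g1 g2 g3; apply: (mulfI v0); rewrite g1 g3.
  transitivity ((rho^-1 * z^-1) * zk * ((1 + rho * z) * f3)); first by field; rewrite x0 z0.
  by rewrite g2; field; rewrite x0 z0.
have x0 : (r ^ (1 + k%:Z))%:C != 0 :> C by rewrite -cabs_eq0 cabsR normr_eq0.
exact: (gen _ _ _ _ _ _ x0 u1 h1 h2 ih1).
Qed.

(** For m <= 0, Fq_reflect and cser_sym are the same relation between the circles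
    of radii r^m and r^(2 - m). *)
Lemma fourier_Fq m s :
  fourier (fun t => Fq q (toC (circle (r ^ m) t))) s = (cser r m s)%:C.
Proof.
have [m0|m0] := ltP 0 m; first exact: fourier_Fq_inner.
have [j e] : exists j : nat, m = 1 - j%:Z by exists `|1 - m|%N; lia.
have -> : (fun t => Fq q (toC (circle (r ^ m) t))) =
  (fun t => echar (- j%:Z) t * Fq q (toC (circle (r ^ (2 - m)) t))).
  apply/funext => t; rewrite !toC_circle e Fq_reflect ?cabs_echar// -echar_exp.
  by congr (_ * Fq q ((r ^ _)%:C * _)); ring.
rewrite fourier_shift fourier_Fq_inner; last by lia.
rewrite (cser_sym r0 r1 m); congr (cser _ _ _)%:C; rewrite e; ring.
Qed.

End FourierF.

(** ** Size of the coefficients *)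

Section CserBounds.
Variables (R : realType) (r : R).
Hypotheses (r0 : 0 < r) (r1 : r < 1).
Local Notation C := R[i].
Implicit Types (m n s : int).
Local Notation c := (cser r).

Let rposz m : 0 < r ^ m. Proof. exact: exprz_gt0. Qed.

(** For m >= 1 the Laurent series with coefficients c m converges absolutely
    where both Euler series do. *)
Lemma psum_cser_pos m (x : R) : 0 < m -> 0 < x -> r ^ m * x < 1 ->
  (psum (fun s => `|c m s| * x ^ s)%R < +oo)%E.
Proof.
move=> m0 x0 x1.
have xn : x != 0 by rewrite gt_eqF.
have cR (y : R) : 0 <= y -> cabs (y%:C : C) = y by move=> y0; rewrite cabsR ger0_norm.
have p1 : 0 <= r ^ m / x by rewrite divr_ge0// ltW.
have p2 : 0 <= r ^ m * x by rewrite mulr_ge0// ltW.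
have ca : asum (pterm (az r) (r ^ m / x)%:C).
  apply: (asum_pterm (causal_az r)); apply: (converges_az r0 r1); exact: cabs_ge0.
have cb : asum (pterm (bz r) (r ^ m * x)%:C).
  apply: (asum_pterm (causal_bz r)); apply: (converges_bz r0 r1).
  by rewrite cR// p2.
have [h _] := csum_prod ca cb.
have {}h := asum_inj (bij_inj skew_bij) h.
pose G (sk : int * int) : R := `|cterm r m sk.1 sk.2| * x ^ sk.1.
have hG : (psum (fun sk => G sk) < +oo)%E.
  apply: le_lt_trans h; apply: le_psum => -[s k].
  rewrite cabsM !cabs_pterm !cR// /G /cterm !normrM (gtr0_norm (rposz _)).
  rewrite !expfzMl exprz_inv.
  rewrite !exprz_exp (expfzDr _ _ xn) -invr_expz /=.
  have -> : m * s + 2 * m * k = m * k + m * (k + s) by ring.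
  rewrite (expfzDr _ _ (lt0r_neq0 r0)).
  rewrite le_eqVlt; apply/orP; left; apply/eqP.
  by field; rewrite expfz_neq0.
have G0 p : 0 <= G p by rewrite /G mulr_ge0// exprz_ge0// ltW.
have [h1 h2] := psum_pair_fin G0 hG.
rewrite h2 in hG; apply: le_lt_trans hG; apply: le_psum => s.
have sc := rsummable_cterm r0 r1 m s.
have -> : (fun k => G (s, k)) = (fun k => x ^ s * `|cterm r m s k|).
  by apply/funext => k; rewrite /G mulrC.
have xs : 0 <= x ^ s by rewrite exprz_ge0// ltW.
rewrite psumZ// fineM//; last first.
  by rewrite ge0_fin_numE//; apply: psum_ge0 => k; exact: normr_ge0.
by rewrite /= mulrC; apply: (ler_wpM2l xs); exact: ler_rsum_norm.
Qed.

Lemma psum_cser m (x : R) : 0 < x -> r * x < 1 ->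
  (psum (fun s => `|c m s| * x ^ s)%R < +oo)%E.
Proof.
move=> x0 x1.
have pos n : 0 < n -> (psum (fun s => `|c n s| * x ^ s)%R < +oo)%E.
  move=> n0; apply: psum_cser_pos => //; apply: le_lt_trans x1.
  apply: (ler_wpM2r (ltW x0)).
  case: n n0 => // -[//|k] _; rewrite -[r ^ _]/(r ^+ k.+1) exprS (ler_piMr (ltW r0))//.
  by apply: exprn_ile1; exact: ltW.
have [m0|m0] := ltP 0 m; first exact: pos.
have xn : x != 0 by rewrite gt_eqF.
have sb : bijective (fun s => s + (m - 1)) by exists (fun s => s - (m - 1)) => s; ring.
rewrite (psum_bij _ sb).
have -> : (fun s => `|c m (s + (m - 1))| * x ^ (s + (m - 1))) =
    (fun s => x ^ (m - 1) * (`|c (2 - m) s| * x ^ s)).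
  apply/funext => s; rewrite (cser_sym r0 r1) (expfzDr _ _ xn).
  have -> : s + (m - 1) - m + 1 = s by ring.
  by rewrite mulrA mulrC.
have y0 y : 0 <= x ^ y by rewrite exprz_ge0// ltW.
rewrite psumZ// => [|s]; last by rewrite mulr_ge0.
have p2 : 0 < 2 - m by lia.
by apply: lte_mul_pinfty; [rewrite lee_fin y0|by []|exact: (pos _ p2)].
Qed.

Lemma rsummable_cser m : rsummable (c m).
Proof.
rewrite /rsummable; have := @psum_cser m 1 ltr01; rewrite mulr1 => /(_ r1).
by congr (psum _ < _)%E; apply/funext => s; rewrite exp1rz mulr1.
Qed.

(** F has modulus 1: apply the inequality of Bessel. *)
Lemma l2_cser m : l2 (fun s => (c m s)%:C : C) /\ nsq (fun s => (c m s)%:C : C) <= 1.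
Proof.
have cq : cabs (r%:C : C) = r by rewrite cabsR gtr0_norm.
have q0 : 0 < cabs (r%:C : C) by rewrite cq.
have q1 : cabs (r%:C : C) < 1 by rewrite cq.
have mF := @bmeasurable_Fq_circle R r%:C q0 q1 (r ^ m).
have := bessel mF.
have -> : fourier (fun t : measurableTypeR R => Fq r%:C (toC (circle (r ^ m) t))) = (fun s => (c m s)%:C).
  by apply/funext => s; have := fourier_Fq q0 q1 m s; rewrite cq.
move=> [h1 h2]; split=> //; apply: (le_trans h2).
rewrite -[leRHS](expr1n R 2); apply: usq_le => // t.
by rewrite (cabs_Fq q0 q1).
Qed.

Lemma cser_le1 m s : `|c m s| <= 1.
Proof.
have [h1 h2] := l2_cser m; apply: le_of_sqr; rewrite ?ler01//.
have := nsq_term s h1; rewrite cabsR expr1n => h; exact: (le_trans h h2).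
Qed.

Lemma cser_near1 (e : R) : 0 < e ->
  exists N : nat, forall n : nat, (N <= n)%N -> `|c n 0 - 1| <= e.
Proof.
move=> e0; pose v k := az r k * bz r k.
have hv : causal v by move=> n; rewrite /v /= mul0r.
have q1 : 0 < 1 - r ^+ 2 by rewrite subr_gt0 q2_lt1.
have cv : converges v 1.
  apply: le_lt_trans (psum_aN r0 r1 (t := (1 - r ^+ 2)^-1) _); last by rewrite invr_ge0 ltW.
  apply: le_psum => n; rewrite expr1n mulr1 /v /= normrM (gtr0_norm (aN_gt0 r0 r1 n)).
  by rewrite ler_wpM2l ?(ltW (aN_gt0 r0 r1 n))// bN_le.
have [K hK] := pser_near0 hv ltr01 cv.
have cE m : (c m 0)%:C = pser v (r ^ (2 * m))%:C.
  rewrite /cser -csum_real; congr csum; apply/funext => k.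
  rewrite /cterm /pterm mulr0 add0r addr0 -real_exprz exprz_exp -rmorphM/= mulrC.
  by congr (_ * r ^ _)%:C; ring.
have cvr : (r ^+ n) @[n --> \oo] --> (0 : R) by apply: cvg_expr; rewrite gtr0_norm.
have K0 : 0 < `|K| + 1 by rewrite ltr_wpDl.
have rn0 (n : nat) : 0 <= r ^+ n by rewrite exprn_ge0// ltW.
have [N hN] := cvg0_small rn0 cvr (divr_gt0 e0 K0).
exists N => n hn.
have e1 : r ^ (2 * n%:Z) = r ^+ n * r ^+ n by rewrite -exprD addnn -mul2n.
have rn1 : r ^+ n <= 1 by rewrite exprn_ile1// ltW.
have h := hK (r ^ (2 * n%:Z))%:C; rewrite -cE cabsR (gtr0_norm (rposz _)) e1 in h.
have v0 : v 0 = 1 by rewrite /v /= mulr1.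
have {}h := h (mulr_ile1 (rn0 n) (rn0 n) rn1 rn1).
rewrite v0 -rmorphB/= cabsR in h; apply: (le_trans h).
apply: (@le_trans _ _ ((`|K| + 1) * r ^+ n)); last first.
  by have := hN n hn; rewrite ltr_pdivlMr// mulrC => /ltW.
rewrite mulrA; apply: (@le_trans _ _ (`|K| * (r ^+ n * r ^+ n))).
  by rewrite -mulrA; apply: ler_wpM2r (ler_norm K); exact: mulr_ge0.
apply: ler_pM => //; first exact: mulr_ge0.
  by rewrite lerDl.
by rewrite ler_piMl.
Qed.

End CserBounds.

(** ** The first-order relations determine the coefficients *)

Section Uniqueness.
Variables (R : realType) (r : R).
Hypotheses (r0 : 0 < r) (r1 : r < 1).
Implicit Types (m n s t : int) (E : int -> int -> R).
Local Notation c := (cser r).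

Let rn0 : r != 0. Proof. by rewrite gt_eqF. Qed.
Let rX0 m : r ^ m != 0. Proof. exact: expfz_neq0. Qed.
Let rD m n : r ^ (m + n) = r ^ m * r ^ n. Proof. exact: expfzDr. Qed.
Let rB1 m : r ^ (m - 1) = r ^ m / r. Proof. by rewrite rD exprN1. Qed.

(** The two first-order relations, which raise or lower m by 1. *)
Definition ladder E :=
  (forall m s, E m s + r ^ m * E m (s - 1) = r ^ s * E (m + 1) s) /\
  (forall m s, r ^ s * E m s = E (m + 1) s + r ^ (m - 1) * E (m + 1) (s + 1)).

Lemma ladder_cser : ladder c.
Proof. by split=> m s; [exact: cser_alpha|exact: cser_beta]. Qed.

Lemma ladder_lin (a : R) E E' : ladder E -> ladder E' -> ladder (fun m s => E m s - a * E' m s).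
Proof.
move=> [ea eb] [fa fb]; split=> m s.
  have h1 := ea m s; have h2 := fa m s.
  transitivity ((E m s + r ^ m * E m (s - 1)) - a * (E' m s + r ^ m * E' m (s - 1))); first by ring.
  by rewrite h1 h2; ring.
have h1 := eb m s; have h2 := fb m s.
transitivity (r ^ s * E m s - a * (r ^ s * E' m s)); first by ring.
by rewrite h1 h2; ring.
Qed.

(** Eliminating m + 1 leaves a second-order recurrence in s. *)
Lemma ladder_recurrence E m s : ladder E ->
  r ^ m * E m (s + 1) = r ^+ 2 * ((r ^ s * r ^ s - 1 - (r ^ m / r) ^+ 2) * E m s - r ^ m * E m (s - 1)).
Proof.
move=> [ea eb]; have hb := eb m s; have h1 := ea m s; have h2 := ea m (s + 1).
rewrite addrK rD expr1z in h2; rewrite rB1 in hb.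
have k1 : r ^ s * E (m + 1) s = E m s + r ^ m * E m (s - 1) by rewrite h1.
have k2 : r ^ s * E (m + 1) (s + 1) = (E m (s + 1) + r ^ m * E m s) / r.
  by rewrite h2; field.
have k3 : r ^ s * (r ^ s * E m s) =
    r ^ s * E (m + 1) s + r ^ m / r * (r ^ s * E (m + 1) (s + 1)) by rewrite hb; ring.
rewrite k1 k2 in k3.
transitivity (r ^+ 2 * (r ^ m / r * (E m (s + 1) / r))); first by field.
transitivity (r ^+ 2 * (r ^ s * (r ^ s * E m s) - (E m s + r ^ m * E m (s - 1)) -
  r ^ m / r * (r ^ m * E m s / r))); last by field.
by rewrite k3; field.
Qed.

Lemma ladder_zero E m : ladder E -> E m 0 = 0 -> E m 1 = 0 -> forall s, E m s = 0.
Proof.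
move=> hE h0 h1.
have up s : E m (s - 1) = 0 -> E m s = 0 -> E m (s + 1) = 0.
  move=> e1 e2; apply: (mulfI (rX0 m)); rewrite (ladder_recurrence _ _ hE) e1 e2.
  by rewrite !mulr0 subr0 mulr0.
have down s : E m (s + 1) = 0 -> E m s = 0 -> E m (s - 1) = 0.
  move=> e1 e2; have := ladder_recurrence m s hE; rewrite e1 e2 !mulr0 sub0r => h.
  apply: (mulfI (rX0 m)); apply: oppr_inj; apply: (mulfI (expf_neq0 2 rn0)).
  by rewrite -h mulr0 oppr0 mulr0.
have pos (k : nat) : E m k = 0 /\ E m k.+1 = 0.
  elim: k => [|k [i1 i2]]; first by split.
  split=> //; have -> : k.+2%:Z = k.+1%:Z + 1 by lia.
  by apply: up => //; have -> : k.+1%:Z - 1 = k by lia.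
have neg (k : nat) : E m (- k%:Z) = 0 /\ E m (- k%:Z + 1) = 0.
  elim: k => [|k [i1 i2]]; first by split.
  have e : - k.+1%:Z = - k%:Z - 1 by lia.
  by split; rewrite e ?subrK//; exact: down.
case=> k; first by have [] := pos k.
by rewrite NegzE; have [] := neg k.+1.
Qed.

(** The Wronskian of two bounded solutions grows like r^(2s) at -oo, hence
    vanishes. *)
Lemma ladder_wronskian E (K : R) m s : ladder E -> (forall s, `|E m s| <= K) ->
  E m s * c m (s - 1) = E m (s - 1) * c m s.
Proof.
move=> hE hK; pose W s := E m s * c m (s - 1) - E m (s - 1) * c m s.
have WS n : W (n + 1) = r ^+ 2 * W n.
  apply: (mulfI (rX0 m)); rewrite /W addrK.
  have h1 := ladder_recurrence m n hE; have h2 := ladder_recurrence m n ladder_cser.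
  transitivity ((r ^ m * E m (n + 1)) * c m n - E m n * (r ^ m * c m (n + 1))); first by ring.
  by rewrite h1 h2; ring.
have K0 : 0 <= K by exact: le_trans (normr_ge0 _) (hK 0).
have WK n : `|W n| <= 2 * K.
  rewrite /W (le_trans (ler_normB _ _))// !normrM mulr2n mulrDl mul1r.
  by apply: lerD; rewrite -[leRHS]mulr1; apply: ler_pM => //; exact: cser_le1.
have Wj (j : nat) n : W n = (r ^+ 2) ^+ j * W (n - j%:Z).
  elim: j => [|j ih]; first by rewrite expr0 mul1r subr0.
  rewrite ih; have -> : n - j%:Z = (n - j.+1%:Z) + 1 by lia.
  by rewrite WS [(r ^+ 2) ^+ j.+1]exprSr mulrA.
suff : W s = 0 by move=> /eqP; rewrite subr_eq0 => /eqP.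
have q0 : 0 <= r ^+ 2 by rewrite exprn_ge0// ltW.
have q1 : r ^+ 2 < 1 by exact: q2_lt1.
apply/eqP; rewrite -normr_le0; apply/ler_addgt0Pr => e e0; rewrite add0r.
have K1 : 0 < 2 * K + 1 by rewrite ltr_wpDl// mulr_ge0.
have [k0 hk] := @cvg_expr_small R (r ^+ 2) (e / (2 * K + 1)) (introT andP (conj q0 q1)) (divr_gt0 e0 K1).
have := hk k0 (leqnn _); rewrite ler_pdivlMr// => h; rewrite (Wj k0 s) normrM.
rewrite (ger0_norm (exprn_ge0 _ q0)); apply: le_trans h.
apply: ler_wpM2l; first exact: exprn_ge0.
by apply: (le_trans (WK _)); rewrite lerDl.
Qed.

(** The vanishing Wronskian makes E m 0 / c m 0 constant for large m, and its
    limit is 0. Then E (m + 1) 1 = 0 by the second relation, so that E m vanishes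
    for one large m by the recurrence in s, and for all m by the two relations. *)
Lemma ladder_unique E (K : R) : ladder E -> (forall m s, `|E m s| <= K) ->
  (forall e : R, 0 < e -> exists N : nat, forall n : nat, (N <= n)%N -> `|E n 0| <= e) ->
  forall m s, E m s = 0.
Proof.
move=> hE hK lim0; have [ea eb] := hE; have [ca cb] := ladder_cser.
have cross m s : E m s * c (m + 1) s = E (m + 1) s * c m s.
  have W := ladder_wronskian s hE (hK m).
  apply: (mulfI (rX0 s)).
  transitivity (E m s * (r ^ s * c (m + 1) s)); first by ring.
  transitivity ((r ^ s * E (m + 1) s) * c m s); last by ring.
  rewrite -ca -ea mulrDr mulrDl; congr (_ + _).
  transitivity (r ^ m * (E m s * c m (s - 1))); first by ring.
  by rewrite W; ring.
have h2 : (0 : R) < 1 / 2 by rewrite divr_gt0.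
have [M0 hM0] := cser_near1 r0 r1 h2.
have cpos (n : nat) : (M0 <= n)%N -> 1 / 2 <= c n 0.
  by move=> /hM0; rewrite ler_norml => /andP[h _]; move: h; lra.
have cneq (n : nat) : (M0 <= n)%N -> c n 0 != 0.
  by move=> /cpos h; rewrite gt_eqF// (lt_le_trans h2).
have ratio (n j : nat) : (M0 <= n)%N -> E n 0 / c n 0 = E (n + j)%N 0 / c (n + j)%N 0.
  move=> hn; elim: j => [|j ->]; first by rewrite addn0.
  have u1 := cneq _ (leq_trans hn (leq_addr j n)).
  have u2 := cneq _ (leq_trans hn (leq_addr j.+1 n)).
  apply/eqP; rewrite eqr_div//; apply/eqP.
  have := cross (n + j)%N%:Z 0; have -> : (n + j)%N%:Z + 1 = (n + j.+1)%N by lia.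
  by [].
have E0 (n : nat) : (M0 <= n)%N -> E n 0 = 0.
  move=> hn; suff : E n 0 / c n 0 = 0.
    by move=> /eqP; rewrite mulf_eq0 invr_eq0 (negbTE (cneq _ hn)) orbF => /eqP.
  apply/eqP; rewrite -normr_le0; apply/ler_addgt0Pr => e e0; rewrite add0r.
  have [N hN] := lim0 (e / 2) (divr_gt0 e0 (ltr0n R 2)).
  rewrite (ratio n N hn) normrM normfV.
  have c0 := cpos _ (leq_trans hn (leq_addr N n)).
  have cp : 0 < c (n + N)%N 0 by exact: lt_le_trans h2 c0.
  rewrite (gtr0_norm cp) ler_pdivrMr//.
  apply: (le_trans (hN _ (leq_addl _ _))).
  by apply: (ler_wpM2l (ltW e0)); rewrite -[leLHS]div1r.
have zero1 s : E M0.+1 s = 0.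
  apply: ladder_zero => //; first by apply: E0; exact: leqnSn.
  have h := eb M0 0; rewrite expr0z mul1r add0r in h.
  have e : M0%:Z + 1 = M0.+1 by lia.
  rewrite e (E0 M0)// (E0 M0.+1) ?leqnSn// add0r in h.
  by move/esym/eqP: h; rewrite mulf_eq0 (negbTE (rX0 _)) => /eqP.
have up m : (forall s, E m s = 0) -> forall s, E (m + 1) s = 0.
  by move=> h s; apply: (mulfI (rX0 s)); rewrite -ea !h !mulr0 addr0.
have down m : (forall s, E (m + 1) s = 0) -> forall s, E m s = 0.
  by move=> h s; apply: (mulfI (rX0 s)); rewrite eb !h !mulr0 addr0.
have hup (j : nat) : forall s, E (M0.+1%:Z + j%:Z) s = 0.
  elim: j => [|j ih]; first by rewrite addr0.
  have -> : M0.+1%:Z + j.+1%:Z = (M0.+1%:Z + j%:Z) + 1 by lia.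
  exact: up.
have hdown (j : nat) : forall s, E (M0.+1%:Z - j%:Z) s = 0.
  elim: j => [|j ih]; first by rewrite subr0.
  apply: down; have -> : M0.+1%:Z - j.+1%:Z + 1 = M0.+1%:Z - j%:Z by lia.
  exact: ih.
move=> m; have -> : m = M0.+1%:Z + (m - M0.+1%:Z) by ring.
case: (m - M0.+1%:Z) => k; first exact: hup.
by rewrite NegzE; exact: hdown.
Qed.

End Uniqueness.

(** ** The pentagon identity for the coefficients *)

Section CserPentagon.
Variables (R : realType) (r : R).
Hypotheses (r0 : 0 < r) (r1 : r < 1).
Local Notation C := R[i].
Implicit Types (m n s t : int).
Local Notation c := (cser r).

Let rn0 : r != 0. Proof. by rewrite gt_eqF. Qed.
Let rX0 m : r ^ m != 0. Proof. exact: expfz_neq0. Qed.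
Let rD m n : r ^ (m + n) = r ^ m * r ^ n. Proof. exact: expfzDr. Qed.
Let rpos m : 0 < r ^ m. Proof. exact: exprz_gt0. Qed.

Lemma rsummable_le (f g : int -> R) : rsummable g -> (forall t, `|f t| <= `|g t|) -> rsummable f.
Proof. by move=> hg h; apply: le_lt_trans hg; exact: le_psum. Qed.

Let refl_bij m : bijective (fun t => m - t).
Proof. by exists (fun t => m - t) => t; ring. Qed.

Lemma rsummable_refl (f : int -> R) m : rsummable f -> rsummable (fun t => f (m - t)).
Proof. by rewrite /rsummable (psum_bij _ (refl_bij m)). Qed.

(** The coefficients decay faster than r^(s/2) at +oo, so that a product of two
    of them beats the growth of r^t at -oo. *)
Lemma rsummable_cser_mul m n (b a : int) :
  rsummable (fun t => r ^ t * (c m (b - t) * c n (a - t))).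
Proof.
pose x := (Num.sqrt r)^-1; have sr : 0 < Num.sqrt r by rewrite sqrtr_gt0.
have x0 : 0 < x by rewrite invr_gt0.
have xn : x != 0 by rewrite gt_eqF.
have rx : r = x^-1 * x^-1 by rewrite invrK -expr2 sqr_sqrtr// ltW.
have rx1 : r * x < 1.
  rewrite {1}rx -mulrA mulVf// mulr1 invrK -(sqrtr1 R).
  by rewrite ltr_sqrt// ltr01.
clearbody x.
have xpos k : 0 < x ^ k by exact: exprz_gt0.
pose f k s := c k s * x ^ s.
have fE k s : `|f k s| = `|c k s| * x ^ s by rewrite normrM (gtr0_norm (xpos s)).
have sf k : rsummable (f k).
  rewrite /rsummable; have := @psum_cser R r r0 r1 k x x0 rx1.
  by congr (psum _ < _)%E; apply/funext => s; rewrite fE.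
pose K := fine (psum (fun s => `|f n s|)).
have fK s : `|f n s| <= K.
  rewrite -lee_fin /K -psum_fin//; last exact: sf.
  exact: (psum_ge_term s (fun i => normr_ge0 (f n i))).
have h := rsummableZ (x ^ (- (b + a)) * K) (rsummable_refl b (sf m)).
apply: rsummable_le h _ => t.
have K0 : 0 <= K by exact: le_trans (normr_ge0 _) (fK 0).
have e : r ^ t = x ^ (- (b + a)) * (x ^ (b - t) * x ^ (a - t)).
  rewrite rx expfzMl !exprz_inv -!(expfzDr _ _ xn); congr (x ^ _); ring.
rewrite e.
have -> : x ^ (- (b + a)) * (x ^ (b - t) * x ^ (a - t)) * (c m (b - t) * c n (a - t)) =
  x ^ (- (b + a)) * f n (a - t) * f m (b - t) by rewrite /f; ring.
rewrite !normrM (ger0_norm K0).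
apply: ler_wpM2r; first by rewrite mulr_ge0.
apply: ler_wpM2l; [exact: normr_ge0|by rewrite -normrM; exact: fK].
Qed.

Variables x a : int.

Definition penta y b t : R := c y (b - t) * c (x + y - 1 - b + t) t * c (x - b) (a - t).

Definition pentasum y b : R := rsum (penta y b).

Lemma rsummable_penta y b : rsummable (penta y b).
Proof.
apply: rsummable_le (rsummable_refl b (rsummable_cser r0 r1 y)) _ => t.
rewrite /penta -mulrA normrM -[leRHS]mulr1; apply: ler_wpM2l; first exact: normr_ge0.
by rewrite normrM mulr_ile1// cser_le1.
Qed.

Let rsummableB (f g : int -> R) : rsummable f -> rsummable g -> rsummable (fun t => f t - g t).
Proof.
move=> hf hg; have := rsummableD hf (rsummableZ (-1) hg).
by congr rsummable; apply/funext => t; rewrite mulN1r.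
Qed.

Let rsumB (f g : int -> R) : rsummable f -> rsummable g ->
  rsum (fun t => f t - g t) = rsum f - rsum g.
Proof.
move=> hf hg; have := rsumD hf (rsummableZ (-1) hg).
rewrite rsumZ mulN1r => <-.
by congr rsum; apply/funext => t; rewrite mulN1r.
Qed.

Let rsum_telescope (h : int -> R) n : rsummable h -> rsum (fun t => h (t + n) - h t) = 0.
Proof. by move=> sh; rewrite rsumB// ?rsum_shift ?subrr//; exact: rsummable_shift. Qed.

Let summand (k : int) (u v : int) m n (w : int -> int) :
  rsummable (fun t => r ^ (t + k) * c m (u - t) * c (w t) t * c n (v - t)).
Proof.
apply: rsummable_le (rsummableZ (r ^ k) (rsummable_cser_mul m n u v)) _ => t.
rewrite rD.
have -> : r ^ t * r ^ k * c m (u - t) * c (w t) t * c n (v - t) =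
  r ^ k * (r ^ t * (c m (u - t) * c n (v - t))) * c (w t) t by ring.
by rewrite [leLHS]normrM ler_piMr// cser_le1.
Qed.

(** The relation holds termwise up to h (t - 1) - h t, for the summable family h
    below. *)
Lemma pentasum_alpha y b :
  pentasum y b + r ^ (y + a) * pentasum y (b - 1) = r ^ b * pentasum (y + 1) b.
Proof.
pose h t := r ^ (t + (y + x - b)) * c y (b - 1 - t) * c (x + y - b + t) t * c (x - b) (a - 1 - t).
have sh : rsummable h by exact: summand.
have sp := rsummable_penta.
rewrite /pentasum -!rsumZ -(rsumD (sp y b) (rsummableZ _ (sp y (b - 1)))).
rewrite -[LHS]addr0 -(rsum_telescope (-1) sh) -rsumD; first last.
- by apply: rsummableB => //; exact: rsummable_shift.
- by apply: rsummableD => //; exact: rsummableZ.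
congr rsum; apply/funext => t; rewrite /penta /h.
have e1 : x + (y + 1) - 1 - b + t = x + y - 1 - b + t + 1 by ring.
have e2 : x + y - 1 - (b - 1) + t = x + y - 1 - b + t + 1 by ring.
have e3 : x + y - b + (t - 1) = x + y - 1 - b + t by ring.
have e4 : x + y - b + t = x + y - 1 - b + t + 1 by ring.
have e5 : x - (b - 1) = x - b + 1 by ring.
have e6 : b - 1 - (t - 1) = b - t by ring.
have e7 : a - 1 - (t - 1) = a - t by ring.
have e8 : b - 1 - t = b - t - 1 by ring.
have e9 : a - 1 - t = a - t - 1 by ring.
rewrite e1 e2 e3 e4 e5 e6 e7 e8 e9.
have A1 := cser_alpha r0 r1 y (b - t).
have A2 := cser_alpha r0 r1 (x + y - 1 - b + t) t.
have A3 := cser_alpha r0 r1 (x - b) (a - t).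
set M := x + y - 1 - b + t in A2 *.
have x1 : r ^ b = r ^ (b - t) * r ^ t by rewrite -rD; congr (r ^ _); ring.
have x2 : r ^ (y + a) = r ^ y * r ^ t * r ^ (a - t) by rewrite -!rD; congr (r ^ _); ring.
have x3 : r ^ (t + -1 + (y + x - b)) = r ^ M by rewrite /M; congr (r ^ _); ring.
have x4 : r ^ (t + (y + x - b)) = r ^ y * r ^ t * r ^ (x - b) by rewrite -!rD; congr (r ^ _); ring.
rewrite x1 x2 x3 x4.
transitivity (c y (b - t) * c M t * c (x - b) (a - t) +
  r ^ y * r ^ t * c y (b - t - 1) * c (M + 1) t * (r ^ (a - t) * c (x - b + 1) (a - t)) +
  (r ^ M * c y (b - t) * c M (t - 1) * c (x - b) (a - t) -
   r ^ y * r ^ t * r ^ (x - b) * c y (b - t - 1) * c (M + 1) t * c (x - b) (a - t - 1))).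
  by ring.
rewrite -A3.
transitivity ((r ^ (b - t) * c (y + 1) (b - t)) * (r ^ t * c (M + 1) t) * c (x - b) (a - t)); last by ring.
rewrite -A1.
transitivity (c y (b - t) * (c M t + r ^ M * c M (t - 1)) * c (x - b) (a - t) +
  r ^ y * c y (b - t - 1) * (r ^ t * c (M + 1) t) * c (x - b) (a - t)); first by ring.
by rewrite A2; ring.
Qed.

(** The relation holds termwise up to h (t + 1) - h t. *)
Lemma pentasum_beta y b :
  r ^ b * pentasum y b = pentasum (y + 1) b + r ^ (y + a - 1) * pentasum (y + 1) (b + 1).
Proof.
pose h t := r ^ (t + (y + x - b - 3)) * c (y + 1) (b + 1 - t) *
  c (x + y - 1 - b + t) t * c (x - b) (a + 1 - t).
have sh : rsummable h by exact: summand.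
have sp := rsummable_penta.
rewrite /pentasum -!rsumZ -(rsumD (sp (y + 1) b) (rsummableZ _ (sp (y + 1) (b + 1)))).
rewrite -[RHS]addr0 -(rsum_telescope 1 sh) -rsumD; first last.
- by apply: rsummableB => //; exact: rsummable_shift.
- by apply: rsummableD => //; exact: rsummableZ.
congr rsum; apply/funext => t; rewrite /penta /h.
have e1 : x + (y + 1) - 1 - b + t = x + y - 1 - b + t + 1 by ring.
have e2 : x + (y + 1) - 1 - (b + 1) + t = x + y - 1 - b + t by ring.
have e3 : x + y - 1 - b + (t + 1) = x + y - 1 - b + t + 1 by ring.
have e5 : x - b = x - (b + 1) + 1 by ring.
have e6 : b + 1 - (t + 1) = b - t by ring.
have e7 : a + 1 - (t + 1) = a - t by ring.
have e8 : b + 1 - t = b - t + 1 by ring.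
have e9 : a + 1 - t = a - t + 1 by ring.
rewrite e1 e2 e3 e6 e7 e8 e9.
have B1 := cser_beta r0 r1 y (b - t).
have B2 := cser_beta r0 r1 (x + y - 1 - b + t) t.
have B3 := cser_beta r0 r1 (x - (b + 1)) (a - t).
rewrite -e5 in B3.
set M := x + y - 1 - b + t in B2 *.
have x1 : r ^ b = r ^ (b - t) * r ^ t by rewrite -rD; congr (r ^ _); ring.
have x2 : r ^ (y + a - 1) = r ^ (y - 1) * r ^ t * r ^ (a - t) by rewrite -!rD; congr (r ^ _); ring.
have x3 : r ^ (t + 1 + (y + x - b - 3)) = r ^ (M - 1) by rewrite /M; congr (r ^ _); ring.
have x4 : r ^ (t + (y + x - b - 3)) = r ^ (y - 1) * r ^ t * r ^ (x - (b + 1) - 1).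
  by rewrite -!rD; congr (r ^ _); ring.
rewrite x1 x2 x3 x4.
transitivity ((r ^ (b - t) * c y (b - t)) * (r ^ t * c M t) * c (x - b) (a - t)); first by ring.
transitivity (c (y + 1) (b - t) * c (M + 1) t * c (x - b) (a - t) +
  r ^ (y - 1) * r ^ t * c (y + 1) (b - t + 1) * c M t * (r ^ (a - t) * c (x - (b + 1)) (a - t)) +
  (r ^ (M - 1) * c (y + 1) (b - t) * c (M + 1) (t + 1) * c (x - b) (a - t) -
   r ^ (y - 1) * r ^ t * r ^ (x - (b + 1) - 1) * c (y + 1) (b - t + 1) * c M t *
     c (x - b) (a - t + 1))); last by ring.
rewrite B3 B1.
transitivity (c (y + 1) (b - t) * (r ^ t * c M t) * c (x - b) (a - t) +
  r ^ (y - 1) * r ^ t * c (y + 1) (b - t + 1) * c M t * c (x - b) (a - t)); first by ring.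
by rewrite B2; ring.
Qed.

Lemma ladder_pentasum : ladder r (fun m s => pentasum (m - a) s).
Proof.
have e m : m - a + 1 = m + 1 - a by ring.
split=> m s.
- by have := pentasum_alpha (m - a) s; rewrite subrK e => ->.
- by have := pentasum_beta (m - a) s; rewrite subrK e => ->.
Qed.

(** Cauchy-Schwarz, with the last two factors of penta merged. *)
Lemma penta_cauchy (f : int -> R) y b : l2 (fun t => (f t)%:C : C) ->
  `|rsum (fun t => f t * (c (x + y - 1 - b + t) t * c (x - b) (a - t)))| ^+ 2
  <= nsq (fun t => (f t)%:C : C).
Proof.
move=> hf; pose g t := c (x + y - 1 - b + t) t * c (x - b) (a - t).
have [l2c n2c] := l2_cser r0 r1 (x - b).
have sc := sqnorm_bij (fun s => (c (x - b) s)%:C) (refl_bij a).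
have hg : (sqnorm (fun t => (g t)%:C : C) <= 1%:E)%E.
  apply: (@le_trans _ _ (sqnorm (fun t => (c (x - b) (a - t))%:C : C))).
    rewrite !sqnormE; apply: le_psum => t; rewrite !cabsR.
    rewrite lerXn2r ?nnegrE ?normr_ge0// /g normrM ler_piMl// cser_le1//.
  by rewrite sc (l2_sqnorm l2c) lee_fin.
have [l2g n2g] := l2_le hg.
have [h1 h2] := cauchy_schwarz hf l2g.
have -> : `|rsum (fun t => f t * (c (x + y - 1 - b + t) t * c (x - b) (a - t)))| =
    cabs (csum (fun t => (f t)%:C * (g t)%:C)).
  rewrite -cabsR -csum_real; congr (cabs (csum _)); apply/funext => t.
  by rewrite rmorphM.
apply: le_trans (_ : anorm (fun t => (f t)%:C * (g t)%:C) ^+ 2 <= _).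
  by rewrite lerXn2r ?nnegrE ?cabs_ge0 ?anorm_ge0// cabs_csum.
apply: (le_trans h2); rewrite -[leRHS]mulr1; apply: ler_wpM2l n2g; exact: nsq_ge0.
Qed.

Let l2_refl m b : l2 (fun t => (c m (b - t))%:C : C) /\ nsq (fun t => (c m (b - t))%:C : C) <= 1.
Proof.
have [h1 h2] := l2_cser r0 r1 m.
have sc := sqnorm_bij (fun s => (c m s)%:C) (refl_bij b).
by rewrite /l2 /nsq sc.
Qed.

Let pentaE y b : penta y b = fun t => c y (b - t) * (c (x + y - 1 - b + t) t * c (x - b) (a - t)).
Proof. by apply/funext => t; rewrite /penta mulrA. Qed.

Lemma pentasum_le1 y b : `|pentasum y b| <= 1.
Proof.
have [h1 h2] := l2_refl y b.
apply: le_of_sqr; first exact: ler01.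
by rewrite expr1n /pentasum pentaE (le_trans (penta_cauchy y b h1)).
Qed.

(** Only the term t = 0 survives as y tends to +oo, the sequence c y being a
    vector of norm at most 1 whose coordinate at 0 tends to 1. *)
Lemma pentasum_lim y : exists2 z, pentasum y 0 = c y 0 * (c (x + y - 1) 0 * c x a) + z &
  `|z| ^+ 2 <= 2 * `|c y 0 - 1|.
Proof.
pose f t := if t == 0 then 0 else c y (0 - t).
exists (rsum (fun t => f t * (c (x + y - 1 - 0 + t) t * c (x - 0) (a - t)))).
  pose d t : R := c y 0 * (c (x + y - 1) 0 * c x a) * (t == 0)%:R.
  have dE : rsum d = c y 0 * (c (x + y - 1) 0 * c x a).
    apply: (@complexI R); rewrite -csum_real (csum_single (i0 := 0)) /d ?eqxx ?mulr1// => t t0.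
    by rewrite (negbTE t0) mulr0.
  have sd : rsummable d.
    rewrite /rsummable (psum_single (i0 := 0)) ?ltry// => t t0.
    by rewrite /d (negbTE t0) mulr0 normr0.
  rewrite -dE -rsumD//.
    rewrite /pentasum; congr rsum; apply/funext => t; rewrite pentaE /d /f.
    by case: eqP => [->|_]; rewrite ?mulr0 ?add0r ?mulr1 ?mul0r ?addr0 ?subr0.
  apply: rsummable_le (rsummable_penta y 0) _ => t; rewrite pentaE /f.
  by case: eqP => // _; rewrite mul0r normr0.
have [h1 h2] := l2_refl y 0.
have key : (sqnorm (fun t => (f t)%:C : C) + ((c y 0) ^+ 2)%:E)%E =
    sqnorm (fun t => (c y (0 - t))%:C : C).
  have -> : ((c y 0) ^+ 2)%:E = psum (fun t : int => (c y 0) ^+ 2 * (t == 0)%:R).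
    rewrite (psum_single (i0 := 0)) ?eqxx ?mulr1 ?sqr_ge0// => t t0.
    by rewrite (negbTE t0) mulr0.
  rewrite !sqnormE -psumD; first last.
  - by move=> t; rewrite mulr_ge0 ?sqr_ge0.
  - by move=> t; rewrite sqr_ge0.
  congr psum; apply/funext => t; rewrite /f; case: eqP => [->|_].
    by rewrite cabs0 expr0n add0r mulr1 subr0 cabsR real_normK// num_real.
  by rewrite mulr0 addr0.
have hf : l2 (fun t => (f t)%:C : C).
  apply: le_lt_trans h1; rewrite -key; by apply: leeDl; rewrite lee_fin sqr_ge0.
apply: (le_trans (penta_cauchy y 0 hf)).
have : nsq (fun t => (f t)%:C : C) + c y 0 ^+ 2 <= 1.
  apply: le_trans h2; rewrite -lee_fin EFinD -(l2_sqnorm hf) key.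
  by rewrite (l2_sqnorm h1).
have := cser_le1 r0 r1 y 0.
rewrite ler_norml; move: (nsq _) (c y 0) => A B /andP[b1 b2] hA.
rewrite ler0_norm; last by lra.
nra.
Qed.

Lemma cser_near1_int (e : R) : 0 < e ->
  exists N : nat, forall m : int, N%:Z <= m -> `|c m 0 - 1| <= e.
Proof.
move=> /(cser_near1 r0 r1)[N hN]; exists N => -[n|n] h; first exact: hN.
by exfalso; move: h; lia.
Qed.

(** Both sides solve the ladder relations in y + a and b, and they have the same
    limit at b = 0 as y tends to +oo. *)
Theorem cser_pentagon y b :
  rsum (fun t => c y (b - t) * c (x + y - 1 - b + t) t * c (x - b) (a - t)) =
  c x a * c (y + a) b.
Proof.
pose E m s := pentasum (m - a) s - c x a * c m s.
have hE : ladder r E by apply: (ladder_lin _ ladder_pentasum); exact: ladder_cser.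
have bE m s : `|E m s| <= 2.
  apply: (le_trans (ler_normB _ _)); apply: lerD; first exact: pentasum_le1.
  by rewrite normrM mulr_ile1// cser_le1.
suff E0 : forall m s, E m s = 0.
  have := E0 (y + a) b; rewrite /E addrK => /eqP; rewrite subr_eq0 => /eqP <-.
  by [].
apply: (ladder_unique r0 r1 hE bE) => e e0.
pose d := Num.min (e / 6) (e ^+ 2 / 8).
have d0 : 0 < d by rewrite lt_min !divr_gt0// exprn_gt0.
have [N hN] := cser_near1_int d0.
exists (N + (`|a| + `|(x - 1 - a)%R|))%N => n hn.
have n1 : `|c n 0 - 1| <= d by apply: hN; lia.
have n2 : `|c (n%:Z - a) 0 - 1| <= d by apply: hN; lia.
have n3 : `|c (x + (n%:Z - a) - 1) 0 - 1| <= d by apply: hN; lia.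
have [z ez hz] := pentasum_lim (n%:Z - a).
rewrite /E ez.
have hz2 : `|z| <= e / 2.
  apply: le_of_sqr; first by rewrite divr_ge0// ltW.
  apply: (le_trans hz); apply: (@le_trans _ _ (2 * d)); first by rewrite ler_wpM2l.
  have : d <= e ^+ 2 / 8 by rewrite /d ge_min lexx orbT.
  by rewrite expr_div_n; lra.
have hd : d <= e / 6 by rewrite /d ge_min lexx.
have k1 := cser_le1 r0 r1 x a; have k2 := cser_le1 r0 r1 (x + (n%:Z - a) - 1) 0.
move: n1 n2 n3 k1 k2; move: (c n 0) (c (n%:Z - a) 0) (c (x + (n%:Z - a) - 1) 0) (c x a) => A B D X n1 n2 n3 k1 k2.
have -> : B * (D * X) + z - X * A = ((B - 1) * D + (D - 1) - (A - 1)) * X + z by ring.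
rewrite (le_trans (ler_normD _ _))// [leRHS]splitr; apply: lerD => //.
rewrite normrM; apply: (@le_trans _ _ (`|(B - 1) * D + (D - 1) - (A - 1)|)); first by rewrite ler_piMr.
rewrite (le_trans (ler_normB _ _))//.
have := ler_normD ((B - 1) * D) (D - 1).
have : `|(B - 1) * D| <= d by rewrite normrM (le_trans _ n2)// ler_piMr.
move: (`|_ + _|) (`|_ * _|) => u v; lra.
Qed.

End CserPentagon.

(** * Positive diagonal operators *)

Section Diagonal.
Variable R : realType.
Local Notation C := R[i].

Section OneIndex.
Variable I : choiceType.
Implicit Types (d : I -> R) (x y z w : I -> C).

Definition diag_uop d : uop R I := fun x y => [/\ l2 x, l2 y & y = fun i => (d i)%:C * x i].

Lemma diag_uop_is_uop d : is_uop (diag_uop d).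
Proof.
split=> [x y [//]|x y y' [_ _ ->] [_ _ ->] //|a x y x' y' [hx hy e] [hx' hy' e']].
split; [exact: l2_lin|exact: (l2_lin a hy hy')|].
by apply/funext => i; rewrite e e' mulrDr mulrCA.
Qed.

Lemma restr_seq (s : seq I) x : uniq s ->
  restr s x = fun i => \sum_(k < size s) x (tnth (in_tuple s) k) * delta R (tnth (in_tuple s) k) i.
Proof.
move=> us; apply/funext => i; rewrite -(big_tnth _ _ s xpredT (fun j => x j * delta R j i)).
rewrite /restr /delta; case: ifPn => hi.
  by rewrite (bigD1_seq i)//= eqxx mulr1 big1 ?addr0// => j ji; rewrite eq_sym (negbTE ji) mulr0.
rewrite big1_seq// => j /= hj; case: eqP => [e|_]; last by rewrite mulr0.
by rewrite e hj in hi.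
Qed.

Lemma l2_supp (s : seq I) x : uniq s -> (forall i, i \notin s -> x i = 0) -> l2 x.
Proof.
move=> us h; have -> : x = restr s x.
  by apply/funext => i; rewrite /restr; case: ifPn => // /h.
by have [] := nsq_restr x us.
Qed.

Lemma diag_uop_restr d (s : seq I) x : uniq s ->
  diag_uop d (restr s x) (fun i => (d i)%:C * restr s x i).
Proof.
move=> us; split=> //; apply: (l2_supp us) => i hi; rewrite /restr (negbTE hi) ?mulr0//.
Qed.

Lemma diag_uop_strictly_positive d : (forall i, 0 < d i) -> strictly_positive (diag_uop d).
Proof.
move=> d0; split.
- split; first exact: diag_uop_is_uop.
    move=> x e hx e0; have [s us hs] := l2_corestr_small hx e0.
    exists (restr s x), (fun i => (d i)%:C * restr s x i); split; first exact: diag_uop_restr.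
    have -> : (fun i => x i - restr s x i) = corestr s x.
      by apply/funext => i; rewrite (restr_corestr s x i) addrAC subrr add0r.
    by rewrite (l2_sqnorm (l2_corestr s hx)) lte_fin.
  move=> y z; split=> [[hy hz e]|[hy hz h]].
    split=> // x x' [hx hx' ->]; rewrite e; congr csum; apply/funext => i.
    by rewrite !conjE conjcM conjc_real mulrCA mulrA.
  split=> //; apply/funext => i.
  have dd : diag_uop d (delta R i) (fun j => (d j)%:C * delta R i j).
    have dE j : (d j)%:C * delta R i j = (d i)%:C * delta R i j.
      by rewrite /delta; case: eqP => [->//|_]; rewrite !mulr0.
    split=> //; first exact: l2_delta.
    by rewrite (funext dE); apply: l2Z; exact: l2_delta.
  have := h _ _ dd; rewrite inner_deltal => <-.
  rewrite /inner (csum_single (i0 := i)); first by rewrite conjE /delta eqxx mulr1 conjc_real.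
  by move=> j ji; rewrite conjE /delta (negbTE ji) mulr0 conjc0 mul0r.
- move=> x y [hx hy e]; rewrite e /inner.
  have -> : (fun i => (x i)^* * ((d i)%:C * x i)) = (fun i => (d i * cabs (x i) ^+ 2)%:C).
    by apply/funext => i; rewrite mulrCA [RHS]rmorphM/= -conjCM.
  rewrite csum_real ler0c.
  have h0 i : 0 <= d i * cabs (x i) ^+ 2 by rewrite mulr_ge0 ?sqr_ge0// ltW.
  by rewrite (rsum_ge0 h0); exact: fine_psum_ge0.
- move=> x y [_ _ ->] h i.
  have d1 : (d i)%:C != 0 :> C by rewrite -cabs_eq0 cabsR normr_eq0 gt_eqF.
  by apply: (mulfI d1); rewrite mulr0.
Qed.

(** On a fibre of nu the diagonal operator is a scalar, so that no domain has to
    be followed through T. *)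
Lemma conj_diag_uop (T : op R I I) (nu : I -> int) (g : int -> R) :
  unitary_op T ->
  (forall n x, l2 x -> T (fun i => if nu i == n then x i else 0) =
     fun i => if nu i == n then T x i else 0) ->
  forall z w, conj_uop T (diag_uop (fun i => g (nu i))) z w <->
    diag_uop (fun i => g (nu i)) z w.
Proof.
move=> [[Tl2 Tlin] Tiso Tsur] Tnu z w.
have l2P n x : l2 x -> l2 (fun i => if nu i == n then x i else 0).
  apply: le_lt_trans; rewrite !sqnormE; apply: le_psum => i.
  by case: ifP => // _; rewrite cabs0 expr0n sqr_ge0.
have TZ (a : C) x : l2 x -> T (fun i => a * x i) = fun i => a * T x i.
  move=> hx; have T0 : T (fun _ => 0) = fun _ => 0.
    have := Tlin (-1) x x hx hx.
    have -> : (fun i => -1 * x i + x i) = (fun _ => 0) by apply/funext => i; ring.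
    by move=> ->; apply/funext => i; ring.
  have := Tlin a x (fun _ => 0) hx (l2_0 _ _); rewrite T0.
  have -> : (fun i => a * x i + 0) = (fun i => a * x i) by apply/funext => i; rewrite addr0.
  by move=> ->; apply/funext => i; rewrite addr0.
split=> [[z' [w' [[hz hw e] -> ->]]]|[hz hw e]].
  split; [exact: Tl2|exact: Tl2|apply/funext => i].
  have := congr1 (@^~ i) (Tnu (nu i) w' hw); rewrite /= eqxx => <-.
  have := congr1 (@^~ i) (Tnu (nu i) z' hz); rewrite /= eqxx => <-.
  have -> : (fun j => if nu j == nu i then w' j else 0) =
      (fun j => (g (nu i))%:C * (if nu j == nu i then z' j else 0)).
    by apply/funext => j; rewrite e; case: eqP => [->|_]; rewrite ?mulr0.
  by rewrite TZ//; exact: l2P.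
have [z' hz' ez] := Tsur z hz; have [w' hw' ew] := Tsur w hw.
exists z', w'; split=> //; split=> //; apply/funext => i.
pose n := nu i.
have : T (fun j => (if nu j == n then w' j else 0) - (g n)%:C * (if nu j == n then z' j else 0)) =
    fun _ => 0.
  have -> : (fun j => (if nu j == n then w' j else 0) - (g n)%:C * (if nu j == n then z' j else 0)) =
      (fun j => (- (g n)%:C) * (if nu j == n then z' j else 0) + (if nu j == n then w' j else 0)).
    by apply/funext => j; rewrite mulNr addrC.
  rewrite Tlin; [|exact: l2P|exact: l2P].
  rewrite !Tnu// ez ew; apply/funext => j; rewrite e.
  by case: eqP => [->|_]; rewrite ?mulr0 ?addr0//; ring.
set v := (fun j => _) => Tv.
have hv : l2 v.
  have := l2_lin (- (g n)%:C) (l2P n z' hz') (l2P n w' hw').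
  by congr l2; apply/funext => j; rewrite /v mulNr addrC.
have v0 : sqnorm v = 0%E.
  rewrite -(Tiso _ hv) Tv sqnormE -[RHS](psum0 R I); congr psum.
  by apply/funext => j; rewrite cabs0 expr0n.
have vi : v i = 0.
  apply: cabs0_eq0; apply/eqP; rewrite -sqrf_eq0 eq_le sqr_ge0 andbT.
  have := nsq_term i hv; rewrite /nsq v0 /=. done.
by move: vi; rewrite /v /n eqxx => /eqP; rewrite subr_eq0 => /eqP.
Qed.

End OneIndex.

Lemma tens_delta (I J : choiceType) (p p' : I * J) :
  tens (delta R p.1) (delta R p.2) p' = delta R p p'.
Proof. by case: p p' => [a b] [a' b']; rewrite /tens /delta xpair_eqE -mulnb natrM. Qed.

(** Coordinates being continuous, a limit of finite sums of tensors satisfies the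
    diagonal relation. Conversely z and w are truncated to a common finite set
    of basis vectors, found from the family v of modulus^2 = |z|^2 + |w|^2. *)
Lemma tens_diag_uop (I J : choiceType) (d : I -> R) (d' : J -> R) z w :
  tens_uop (diag_uop d) (diag_uop d') z w <-> diag_uop (fun p => d p.1 * d' p.2) z w.
Proof.
split=> [[hz hw h]|[hz hw e]]; split=> //.
  apply/funext => p; apply/eqP; rewrite -subr_eq0 -cabs_eq0 eq_le cabs_ge0 andbT.
  apply/ler_addgt0Pr => e e0; rewrite add0r.
  pose D := d p.1 * d' p.2; pose K := 1 + `|D|.
  have K0 : 0 < K by rewrite ltr_pwDl.
  pose e' := (e / K); have e'0 : 0 < e' by rewrite divr_gt0.
  have [n [x [x' [y [y' [hx hy sz sw]]]]]] := h (e' ^+ 2) (exprn_gt0 2 e'0).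
  set A := \sum_(k < n) tens (x k) (y k) p; set B := \sum_(k < n) tens (x' k) (y' k) p.
  have AB : B = D%:C * A.
    rewrite /A /B mulr_sumr; apply: eq_bigr => k _; rewrite /tens.
    by have [_ _ ->] := hx k; have [_ _ ->] := hy k; rewrite /D rmorphM/=; ring.
  have small (v : I * J -> C) : (sqnorm v < (e' ^+ 2)%:E)%E -> cabs (v p) <= e'.
    move=> hv; have [l2v nv] := l2_le (ltW hv).
    by apply: le_of_sqr (ltW e'0) _; exact: le_trans (nsq_term p l2v) nv.
  have s1 := small _ sz; have s2 := small _ sw.
  have -> : w p - D%:C * z p = (w p - B) - D%:C * (z p - A) by rewrite AB; ring.
  rewrite (le_trans (cabsB _ _))// cabsM cabsR.
  apply: (@le_trans _ _ (e' + `|D| * e')).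
    by apply: lerD => //; apply: ler_wpM2l => //.
  by rewrite -[X in X + _]mul1r -mulrDl -/K /e' mulrC divfK// gt_eqF.
move=> eps eps0.
pose v p : C := (cabs (z p)) +i* (cabs (w p)).
have vE p : cabs (v p) ^+ 2 = cabs (z p) ^+ 2 + cabs (w p) ^+ 2 by rewrite cabs_sqr.
have hv : l2 v.
  rewrite /l2 sqnormE; have -> : (fun p => cabs (v p) ^+ 2) = (fun p => cabs (z p) ^+ 2 + cabs (w p) ^+ 2).
    by apply/funext => p; exact: vE.
  by rewrite psumD -?sqnormE ?lte_add_pinfty// => p; exact: sqr_ge0.
have [s us hs] := l2_corestr_small hv eps0.
have small (a : I * J -> C) : (forall p, cabs (a p) ^+ 2 <= cabs (v p) ^+ 2) ->
    (sqnorm (corestr s a) < eps%:E)%E.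
  move=> ha; apply: (@le_lt_trans _ _ (sqnorm (corestr s v))).
    rewrite !sqnormE; apply: le_psum => p; rewrite /corestr.
    by case: ifP => // _; rewrite ?lexx.
  by rewrite (l2_sqnorm (l2_corestr s hv)) lte_fin.
have co (a : I * J -> C) : (fun p => a p - restr s a p) = corestr s a.
  by apply/funext => p; rewrite (restr_corestr s a p) addrAC subrr add0r.
pose pt (k : 'I_(size s)) := tnth (in_tuple s) k.
have restr_tens (a : I * J -> C) p :
    restr s a p = \sum_(k < size s) tens (fun i => a (pt k) * delta R (pt k).1 i) (delta R (pt k).2) p.
  rewrite (restr_seq a us); apply: eq_bigr => k _.
  by rewrite -tens_delta /tens mulrA.
exists (size s), (fun k i => z (pt k) * delta R (pt k).1 i),
  (fun k i => (d (pt k).1)%:C * (z (pt k) * delta R (pt k).1 i)),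
  (fun k => delta R (pt k).2), (fun k j => (d' (pt k).2)%:C * delta R (pt k).2 j).
have diagd (K : choiceType) (b : K -> R) (c : C) (i : K) :
    diag_uop b (fun i' => c * delta R i i') (fun i' => (b i)%:C * (c * delta R i i')).
  split; [by apply: l2Z; exact: l2_delta| |].
    by do 2 apply: l2Z; exact: l2_delta.
  by apply/funext => i'; rewrite /delta; case: eqP => [->//|_]; rewrite !mulr0.
split.
- by move=> k; exact: diagd.
- move=> k; have := diagd J d' 1 (pt k).2.
  have f1 : (fun i' => 1 * delta R (pt k).2 i') = delta R (pt k).2.
    by apply/funext => i'; rewrite mul1r.
  by rewrite f1; have -> : (fun i' => (d' (pt k).2)%:C * (1 * delta R (pt k).2 i')) =
    (fun i' => (d' (pt k).2)%:C * delta R (pt k).2 i') by apply/funext => i'; rewrite mul1r.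
- under [X in sqnorm X]eq_fun => p do rewrite -restr_tens.
  by rewrite co; apply: small => p; rewrite vE lerDl sqr_ge0.
- have -> : (fun p => w p - \sum_(k < size s)
      tens (fun i => (d (pt k).1)%:C * (z (pt k) * delta R (pt k).1 i))
        (fun j => (d' (pt k).2)%:C * delta R (pt k).2 j) p) = (fun p => w p - restr s w p).
    apply/funext => p; congr (_ - _); rewrite restr_tens; apply: eq_bigr => k _.
    by rewrite /tens e rmorphM/=; ring.
  by rewrite co; apply: small => p; rewrite vE lerDr sqr_ge0.
Qed.

Lemma id_uop_diag (I : choiceType) : @id_uop R I = diag_uop (fun _ => 1).
Proof.
apply/funext => x; apply/funext => y; apply/propext.
have e : (fun i => 1%:C * x i) = x by apply/funext => i; rewrite mul1r.
by split=> [[hx ->]|[hx _ ->]]; rewrite /diag_uop /id_uop e.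
Qed.

End Diagonal.

(** * The operators of the theorem in coordinates *)

Section Coordinates.
Variable R : realType.
Local Notation C := R[i].

Lemma basis_op_monomial (I J : choiceType) (f : I -> J -> C) (a : I -> C)
    (h : I -> J) (g : J -> I) : cancel h g -> cancel g h ->
  (forall i j, f i j = a i * delta R (h i) j) ->
  forall x, basis_op f x = fun j => a (g j) * x (g j).
Proof.
move=> hg gh hf x; apply/funext => j; rewrite /basis_op (csum_single (i0 := g j)).
  by rewrite hf /delta gh eqxx mulr1 mulrC.
move=> i ij; rewrite hf /delta; case: eqP => [e|_]; last by rewrite !mulr0.
by rewrite e hg eqxx in ij.
Qed.

(** For unimodular a, the inverse operator. *)
Lemma adj_monomial (I J : choiceType) (T : op R I J) (a : J -> C)
    (g : J -> I) (h : I -> J) : cancel h g -> cancel g h ->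
  (forall x, T x = fun j => a j * x (g j)) ->
  forall y, adj T y = fun i => conjc (a (h i)) * y (h i).
Proof.
move=> hg gh hT y; apply/funext => i; rewrite /adj /inner hT (csum_single (i0 := h i)).
  by rewrite conjE /delta hg eqxx mulr1.
move=> j ji; rewrite conjE /delta; case: eqP => [e|_]; last by rewrite mulr0 conjc0 mul0r.
by rewrite -e gh eqxx in ji.
Qed.

Lemma WE (x : int * int -> C) : W x = fun p => x (p.1, p.2 - p.1).
Proof.
rewrite /W (@basis_op_monomial _ _ _ (fun _ => 1) (fun p => (p.1, p.2 + p.1))
  (fun p => (p.1, p.2 - p.1))).
- by apply/funext => p; rewrite mul1r.
- by case=> a b; rewrite /= addrK.
- by case=> a b; rewrite /= subrK.
- by case=> a b j; rewrite mul1r.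
Qed.

Local Notation LL := ((int * int) * (int * int))%type.
Implicit Types (p : LL) (s t : int).

Definition ysrc p : LL := (p.1, (p.2.1 - p.1.1 - p.1.2, p.2.2)).

Lemma YE (x : LL -> C) : Y x = fun p => x (ysrc p).
Proof.
by apply/funext => -[[i j] [k l]]; rewrite /Y /= /W13 WE /= /W23 WE /=.
Qed.

Lemma ysrc_bij : bijective ysrc.
Proof.
exists (fun p : LL => (p.1, (p.2.1 + p.1.1 + p.1.2, p.2.2))) => -[[i j] [k l]];
  rewrite /ysrc /=; congr (_, (_, _)); ring.
Qed.

Lemma Y_unitary : unitary_op (@Y R).
Proof.
have := @monomial_unitary R LL LL (fun _ => 1) ysrc (fun _ => @cabs1 R) ysrc_bij.
congr unitary_op; apply/funext => x; rewrite YE; apply/funext => p.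
by rewrite /monomial mul1r.
Qed.

Lemma UE (x : (int * int) * int -> C) : U x = fun a : (int * int) * int => x (a.1, a.2 - a.1.2).
Proof.
rewrite /U (@basis_op_monomial _ _ _ (fun _ => 1) (fun a : (int * int) * int => (a.1, a.2 + a.1.2))
  (fun a : (int * int) * int => (a.1, a.2 - a.1.2))).
- by apply/funext => a; rewrite mul1r.
- by case=> a b; rewrite /= addrK.
- by case=> a b; rewrite /= subrK.
- by case=> [[a b] c] j; rewrite mul1r.
Qed.

Lemma U_unitary : unitary_op (@U R).
Proof.
have b : bijective (fun a : (int * int) * int => (a.1, a.2 - a.1.2)).
  by exists (fun a : (int * int) * int => (a.1, a.2 + a.1.2)) => -[a b]; rewrite /= ?addrK ?subrK.
have := monomial_unitary (fun _ => @cabs1 R) b.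
congr unitary_op; apply/funext => x; rewrite UE; apply/funext => a.
by rewrite /monomial mul1r.
Qed.

Variable q : C.
Local Notation r := (cabs q).
Hypotheses (r0 : 0 < r) (r1 : r < 1).

(** The phase of q; all the scalars of modulus 1 are powers of it. *)
Definition phase : C := q / r%:C.
Local Notation ph := phase.

Lemma qE : q = r%:C * ph.
Proof. by rewrite /phase mulrC divfK// -cabs_eq0 cabsR normr_eq0 gt_eqF. Qed.

Lemma cabs_phase : cabs ph = 1.
Proof. by rewrite /phase cabsM cabsV cabsR gtr0_norm// divff// gt_eqF. Qed.

Lemma phase_neq0 : ph != 0.
Proof. by rewrite -cabs_eq0 cabs_phase oner_eq0. Qed.

Lemma cabs_phX s : cabs (ph ^ s) = 1.
Proof. by rewrite cabs_exprz cabs_phase exp1rz. Qed.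

Lemma phD s t : ph ^ (s + t) = ph ^ s * ph ^ t.
Proof. exact: expfzDr phase_neq0. Qed.

Lemma conj_phX s : conjc (ph ^ s) = ph ^ (- s).
Proof. by rewrite cabs_unit_conj ?cabs_phX// invr_expz. Qed.

Lemma q_exprz s : q ^ s = (r ^ s)%:C * ph ^ s.
Proof. by rewrite real_exprz -expfzMl -qE. Qed.

Lemma zetaE s : zeta q ^ s = ph ^ (2 * s).
Proof.
have rn : r%:C != 0 :> C by rewrite -cabs_eq0 cabsR normr_eq0 gt_eqF.
have -> : zeta q = ph ^ 2.
  rewrite /zeta conjE.
  have -> : conjc q = r%:C * ph^-1.
    by rewrite [in LHS]qE conjcM conjc_real (cabs_unit_conj cabs_phase).
  rewrite {1}qE -[ph ^ 2]/(ph * ph); field.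
  by rewrite rn phase_neq0.
by rewrite exprz_exp.
Qed.

Lemma ZopE (x : LL -> C) : Zop q x = fun p => ph ^ (- (2 * (p.1.2 * p.2.2))) * x p.
Proof.
rewrite /Zop (@basis_op_monomial _ _ _ (fun p => ph ^ (- (2 * (p.1.2 * p.2.2)))) id id)//.
by case=> [[i j] [k l]] p; rewrite /Rmatrix zetaE invr_expz.
Qed.

Lemma ZtildeE (x : LL -> C) : Ztilde q x = fun p => ph ^ (2 * (p.1.2 * p.2.2)) * x p.
Proof.
rewrite /Ztilde (@basis_op_monomial _ _ _ (fun p => ph ^ (2 * (p.1.2 * p.2.2))) id id)//.
by case=> [[i j] [k l]] p; rewrite /Rmatrix zetaE.
Qed.

Lemma adj_ZopE (x : LL -> C) : adj (Zop q) x = fun p => ph ^ (2 * (p.1.2 * p.2.2)) * x p.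
Proof.
rewrite (adj_monomial (g := id) (h := id) _ _ ZopE)//.
by apply/funext => p; rewrite conj_phX opprK.
Qed.

Lemma adj_ZtildeE (x : LL -> C) :
  adj (Ztilde q) x = fun p => ph ^ (- (2 * (p.1.2 * p.2.2))) * x p.
Proof.
rewrite (adj_monomial (g := id) (h := id) _ _ ZtildeE)//.
by apply/funext => p; rewrite conj_phX.
Qed.

Definition swap p : LL := (p.2, p.1).

Lemma swapK : cancel swap swap. Proof. by case. Qed.

Lemma PsiE (x : LL -> C) : Psi q x = fun p => ph ^ (- (2 * (p.1.2 * p.2.2))) * x (swap p).
Proof. by rewrite /Psi /= ZopE. Qed.

Lemma adj_PsiE (x : LL -> C) :
  adj (Psi q) x = fun p => ph ^ (2 * (p.1.2 * p.2.2)) * x (swap p).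
Proof.
rewrite (adj_monomial swapK swapK PsiE).
by apply/funext => p; rewrite conj_phX opprK /swap /= [p.2.2 * _]mulrC.
Qed.

Lemma Psi_unitary : unitary_op (Psi q).
Proof.
have b : bijective swap by exists swap; exact: swapK.
have := @monomial_unitary R LL LL (fun p => ph ^ (- (2 * (p.1.2 * p.2.2)))) swap
  (fun p => cabs_phX _) b.
by congr unitary_op; apply/funext => x; rewrite PsiE.
Qed.

Lemma adj_Psi_unitary : unitary_op (adj (Psi q)).
Proof.
have b : bijective swap by exists swap; exact: swapK.
have := @monomial_unitary R LL LL (fun p => ph ^ (2 * (p.1.2 * p.2.2))) swap
  (fun p => cabs_phX _) b.
by congr unitary_op; apply/funext => x; rewrite adj_PsiE.
Qed.

Lemma adj_Zop_unitary : unitary_op (adj (Zop q)).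
Proof.
have b : bijective (id : LL -> LL) by exists id.
have := @monomial_unitary R LL LL (fun p => ph ^ (2 * (p.1.2 * p.2.2))) id
  (fun p => cabs_phX _) b.
by congr unitary_op; apply/funext => x; rewrite adj_ZopE.
Qed.

Lemma adj_Ztilde_unitary : unitary_op (adj (Ztilde q)).
Proof.
have b : bijective (id : LL -> LL) by exists id.
have := @monomial_unitary R LL LL (fun p => ph ^ (- (2 * (p.1.2 * p.2.2)))) id
  (fun p => cabs_phX _) b.
by congr unitary_op; apply/funext => x; rewrite adj_ZtildeE.
Qed.

(** The gauge in which X has the positive weights r^(k-i+1). *)
Definition gauge p : C := ph ^ (p.1.2 * p.1.2 - p.1.2 * (p.2.1 - p.1.1)).

Lemma cabs_gauge p : cabs (gauge p) = 1.
Proof. exact: cabs_phX. Qed.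

Lemma gauge_tau s p : gauge p * conjc (gauge (tau s p)) =
  ph ^ (s * (p.2.1 - p.1.1) - s * s - 2 * p.1.2 * s).
Proof. by rewrite /gauge conj_phX -phD; congr (ph ^ _); rewrite /tau /=; ring. Qed.

Lemma X_wshift : X q = wshift_uop r gauge.
Proof.
apply/funext => x; apply/funext => y; rewrite /X /wshift_uop.
pose a p : C := zeta q ^ (- p.1.2) * q ^ (p.2.1 - p.1.1 + 1).
rewrite (@basis_op_monomial _ _ _ a (tau (- 1)) (tau 1)); first last.
- by case=> [[i j] [k l]] p; rewrite /a /tau /= opprK.
- by move=> p; rewrite tauD addrN tau0.
- by move=> p; rewrite tauD addNr tau0.
suff -> : (fun j => a (tau 1 j) * x (tau 1 j)) = wshift r gauge x by [].
apply/funext => p; rewrite /wshift [RHS]mulrA conjE gauge_tau; congr (_ * _).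
rewrite /a zetaE q_exprz mulrCA -phD /rmod /tau /=.
have -> : p.2.1 + 1 - (p.1.1 + 1) + 1 = p.2.1 - p.1.1 + 1 by ring.
by congr (_ * ph ^ _); ring.
Qed.

Lemma measurable_Cbar : measurable (Cbar q : set (measurableTypeR R * measurableTypeR R)).
Proof.
have mid : @cmeasurable _ (measurableTypeR R * measurableTypeR R)%type R (fun z => toC z).
  by split; [exact: measurable_fst|exact: measurable_snd].
have mn := measurable_cabs_sqr mid.
have mlev (a : R) : measurable
    [set z : measurableTypeR R * measurableTypeR R | cabs (toC z) ^+ 2 = a].
  by have := mn measurableT [set a] (measurable_set1 a); rewrite setTI.
have -> : Cbar q = [set z | cabs (toC z) ^+ 2 = 0] `|`
    \bigcup_(n : int) [set z | cabs (toC z) ^+ 2 = (r ^ n) ^+ 2].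
  apply/seteqP; split=> z /=.
    case=> [->|[n hn]]; [by left; rewrite cabs0 expr0n|right; exists n => //=].
    by move: hn; rewrite !normE -real_exprz => /complexI ->.
  case=> [/eqP|[n _ /= hn]]; first by rewrite sqrf_eq0 cabs_eq0 => /eqP; left.
  right; exists n; rewrite !normE -real_exprz; congr _%:C.
  apply/eqP; rewrite -(eqrXn2 (n := 2))//; [exact/eqP|exact: cabs_ge0|].
  by rewrite exprz_ge0// ltW.
apply: measurableU; first exact: mlev.
by apply: countable_bigcupT_measurable => // n; exact: mlev.
Qed.

Lemma circle_Cbar p (t : R) : Cbar q (circle (rmod r p) t).
Proof.
right; exists (p.2.1 - p.1.1 + 1); rewrite !normE -real_exprz cabs_circle gtr0_norm//.
exact: exprz_gt0.
Qed.

End Coordinates.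

Section TheUnitary.
Variables (R : realType) (q : R[i]).
Local Notation C := R[i].
Local Notation L := (int * int)%type.
Local Notation LL := ((int * int) * (int * int))%type.
Local Notation r := (cabs q).
Local Notation ph := (phase q).
Local Notation T2 := (measurableTypeR R * measurableTypeR R)%type.
Local Notation c := (cser (cabs q)).
Hypotheses (r0 : 0 < r) (r1 : r < 1).
Implicit Types (p : LL) (s t : int) (x : LL -> C).

Definition FX : op R LL LL := Phi r (gauge q) (fun z : T2 => Fq q (toC z)).

Lemma FX_fun_calc : is_fun_calc (X q) (Cbar q) (Fq q) FX.
Proof.
rewrite (X_wshift r0); apply: (wshift_fun_calc _ r0).
- by move=> p; exact: cabs_gauge.
- exact: measurable_Cbar.
- exact: circle_Cbar.
- exact: bmeasurable_Fq.
Qed.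

Definition theF : op R LL LL := FX \o @Y R.

Lemma unitary_theF : unitary_op theF.
Proof.
apply: unitary_comp; last exact: Y_unitary.
apply: Phi_unitary.
- by move=> p; exact: cabs_gauge.
- exact: bmeasurable_Fq.
- by move=> z; exact: cabs_Fq.
Qed.

Lemma ofourier_Fq p s : ofourier r (fun z : T2 => Fq q (toC z)) p s =
  (c (p.2.1 - p.1.1 + 1) s)%:C.
Proof. exact: fourier_Fq. Qed.

(** The basis vectors with nonzero coefficient in the row of index p. *)
Definition fsrc s p : LL := ((p.1.1 + s, p.1.2 + s),
  (p.2.1 - p.1.1 - p.1.2 - s, p.2.2 - s)).

Definition fcoef p s : C :=
  ph ^ (s * (p.2.1 - p.1.1) - s * s - 2 * p.1.2 * s) * (c (p.2.1 - p.1.1 + 1) s)%:C.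

Lemma theFE x : theF x = fun p => csum (fun s => fcoef p s * x (fsrc s p)).
Proof.
apply/funext => p; rewrite /theF /= YE /FX.
transitivity (csum (fun s => gauge q p * conjc (gauge q (tau s p)) *
  ofourier r (fun z : T2 => Fq q (toC z)) p s * x (ysrc (tau s p)))); first by [].
congr csum; apply/funext => s; rewrite (gauge_tau r0) ofourier_Fq /fcoef; congr (_ * x _).
by case: p => [[i j] [k l]]; rewrite /ysrc /tau /fsrc /=; congr (_, (_, _)); ring.
Qed.

Lemma theF_covariant (x : L * L * int -> C) :
  leg12 (K := int) theF (leg13 (J := (int * int)%type) (@U R) (leg23 (I := (int * int)%type) (@U R) x)) =
  leg13 (J := (int * int)%type) (@U R) (leg23 (I := (int * int)%type) (@U R) (leg12 (K := int) theF x)).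
Proof.
apply/funext => -[[a b] h].
rewrite /leg13 /leg12 /leg23 !theFE UE /= UE /= theFE /=.
congr csum; apply/funext => s; rewrite UE /= UE /=; congr (_ * x (_, _)).
by ring.
Qed.

End TheUnitary.

(** * The pentagon equation *)

Section Pentagon.
Variables (R : realType) (q : R[i]).
Local Notation C := R[i].
Local Notation L := (int * int)%type.
Local Notation LL := ((int * int) * (int * int))%type.
Local Notation LLL := (L * L * L)%type.
Local Notation r := (cabs q).
Local Notation ph := (phase q).
Local Notation c := (cser (cabs q)).
Local Notation F := (theF q).
Hypotheses (r0 : 0 < r) (r1 : r < 1).
Implicit Types (s t : int) (a b d : L) (x : LLL -> C).

Lemma pentagon_left x a b d :
  leg23 (I := L) F (leg12 (K := L) F x) (a, b, d) =
  csum (fun s => fcoef q (b, d) s * csum (fun t =>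
    fcoef q (a, (fsrc s (b, d)).1) t *
    x (fsrc t (a, (fsrc s (b, d)).1), (fsrc s (b, d)).2))).
Proof.
rewrite /leg23 (theFE r0 r1); congr csum; apply/funext => s; congr (_ * _).
rewrite /leg12 (theFE r0 r1); congr csum; apply/funext => t; congr (_ * x _).
Qed.

Lemma pentagon_right x a b d :
  leg12 (K := L) F (leg23 (I := L) (Psi q) (leg12 (K := L) F
    (leg23 (I := L) (adj (Psi q)) (leg23 (I := L) F x)))) (a, b, d) =
  csum (fun s1 => fcoef q (a, b) s1 * (
    ph ^ (- (2 * ((fsrc s1 (a, b)).2.2 * d.2))) *
    csum (fun s2 => fcoef q ((fsrc s1 (a, b)).1, d) s2 * (
      ph ^ (2 * ((fsrc s2 ((fsrc s1 (a, b)).1, d)).2.2 * (fsrc s1 (a, b)).2.2)) *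
      csum (fun s3 =>
        fcoef q ((fsrc s1 (a, b)).2, (fsrc s2 ((fsrc s1 (a, b)).1, d)).2) s3 *
        x ((fsrc s2 ((fsrc s1 (a, b)).1, d)).1,
           (fsrc s3 ((fsrc s1 (a, b)).2, (fsrc s2 ((fsrc s1 (a, b)).1, d)).2)).1,
           (fsrc s3 ((fsrc s1 (a, b)).2, (fsrc s2 ((fsrc s1 (a, b)).1, d)).2)).2)))))).
Proof.
rewrite leg12E (theFE r0 r1); congr csum; apply/funext => s1; congr (_ * _).
case: (fsrc s1 (a, b)) => a1 b1; rewrite leg23E (PsiE r0); congr (_ * _).
rewrite /swap leg12E (theFE r0 r1); congr csum; apply/funext => s2; congr (_ * _).
rewrite /=; case: (fsrc s2 (a1, d)) => a2 d2; rewrite /leg23 /= (adj_PsiE r0); congr (_ * _).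
rewrite /swap /= (theFE r0 r1); congr csum.
Qed.

(** Sums against a basis vector: the indices of the left side are determined,
    those of the right side up to one free parameter. *)
Lemma csum_delta_two (k1 : int -> C) (k2 D : int -> int -> C) s t :
  (forall s' t', D s' t' = ((s' == s) && (t' == t))%:R) ->
  csum (fun s' => k1 s' * csum (fun t' => k2 s' t' * D s' t')) = k1 s * k2 s t.
Proof.
move=> hD.
have inner s' : csum (fun t' => k2 s' t' * D s' t') = k2 s' t * (s' == s)%:R.
  rewrite (csum_single (i0 := t)) => [|t' tt']; first by rewrite hD eqxx andbT.
  by rewrite hD (negbTE tt') andbF mulr0.
rewrite (csum_single (i0 := s)) => [|s' ss']; first by rewrite inner eqxx mulr1.
by rewrite inner (negbTE ss') !mulr0.
Qed.

Lemma csum_delta_three (k1 f1 : int -> C) (k2 f2 D : int -> int -> C)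
    (k3 : int -> int -> int -> C) s t :
  (forall s' t', D s' t' = ((s' == s) && (t' == t))%:R) ->
  csum (fun s1 => k1 s1 * (f1 s1 * csum (fun s2 => k2 s1 s2 * (f2 s1 s2 *
    csum (fun s3 => k3 s1 s2 s3 * D (s2 + s3) (s1 + s2)))))) =
  csum (fun u => k1 (t - u) * (f1 (t - u) * (k2 (t - u) u * (f2 (t - u) u *
    k3 (t - u) u (s - u))))).
Proof.
move=> hD.
have tb : bijective (fun u : int => t - u) by exists (fun u => t - u) => u; ring.
rewrite (csum_bij _ tb); congr csum; apply/funext => u; congr (_ * (_ * _)).
have inner s2 : csum (fun s3 => k3 (t - u) s2 s3 * D (s2 + s3) (t - u + s2)) =
    k3 (t - u) s2 (s - s2) * (s2 == u)%:R.
  have e : (t - u + s2 == t) = (s2 == u) by apply/eqP/eqP; lia.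
  rewrite (csum_single (i0 := s - s2)) => [|s3 h3].
    have es : s2 + (s - s2) = s by ring.
    by rewrite hD e es eqxx.
  rewrite hD; have -> : (s2 + s3 == s) = false; last by rewrite mulr0.
  by apply/eqP => h; move/eqP: h3; lia.
rewrite (csum_single (i0 := u)) => [|s2 h2]; first by rewrite inner eqxx mulr1.
by rewrite inner (negbTE h2) !mulr0.
Qed.

(** The exponents of ph on the two sides of the pentagon equation agree for each
    value of the free parameter u. *)
Lemma pentagon_phase (i j k l m n s t u : int) :
  ph ^ (s * (m - k) - s * s - 2 * l * s) * ph ^ (t * (k + s - i) - t * t - 2 * j * t) =
  ph ^ ((t - u) * (k - i) - (t - u) * (t - u) - 2 * j * (t - u)) *
  (ph ^ (- (2 * ((l - (t - u)) * n))) *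
  (ph ^ (u * (m - (i + (t - u))) - u * u - 2 * (j + (t - u)) * u) *
  (ph ^ (2 * ((n - u) * (l - (t - u)))) *
  ph ^ ((s - u) * (m - (i + (t - u)) - (j + (t - u)) - u - (k - i - j - (t - u))) -
     (s - u) * (s - u) - 2 * (l - (t - u)) * (s - u))))).
Proof. by rewrite -!(phD r0); congr (ph ^ _); ring. Qed.

Lemma theF_pentagon x : l2 x ->
  leg23 (I := L) F (leg12 (K := L) F x) =
  leg12 (K := L) F (leg23 (I := L) (Psi q) (leg12 (K := L) F
    (leg23 (I := L) (adj (Psi q)) (leg23 (I := L) F x)))).
Proof.
have bF : bounded_op F by apply: unitary_bounded; exact: unitary_theF.
have bP : bounded_op (Psi q) by apply: unitary_bounded; exact: Psi_unitary.
have bP' : bounded_op (adj (Psi q)) by apply: unitary_bounded; exact: adj_Psi_unitary.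
have b12 := @bounded_leg12 R L L L _ bF; have b23 := @bounded_leg23 R L L L _ bF.
have S1 := bounded_comp b23 b12.
have S2 := bounded_comp b12 (bounded_comp (@bounded_leg23 R L L L _ bP)
  (bounded_comp b12 (bounded_comp (@bounded_leg23 R L L L _ bP') b23))).
apply: (bounded_op_ext S1 S2) => p0.
apply/funext => -[[[i j] [k l]] [m n]].
rewrite [LHS]pentagon_left [RHS]pentagon_right /fsrc /=.
pose P s t : LLL := ((i + t, j + t), (k + s - i - j - t, l + s - t), (m - k - l - s, n - s)).
have PE1 s t : ((i + t, j + t), (k + s - i - j - t, l + s - t), (m - k - l - s, n - s)) = P s t by [].
have PE2 s1 s2 s3 :
  (i + s1 + s2, j + s1 + s2, (k - i - j - s1 + s3, l - s1 + s3),
   (m - (i + s1) - (j + s1) - s2 - (k - i - j - s1) - (l - s1) - s3, n - s2 - s3)) =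
  P (s2 + s3) (s1 + s2) by rewrite /P; congr ((_, _), (_, _), (_, _)); ring.
have Pinj s t s' t' : P s t = P s' t' -> s = s' /\ t = t'.
  by move=> [h _ _ _ _ h']; lia.
have [[[s t] p0E]|nP] := pselect (exists st : int * int, p0 = P st.1 st.2); last first.
  have D0 s t : delta R p0 (P s t) = 0.
    by rewrite /delta; case: eqP => // e; exfalso; apply: nP; exists (s, t).
  transitivity (0 : C).
    rewrite -[RHS](csum0 R int); congr csum; apply/funext => s.
    have -> : (fun t => fcoef q ((i, j), (k + s, l + s)) t * delta R p0 ((i + t, j + t),
        (k + s - i - j - t, l + s - t), (m - k - l - s, n - s))) = (fun _ => 0).
      by apply/funext => t; rewrite PE1 D0 mulr0.
    by rewrite csum0 mulr0.
  symmetry; rewrite -[RHS](csum0 R int); congr csum; apply/funext => s1.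
  rewrite (_ : csum _ = 0) ?mulr0// -[RHS](csum0 R int); congr csum; apply/funext => s2.
  rewrite (_ : csum _ = 0) ?mulr0// -[RHS](csum0 R int); congr csum; apply/funext => s3.
  by rewrite PE2 D0 mulr0.
pose D s' t' : C := delta R p0 (P s' t').
have hD s' t' : D s' t' = ((s' == s) && (t' == t))%:R.
  rewrite /D p0E /delta; congr ((nat_of_bool _)%:R); apply/eqP/andP => [/Pinj[-> ->]//|[/eqP-> /eqP->]//].
rewrite (csum_delta_two (fun s' => fcoef q ((k, l), (m, n)) s')
  (fun s' t' => fcoef q ((i, j), (k + s', l + s')) t') hD).
transitivity (csum (fun u => fcoef q ((i, j), (k, l)) (t - u) *
  (ph ^ (- (2 * ((l - (t - u)) * n))) * (fcoef q ((i + (t - u), j + (t - u)), (m, n)) u *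
  (ph ^ (2 * ((n - u) * (l - (t - u)))) *
   fcoef q ((k - i - j - (t - u), l - (t - u)), (m - (i + (t - u)) - (j + (t - u)) - u, n - u)) (s - u)))))).
  pose E := ph ^ (s * (m - k) - s * s - 2 * l * s) * ph ^ (t * (k + s - i) - t * t - 2 * j * t).
  pose y := k - i + 1; pose x0 := m - k + 1.
  have -> : (fun u => fcoef q ((i, j), (k, l)) (t - u) *
      (ph ^ (- (2 * ((l - (t - u)) * n))) * (fcoef q ((i + (t - u), j + (t - u)), (m, n)) u *
      (ph ^ (2 * ((n - u) * (l - (t - u)))) *
       fcoef q ((k - i - j - (t - u), l - (t - u)), (m - (i + (t - u)) - (j + (t - u)) - u, n - u)) (s - u))))) =
      (fun u => E * (penta r x0 s y t u)%:C).
    apply/funext => u; rewrite /E (pentagon_phase i j k l m n s t u) /fcoef /= /penta.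
    have -> : m - (i + (t - u)) + 1 = x0 + y - 1 - t + u by rewrite /x0 /y; ring.
    have -> : m - (i + (t - u)) - (j + (t - u)) - u - (k - i - j - (t - u)) + 1 = x0 - t.
      by rewrite /x0; ring.
    rewrite -/y !rmorphM/=; ring.
  have sp : asum (fun u => (penta r x0 s y t u)%:C : C).
    have := rsummable_penta r0 r1 x0 s y t; rewrite /asum /rsummable.
    by congr (psum _ < _)%E; apply/funext => u; rewrite cabsR.
  rewrite (csumZ E sp) csum_real (cser_pentagon r0 r1 x0 s y t) /fcoef /= /E.
  have -> : k + s - i + 1 = y + s by rewrite /y; ring.
  by rewrite -/x0 rmorphM/=; ring.
symmetry; rewrite -(csum_delta_three (fun s1 => fcoef q ((i, j), (k, l)) s1)
  (fun s1 => ph ^ (- (2 * ((l - s1) * n))))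
  (fun s1 s2 => fcoef q ((i + s1, j + s1), (m, n)) s2)
  (fun s1 s2 => ph ^ (2 * ((n - s2) * (l - s1))))
  (fun s1 s2 s3 => fcoef q ((k - i - j - s1, l - s1), (m - (i + s1) - (j + s1) - s2, n - s2)) s3) hD).
congr csum; apply/funext => s1; congr (_ * (_ * csum _)); apply/funext => s2.
by congr (_ * (_ * csum _)); apply/funext => s3; rewrite PE2.
Qed.

End Pentagon.

(** * Manageability *)

Section Functionals.
Variables (R : realType) (I J : choiceType).
Local Notation C := R[i].

Lemma inner_tens_delta (i0 : I) (u : J -> C) (v : I * J -> C) :
  inner (tens (delta R i0) u) v = csum (fun j => conjc (u j) * v (i0, j)).
Proof.
rewrite /inner (@csum_reindex R (I * J)%type J (pair i0)) => [|j j' [//]|[i j] h].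
  by congr csum; apply/funext => j; rewrite /= /tens /delta eqxx mul1r conjE.
rewrite /tens /delta conjE; case: eqP => [e|_]; last by rewrite mul0r conjc0 mul0r.
by case: (h j); rewrite /= in e; rewrite e.
Qed.

Lemma tens_left_functional (u : J -> C) (v : I * J -> C) : l2 u -> l2 v ->
  linear_fun (fun x => inner (tens (conjv x) u) v) /\
  forall x, l2 x -> cabs (inner (tens (conjv x) u) v) ^+ 2 <= nsq u * nsq v * nsq x.
Proof.
move=> hu hv; have hc x : l2 x -> l2 (conjv x : I -> C).
  by move=> hx; rewrite /l2 /conjv sqnorm_conj.
split=> [a x y hx hy|x hx].
  rewrite !(inner_conj v).
  have -> : tens (conjv (fun i => a * x i + y i)) u =
      fun p => conjc a * tens (conjv x) u p + tens (conjv y) u p.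
    by apply/funext => p; rewrite /tens /conjv conjcD conjcM mulrDl mulrA.
  have [h1 _] := l2_tens (hc x hx) hu; have [h2 _] := l2_tens (hc y hy) hu.
  by rewrite inner_linr// conjcD conjcM conjcK.
have [h1 h2] := l2_tens (hc x hx) hu.
apply: (le_trans (inner_le h1 hv)); rewrite h2 [nsq (conjv x)]/nsq /conjv sqnorm_conj -/(nsq x).
by rewrite le_eqVlt; apply/orP; left; apply/eqP; ring.
Qed.

Lemma tens_right_functional (K : choiceType) (T : op R (I * J)%type K) (w : J -> C) (z : K -> C) :
  bounded_op T -> l2 w -> l2 z ->
  linear_fun (fun y => inner z (T (tens y w))) /\
  exists M, forall y, l2 y -> cabs (inner z (T (tens y w))) ^+ 2 <= M * nsq y.
Proof.
move=> [[Tl2 Tlin] [M hM]] hw hz; split=> [a x y hx hy|].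
  have -> : tens (fun i => a * x i + y i) w = fun p => a * tens x w p + tens y w p.
    by apply/funext => p; rewrite /tens mulrDl mulrA.
  have [h1 _] := l2_tens hx hw; have [h2 _] := l2_tens hy hw.
  by rewrite Tlin// inner_linr//; exact: Tl2.
exists (nsq z * (M * nsq w)) => y hy; have [h1 h2] := l2_tens hy hw.
apply: (le_trans (inner_le hz (Tl2 _ h1))).
have : nsq (T (tens y w)) <= M * nsq (tens y w).
  have := hM _ h1; rewrite (l2_sqnorm h1) (l2_sqnorm (Tl2 _ h1)) -EFinM lee_fin.
  by [].
move=> /(ler_wpM2l (nsq_ge0 z)) h; apply: (le_trans h); rewrite h2.
by rewrite le_eqVlt; apply/orP; left; apply/eqP; ring.
Qed.

End Functionals.

Section Manageable.
Variables (R : realType) (q : R[i]).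
Local Notation C := R[i].
Local Notation L := (int * int)%type.
Local Notation LL := ((int * int) * (int * int))%type.
Local Notation r := (cabs q).
Local Notation ph := (phase q).
Local Notation T2 := (measurableTypeR R * measurableTypeR R)%type.
Local Notation c := (cser (cabs q)).
Local Notation F := (theF q).
Hypotheses (r0 : 0 < r) (r1 : r < 1).
Implicit Types (p : LL) (s t : int).

Let rpos s : 0 < r ^ s. Proof. exact: exprz_gt0. Qed.
Let rn0 : r != 0. Proof. by rewrite gt_eqF. Qed.

Definition QL : uop R L := diag_uop (fun a : L => r ^ a.2).

Lemma tens_QL : tens_uop QL QL = diag_uop (fun p => r ^ (p.1.2 + p.2.2)).
Proof.
apply/funext => z; apply/funext => w; apply/propext; rewrite tens_diag_uop.
have -> : (fun p => r ^ p.1.2 * r ^ p.2.2) = (fun p => r ^ (p.1.2 + p.2.2)) by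
  apply/funext => p; rewrite (expfzDr _ _ rn0).
by [].
Qed.

Lemma tens_QL_id : tens_uop QL (@id_uop R int) = diag_uop (fun p : L * int => r ^ p.1.2).
Proof.
apply/funext => z; apply/funext => w; apply/propext; rewrite id_uop_diag tens_diag_uop.
have -> : (fun p : L * int => r ^ p.1.2 * 1) = (fun p : L * int => r ^ p.1.2) by
  apply/funext => p; rewrite mulr1.
by [].
Qed.

(** F shifts the two degrees j and l by opposite amounts. *)
Lemma conj_F_QL z w : conj_uop F (tens_uop QL QL) z w <-> tens_uop QL QL z w.
Proof.
rewrite tens_QL; apply: (@conj_diag_uop R _ _ (fun p => p.1.2 + p.2.2) (fun n => r ^ n)).
  exact: unitary_theF.
move=> n x hx; rewrite !(theFE r0 r1); apply/funext => p.
have e s : (fsrc s p).1.2 + (fsrc s p).2.2 = p.1.2 + p.2.2 by rewrite /fsrc /=; ring.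
case: ifP => hp.
  by congr csum; apply/funext => s; rewrite e hp.
rewrite -[RHS](csum0 R int); congr csum; apply/funext => s.
by rewrite e hp mulr0.
Qed.

Lemma conj_U_QL z w : conj_uop (@U R) (tens_uop QL (@id_uop R int)) z w <->
  tens_uop QL (@id_uop R int) z w.
Proof.
rewrite tens_QL_id.
apply: (@conj_diag_uop R _ _ (fun p : L * int => p.1.2) (fun n => r ^ n)).
  exact: U_unitary.
by move=> n x hx; rewrite !UE.
Qed.

(** The sign accounts for that in cser_flip. *)
Definition gauge' p : C := ((-1) ^ p.1.2)%:C * ph ^ (p.1.2 * (p.2.1 - p.1.1)).

Definition lrefl p : LL := (p.1, (p.2.1, - p.2.2)).

Definition gsrc p : LL := (p.1, (p.2.1 - p.1.1 - p.1.2, - p.2.2)).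

Definition Ft : op R LL LL :=
  monomial (fun _ => 1) lrefl \o (Phi r gauge' (fun z : T2 => Fq q (toC z)) \o
    monomial (fun p => ph ^ (- (4 * (p.1.2 * p.2.2)))) gsrc).

Let sgn2 s : (-1 : R) ^ s * (-1) ^ s = 1.
Proof. by rewrite -exprzMl ?mulrNN ?mulr1 ?exp1rz// unitrN1. Qed.

Let sgnD s t : (-1 : R) ^ (s + t) = (-1) ^ s * (-1) ^ t.
Proof. by rewrite expfzDr// oppr_eq0 oner_eq0. Qed.

Let sgnN s : (-1 : R) ^ (- s) = (-1) ^ s.
Proof.
have n0 : (-1 : R) ^ s != 0 by rewrite expfz_neq0// oppr_eq0 oner_eq0.
by apply: (mulIf n0); rewrite -sgnD addNr expr0z sgn2.
Qed.

Lemma cabs_gauge' p : cabs (gauge' p) = 1.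
Proof.
rewrite /gauge' cabsM (cabs_phX r0) mulr1 cabsR; apply/eqP.
by rewrite -sqrp_eq1// -normrX expr2 sgn2 normr1.
Qed.

Lemma gauge'_tau s p : gauge' p * conjc (gauge' (tau s p)) =
  ((-1) ^ s)%:C * ph ^ (- s * (p.2.1 - p.1.1)).
Proof.
rewrite /gauge' conjcM conjc_real (conj_phX r0) mulrACA -(phD r0) -rmorphM/= sgnD mulrA sgn2 mul1r.
by congr (_ * ph ^ _); ring.
Qed.

Lemma Ft_unitary : unitary_op Ft.
Proof.
apply: unitary_comp; last apply: unitary_comp.
- apply: monomial_unitary; first by move=> _; exact: cabs1.
  by exists lrefl => -[a [k l]]; rewrite /lrefl /= opprK.
- apply: Phi_unitary.
  + by move=> p; exact: cabs_gauge'.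
  + exact: bmeasurable_Fq.
  + by move=> z; exact: cabs_Fq.
- apply: monomial_unitary; first by move=> p; exact: cabs_phX.
  exists (fun p : LL => (p.1, (p.2.1 + p.1.1 + p.1.2, - p.2.2))) => -[[i j] [k l]];
    rewrite /gsrc /=; congr (_, (_, _)); ring.
Qed.

Definition tsrc s p : LL := ((p.1.1 - s, p.1.2 - s),
  (p.2.1 - p.1.1 - p.1.2 + s, p.2.2 - s)).

Definition tcoef p s : C := ph ^ (4 * ((p.1.2 - s) * (p.2.2 - s)) + s * (p.2.1 - p.1.1)) *
  ((-1) ^ s * c (p.2.1 - p.1.1 + 1) (- s))%:C.

Lemma FtE (x : LL -> C) : Ft x = fun p => csum (fun s => tcoef p s * x (tsrc s p)).
Proof.
apply/funext => p; pose g := fun y p' => ph ^ (- (4 * (p'.1.2 * p'.2.2))) * y (gsrc p') : C.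
transitivity (csum (fun s => gauge' (lrefl p) * conjc (gauge' (tau s (lrefl p))) *
    ofourier r (fun z : T2 => Fq q (toC z)) (lrefl p) s * g x (tau s (lrefl p)))).
  by rewrite /Ft /= /monomial mul1r.
have ob : bijective (fun s : int => - s) by exists (fun s => - s); exact: opprK.
rewrite (csum_bij _ ob); congr csum; apply/funext => s.
rewrite gauge'_tau ofourier_Fq// /g /tcoef sgnN.
have -> : gsrc (tau (- s) (lrefl p)) = tsrc s p.
  by case: p => [[i j] [k l]]; rewrite /gsrc /tau /lrefl /tsrc /=; congr (_, (_, _)); ring.
rewrite (phD r0) rmorphM /=.
have -> : - - s * (p.2.1 - p.1.1) = s * (p.2.1 - p.1.1) by ring.
have -> : - (4 * ((p.1.2 - s) * (- p.2.2 - - s))) = 4 * ((p.1.2 - s) * (p.2.2 - s)) by ring.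
by ring.
Qed.

(** The two matrix coefficients have the same support; on it the identity
    reduces to cser_flip. *)
Lemma matrix_identity_delta (a b : L) (u u' w w' : L -> C) : QL u u' -> QL w' w ->
  inner (tens (delta R a) u) (adj (Zop q) (F (tens (delta R b) w))) =
  inner (tens (delta R b) u') (Ft (adj (Ztilde q) (tens (delta R a) w'))).
Proof.
move=> [_ _ eu] [_ _ ew]; rewrite !inner_tens_delta.
rewrite (adj_ZopE r0) (theFE r0 r1) FtE (adj_ZtildeE r0).
case: a b => [i j] [i' j'].
have [e|ne] := pselect (j' - j = i' - i); last first.
  transitivity (0 : C).
    rewrite -[RHS](csum0 R L); congr csum; apply/funext => -[k l].
    rewrite (_ : csum _ = 0) ?mulr0//= -[RHS](csum0 R int); congr csum; apply/funext => s.
    rewrite /tens /delta /fsrc /= xpair_eqE.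
    case: eqP => [h1|_]; last by rewrite mul0r mulr0.
    case: eqP => [h2|_]; last by rewrite mul0r mulr0.
    by exfalso; apply: ne; rewrite -h1 -h2; ring.
  symmetry; rewrite -[RHS](csum0 R L); congr csum; apply/funext => -[k l].
  rewrite (_ : csum _ = 0) ?mulr0//= -[RHS](csum0 R int); congr csum; apply/funext => s.
  rewrite /tens /delta /tsrc /= xpair_eqE.
  case: eqP => [h1|_]; last by rewrite mul0r !mulr0.
  case: eqP => [h2|_]; last by rewrite mul0r !mulr0.
  by exfalso; apply: ne; rewrite -h1 -h2; ring.
pose s := i' - i.
have ei : i' = i + s by rewrite /s; ring.
have ej : j' = j + s by rewrite /s -e; ring.
rewrite {}ei {}ej; congr csum; apply/funext => -[k l] /=.
rewrite (csum_single (i0 := s)); last first.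
  move=> t ts; rewrite /tens /delta /fsrc /= xpair_eqE.
  have -> : (i + t == i + s) = false by rewrite (inj_eq (addrI i)) (negbTE ts).
  by rewrite mul0r mulr0.
rewrite (csum_single (i0 := s)); last first.
  move=> t ts; rewrite /tens /delta /tsrc /= xpair_eqE.
  have -> : (i + s - t == i) = false by apply/eqP => h; move/eqP: ts; lia.
  by rewrite mul0r !mulr0.
rewrite /tens /delta /fsrc /tsrc /= !eqxx !addrK eqxx !mul1r.
have -> : k - (i + s) - (j + s) + s = k - i - j - s by ring.
rewrite eu ew /= conjcM conjc_real /fcoef /tcoef /= !addrK.
have -> : k - (i + s) + 1 = (k - i + 1) - s by ring.
have es : k - i + 1 - s + s = k - i + 1 by ring.
rewrite (cser_flip r0 r1) es.
have -> : (-1) ^ s * ((-1) ^ s * r ^ (- s) * c (k - i + 1) s) = r ^ (- s) * c (k - i + 1) s.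
  by rewrite !mulrA sgn2 mul1r.
rewrite rmorphM/= (expfzDr l (- s) rn0) rmorphM/=.
have p1 : ph ^ (2 * (j * l)) * ph ^ (s * (k - i) - s * s - 2 * j * s) =
    ph ^ (4 * (j * (l - s)) + s * (k - (i + s))) * ph ^ (- (2 * (j * (l - s)))).
  by rewrite -!(phD r0); congr (ph ^ _); ring.
move: (conjc (u _)) (w' _) (c _ _) (r ^ l) (r ^ (- s)) => uc wc cc x1 x2.
transitivity (uc * wc * cc%:C * x1%:C * x2%:C *
  (ph ^ (2 * (j * l)) * ph ^ (s * (k - i) - s * s - 2 * j * s))); first by ring.
by rewrite p1; ring.
Qed.

(** Both sides are bounded and linear in y, and antilinear in x; conjugating x
    makes functional_ext applicable to it too. *)
Lemma matrix_identity (x y u u' w w' : L -> C) : l2 x -> l2 y -> QL u u' -> QL w' w ->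
  inner (tens x u) (adj (Zop q) (F (tens y w))) =
  inner (tens (conjv y) u') (Ft (adj (Ztilde q) (tens (conjv x) w'))).
Proof.
move=> hx hy Qu Qw; have [hu hu' _] := Qu; have [hw' hw _] := Qw.
have conj_delta (a : L) : conjv (delta R a) = delta R a.
  by apply/funext => b; rewrite /conjv /delta; case: eqP; rewrite ?conjc1 ?conjc0.
pose S : op R LL LL := adj (Zop q) \o F; pose S' : op R LL LL := Ft \o adj (Ztilde q).
have bS : bounded_op S.
  by apply: unitary_bounded; apply: unitary_comp; [exact: adj_Zop_unitary|exact: unitary_theF].
have bS' : bounded_op S'.
  by apply: unitary_bounded; apply: unitary_comp; [exact: Ft_unitary|exact: adj_Ztilde_unitary].
have l2S z : l2 z -> l2 (S z) by case: bS => -[h _] _ /h.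
have l2S' z : l2 z -> l2 (S' z) by case: bS' => -[h _] _ /h.
have conjK (z : L -> C) : conjv (conjv z) = z by apply/funext => a; rewrite /conjv conjcK.
have l2c (z : L -> C) : l2 z -> l2 (conjv z) by move=> hz; rewrite /l2 /conjv sqnorm_conj.
have step (a : L) z : l2 z ->
    inner (tens (conjv z) u) (S (tens (delta R a) w)) =
    inner (tens (conjv (delta R a)) u') (S' (tens z w')).
  move=> hz; have [h1 _] := l2_tens (l2_delta R a) hw.
  have [lin1 bd1] := tens_left_functional hu (l2S _ h1).
  have [h2 _] := l2_tens (l2c _ (l2_delta R a)) hu'.
  have [lin2 [M bd2]] := tens_right_functional bS' hw' h2.
  apply: (functional_ext lin1 lin2 bd1 bd2) hz => b.
  by rewrite !conj_delta; exact: matrix_identity_delta.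
have [h1 _] := l2_tens hx hu.
have [lin1 [M bd1]] := tens_right_functional bS hw h1.
have [h2 _] := l2_tens (l2c _ hx) hw'.
have [lin2 bd2] := tens_left_functional hu' (l2S' _ h2).
apply: (functional_ext lin1 lin2 bd1 bd2) hy => b.
by rewrite -{1}(conjK x); exact: (step b _ (l2c _ hx)).
Qed.

End Manageable.

Theorem theorem4p6 (R : realType) (q : R[i]) :
  0 < `|q| -> `|q| < 1 ->
  exists FX : op R ((int * int) * (int * int))%type ((int * int) * (int * int))%type,
    is_fun_calc (X q) (Cbar q) (Fq q) FX /\
    (let F := FX \o @Y R in
     braided_multiplicative_unitary (@U R) (Psi q) F /\
     manageable (@U R) (@id_uop R int) (Zop q) (Ztilde q) F).
Proof.
rewrite normE ltcR => r0; rewrite ltcR => r1.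
exists (FX q); split; first exact: FX_fun_calc.
split; first split.
- exact: unitary_theF.
- by move=> x _; exact: theF_covariant.
- by move=> x hx; exact: theF_pentagon.
exists (QL q), (Ft q); split.
- by apply: diag_uop_strictly_positive => a; exact: exprz_gt0.
- exact: Ft_unitary.
- exact: conj_F_QL.
- exact: conj_U_QL.
- exact: matrix_identity.
Qed.
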